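(* Let $\Omega\subseteq\mathbb R^d$ be open, $m\in\mathbb N$, $l\in\{0,\dots,m\}$, and let $u_n\rightharpoonup 0$ weakly in $L^2_{\rm loc}(\Omega;\mathbb C^r)$ satisfy $$\sum_{l\le|\alpha|\le m}\varepsilon_n^{|\alpha|-l}\,\partial_\alpha(A_n^\alpha u_n)=f_n\quad\text{in }\Omega,$$ where $0<\varepsilon_0\le\varepsilon_n\le\varepsilon_\infty<\infty$ for all $n$ (with constants $\varepsilon_0,\varepsilon_\infty$), $A_n^\alpha\in C(\Omega;\mathrm M_{q\times r}(\mathbb C))$, $A_n^\alpha\to A^\alpha$ locally uniformly on $\Omega$ for every $\alpha$ with $l\le|\alpha|\le m$, and $(f_n)$ is a sequence in $H^{-m}_{\rm loc}(\Omega;\mathbb C^q)$ such that for every $\varphi\in C_c^\infty(\Omega)$ $$\frac{\widehat{\varphi f_n}}{1+\sum_{s=l}^m\varepsilon_n^{s-l}|\xi|^s}\longrightarrow 0\quad\text{strongly in }L^2(\mathbb R^d;\mathbb C^q).$$ Let $\mu_H$ be the H-measure associated to (a subsequence of) $(u_n)$. Then $$p_{pr}\,\mu_H^\top=0\quad\text{on }\Omega\times S^{d-1},\qquad p_{pr}(x,\xi)=\sum_{|\alpha|=m}(2\pi i)^m\Big(\frac{\xi}{|\xi|}\Big)^\alpha A^\alpha(x).$$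
   Context: Conventions: functions on $\Omega$ are extended by zero to $\mathbb R^d$; $\hat u(\xi)=\int_{\mathbb R^d}e^{-2\pi i x\cdot\xi}u(x)\,dx$; $(a\otimes b)_{ij}=a_i\overline{b_j}$. $f\in H^{-m}_{\rm loc}(\Omega)$ means $\varphi f\in H^{-m}(\mathbb R^d)$ for all $\varphi\in C_c^\infty(\Omega)$. H-measure: if $u_n\rightharpoonup0$ in $L^2_{\rm loc}(\Omega;\mathbb C^r)$, then, after passing to a subsequence, there is an $r\times r$ hermitian non-negative matrix Radon measure $\mu_H$ on $\Omega\times S^{d-1}$ such that for all $\varphi_1,\varphi_2\in C_c(\Omega)$ and $\psi\in C(S^{d-1})$ $$\lim_n\int_{\mathbb R^d}\big(\widehat{\varphi_1u_n}(\xi)\otimes\widehat{\varphi_2u_n}(\xi)\big)\psi\Big(\frac{\xi}{|\xi|}\Big)\,d\xi=\int_{\Omega\times S^{d-1}}\varphi_1(x)\overline{\varphi_2(x)}\psi(\xi)\,d\bar\mu_H(x,\xi),$$ where $\bar\mu_H$ is the entrywise complex conjugate; $\mu_H$ is called the H-measure associated to the (sub)sequence. *)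

(* Defs.v *)
From HB Require Import structures.
From mathcomp Require Import all_boot all_order all_algebra.
From mathcomp Require Import all_classical all_reals all_analysis.
From mathcomp Require Import measurable_realfun.
From mathcomp.real_closed Require Import complex.

Set Implicit Arguments.
Unset Strict Implicit.
Unset Printing Implicit Defensive.

Import Order.TTheory GRing.Theory Num.Theory.
Import numFieldNormedType.Exports.

Local Open Scope classical_set_scope.
Local Open Scope ring_scope.

(* The library provides no sigma-algebra on 'rV[R]_n.  As it does for tuples,
   we take the one generated by the coordinates; [measurable_rVE] below shows
   that it is the Borel sigma-algebra. *)
Section rV_measurable.
Context {R : realType} {n : nat}.

Let coors : 'I_n -> 'rV[R]_n -> R := fun i x => x ord0 i.

Let rV_set0 : g_sigma_preimage coors set0.
Proof. exact: sigma_algebra0. Qed.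

Let rV_setC A : g_sigma_preimage coors A -> g_sigma_preimage coors (~` A).
Proof. exact: sigma_algebraC. Qed.

Let rV_bigcup (F : _^nat) : (forall i, g_sigma_preimage coors (F i)) ->
  g_sigma_preimage coors (\bigcup_i (F i)).
Proof. exact: sigma_algebra_bigcup. Qed.

HB.instance Definition _ := @isMeasurable.Build default_measure_display
  'rV[R]_n (g_sigma_preimage coors) rV_set0 rV_setC rV_bigcup.

Lemma measurable_rV_coord (i : 'I_n) :
  measurable_fun [set: 'rV[R]_n] (fun x : 'rV[R]_n => x ord0 i).
Proof.
move=> _ Y mY; rewrite setTI; apply: sub_sigma_algebra => /=.
rewrite -bigcup_seq/=; exists i => /=; first by rewrite mem_index_enum.
by exists Y => //; rewrite setTI.
Qed.

Lemma measurable_rVE :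
  measurable = <<s [set A : set 'rV[R]_n | open A] >> :> set (set 'rV[R]_n).
Proof.
apply/seteqP; split=> A.
  apply: smallest_sub; first exact: smallest_sigma_algebra.
  move=> B; rewrite -bigcup_seq => -[i _ [C mC <-]]; rewrite setTI.
  have : measurable_fun (setT : set (g_sigma_algebraType
      [set A : set 'rV[R]_n | open A])) (coors i).
    apply: (measurability _ (RGenOpens.measurableE R)).
    move=> _ [_ [a [b ->] <-]]; rewrite setTI.
    apply: sub_sigma_algebra => /=.
    apply: open_comp; last exact: interval_open.
    by move=> x _; exact: coord_continuous.
  by move=> /(_ measurableT _ mC); rewrite setTI.
apply: smallest_sub; first exact: sigma_algebra_measurable.
move=> {}A /= oA.
pose Q (p : 'rV[rat]_n * nat) : set 'rV[R]_n :=
  [set x | forall i, `|ratr (p.1 ord0 i) - x ord0 i| < p.2.+1%:R^-1].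
have -> : A = \bigcup_(p in [set p | Q p `<=` A]) Q p.
  apply/seteqP; split=> [x Ax|x [p /= QA /QA //]].
  have /nbhs_ballP[e /= e0 xeA] : nbhs x A by exact: open_nbhs_nbhs.
  have [k ke] : exists k : nat, (k.+1%:R^-1 : R) < e / 2.
    have e20 : 0 < e / 2 by rewrite divr_gt0.
    have [k _ kP] := near_infty_natSinv_lt (PosNum e20).
    by exists k; exact: (kP k (leqnn k)).
  have /choice[q qP] : forall i, exists q : rat,
      `|ratr q - x ord0 i| < (k.+1%:R^-1 : R).
    move=> i.
    have : x ord0 i - (k.+1%:R^-1 : R) < x ord0 i + k.+1%:R^-1.
      by rewrite ltrD2l gtrN// invr_gt0.
    move=> /rat_in_itvoo[q]; rewrite in_itv/= => qx; exists q.
    by rewrite ltr_distl.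
  exists (\row_i q i, k); last by move=> i /=; rewrite mxE.
  move=> y /= yQ; apply: xeA; split=> // i j; rewrite !ord1 /ball/=.
  have := yQ j; rewrite mxE => yj.
  rewrite -(subrK (ratr (q j)) (x ord0 j)) -addrA.
  rewrite (le_lt_trans (ler_normD _ _))// [e]splitr ltrD//.
    by rewrite distrC (lt_trans (qP j)).
  by rewrite (lt_trans yj).
rewrite bigcup_mkcond; apply: countable_bigcupT_measurable => // p.
case: ifPn => // _.
have -> : Q p = \big[setI/setT]_i
    (coors i @^-1` [set t : R | `|ratr (p.1 ord0 i) - t| < p.2.+1%:R^-1]).
  rewrite -bigcap_seq; apply/seteqP; split=> x /= H i; first by move=> _; exact: H.
  by apply: (H i); rewrite /= mem_index_enum.
apply: bigsetI_measurable => i _; rewrite -[_ @^-1` _]setTI.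
apply: measurable_rV_coord => //; apply: open_measurable.
exact: ball_open.
Qed.

Lemma measurable_fun_rVP d (T : measurableType d) (f : T -> 'rV[R]_n) :
  (forall i, measurable_fun [set: T] (fun x => f x ord0 i)) ->
  measurable_fun [set: T] f.
Proof.
move=> mf.
suff H : g_sigma_preimage (fun i => coors i \o f) `<=` measurable.
  move=> _ A mA; apply: H; rewrite g_sigma_preimage_comp.
  by exists A.
apply: smallest_sub; first exact: sigma_algebra_measurable.
move=> A; rewrite -bigcup_seq => -[i _ [B mB <-]]; exact: mf.
Qed.

End rV_measurable.

Section rV_lebesgue_step.
Context {R : realType} {n : nat}.

Definition rV_cons (p : R * 'rV[R]_n) : 'rV[R]_n.+1 :=
  \row_i oapp (fun j => p.2 ord0 j) p.1 (unlift ord0 i).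

Definition rV_uncons (v : 'rV[R]_n.+1) : R * 'rV[R]_n :=
  (v ord0 ord0, \row_i v ord0 (lift ord0 i)).

Lemma rV_consK : cancel rV_cons rV_uncons.
Proof.
case=> x v; rewrite /rV_uncons /rV_cons !mxE unlift_none/=; congr (_, _).
by apply/rowP => i; rewrite !mxE liftK.
Qed.

Lemma rV_unconsK : cancel rV_uncons rV_cons.
Proof.
move=> v; apply/rowP => i; rewrite !mxE.
by case: unliftP => [j ->|->] //=; rewrite mxE.
Qed.

Lemma measurable_rV_cons : measurable_fun [set: R * 'rV[R]_n] rV_cons.
Proof.
apply: measurable_fun_rVP => i; under eq_fun do rewrite mxE.
case: unliftP => [j _|_] /=; last exact: measurable_fst.
exact: (measurableT_comp (measurable_rV_coord j) measurable_snd).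
Qed.

Lemma measurable_rV_uncons : measurable_fun [set: 'rV[R]_n.+1] rV_uncons.
Proof.
apply: measurable_fun_pair; first exact: measurable_rV_coord.
apply: measurable_fun_rVP => i; under eq_fun do rewrite mxE.
exact: measurable_rV_coord.
Qed.

Variable m : {sigma_finite_measure set 'rV[R]_n -> \bar R}.

Definition lebesgue_rV_step : set 'rV[R]_n.+1 -> \bar R :=
  pushforward (@lebesgue_measure R \x m)%E rV_cons.

Let step0 : lebesgue_rV_step set0 = 0%E.
Proof. by rewrite /lebesgue_rV_step /pushforward preimage_set0 measure0. Qed.

Let step_ge0 A : (0 <= lebesgue_rV_step A)%E.
Proof. by rewrite /lebesgue_rV_step /pushforward measure_ge0. Qed.

Let step_sigma_additive : semi_sigma_additive lebesgue_rV_step.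
Proof.
move=> F mF tF mUF; rewrite /lebesgue_rV_step /pushforward preimage_bigcup.
apply: measure_semi_sigma_additive.
- by move=> i; rewrite -[X in measurable X]setTI; exact: measurable_rV_cons.
- apply/trivIsetP => i j _ _ ij; rewrite -preimage_setI.
  by move/trivIsetP : tF => /(_ i j Logic.I Logic.I ij) ->; rewrite preimage_set0.
- by rewrite -preimage_bigcup -[X in measurable X]setTI; exact: measurable_rV_cons.
Qed.

HB.instance Definition _ := isMeasure.Build _ _ _ lebesgue_rV_step
  step0 step_ge0 step_sigma_additive.

Let step_sigma_finite : sigma_finite setT lebesgue_rV_step.
Proof.
have /sigma_finiteP[F [TF ndF Foo]] := sigma_finiteT (@lebesgue_measure R).
have /sigma_finiteP[G [TG ndG Goo]] := sigma_finiteT m.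
exists (fun k => rV_uncons @^-1` (F k `*` G k)).
  apply/seteqP; split=> // v _.
  have [i _ Fi] : (\bigcup_k F k) (rV_uncons v).1 by rewrite -TF.
  have [j _ Gj] : (\bigcup_k G k) (rV_uncons v).2 by rewrite -TG.
  exists (maxn i j) => //; split.
    by move: Fi; exact/subsetPset/ndF/leq_maxl.
  by move: Gj; exact/subsetPset/ndG/leq_maxr.
move=> k; have [mF Fk] := Foo k; have [mG Gk] := Goo k.
have mFG : measurable (F k `*` G k) by exact: measurableX.
split; first by rewrite -[X in measurable X]setTI; exact: measurable_rV_uncons.
rewrite /lebesgue_rV_step /pushforward -comp_preimage.
rewrite (_ : rV_uncons \o rV_cons = id); last first.
  by apply/funext => p /=; rewrite rV_consK.
by rewrite preimage_id product_measure1E// lte_mul_pinfty// ge0_fin_numE.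
Qed.

HB.instance Definition _ := Measure_isSigmaFinite.Build _ _ _ lebesgue_rV_step
  step_sigma_finite.

End rV_lebesgue_step.

Section rV_lebesgue.
Context {R : realType}.

Definition lebesgue_rV0 : set 'rV[R]_0 -> \bar R := \d_(0 : 'rV[R]_0).

HB.instance Definition _ := Measure.on lebesgue_rV0.

Let lebesgue_rV0_sigma_finite : sigma_finite setT lebesgue_rV0.
Proof.
exists (fun=> setT); first by rewrite bigcup_const.
by move=> _; split; rewrite // /lebesgue_rV0 diracT ltry.
Qed.

HB.instance Definition _ := Measure_isSigmaFinite.Build _ _ _ lebesgue_rV0
  lebesgue_rV0_sigma_finite.

Fixpoint lebesgue_rV (n : nat) : {sigma_finite_measure set 'rV[R]_n -> \bar R} :=
  if n is n'.+1 then lebesgue_rV_step (lebesgue_rV n') else lebesgue_rV0.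

Lemma lebesgue_rV_box n (a b : 'I_n -> R) : (forall i, a i <= b i) ->
  lebesgue_rV n [set x | forall i, a i <= x ord0 i <= b i] =
  (\prod_i (b i - a i))%:E.
Proof.
elim: n a b => [|n IHn] a b ab.
  rewrite big_ord0 /= /lebesgue_rV0 diracE mem_set//=.
  by move=> [].
pose B : set 'rV[R]_n :=
  [set x | forall i, a (lift ord0 i) <= x ord0 i <= b (lift ord0 i)].
have mB : measurable B.
  rewrite (_ : B = \big[setI/setT]_(i < n) ((fun x : 'rV[R]_n => x ord0 i)
      @^-1` `[a (lift ord0 i), b (lift ord0 i)]%classic)).
    apply: bigsetI_measurable => i _; rewrite -[X in measurable X]setTI.
    exact: measurable_rV_coord.
  rewrite -bigcap_seq; apply/seteqP; split=> x /= H i.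
    by move=> _; rewrite /= in_itv/= H.
  by have := H i; rewrite /= in_itv/=; apply; rewrite mem_index_enum.
have -> : lebesgue_rV n.+1 [set x | forall i, a i <= x ord0 i <= b i] =
    (@lebesgue_measure R \x lebesgue_rV n)%E
      (`[a ord0, b ord0]%classic `*` B).
  congr ((_ \x _)%E _); apply/seteqP; split=> -[x v] /=.
    move=> H; split; first by have := H ord0; rewrite mxE unlift_none/= in_itv.
    by move=> i; have := H (lift ord0 i); rewrite mxE liftK.
  move=> [+ H] i; rewrite in_itv/= mxE => H0.
  by case: unliftP => [j ->|->] //=; exact: H.
rewrite product_measure1E// IHn// big_ord_recl EFinM; congr (_ * _)%E.
rewrite [LHS]lebesgue_measure_itv/= lte_fin.
have [//|ba] := ltP (a ord0) (b ord0).
have /eqP -> : a ord0 == b ord0 by rewrite eq_le ab ba.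
by rewrite subrr.
Qed.

End rV_lebesgue.

Local Open Scope complex_scope.
Local Notation Re := complex.Re.
Local Notation Im := complex.Im.

(* Continuity, measurability, convergence, integration and differentiation of
   R[i]-valued objects are read off real and imaginary parts. *)
Section complex_valued.
Context {R : realType}.

Definition cabs2 (z : R[i]) : R := Re z ^+ 2 + Im z ^+ 2.

Definition cabs (z : R[i]) : R := Num.sqrt (cabs2 z).

Definition ccontinuous_on (T : topologicalType) (D : set T) (f : T -> R[i]) :=
  {within D, continuous (fun x => Re (f x))} /\
  {within D, continuous (fun x => Im (f x))}.

Definition ccvg (z : nat -> R[i]) (l : R[i]) :=
  ((fun n => Re (z n)) @ \oo --> Re l) /\ ((fun n => Im (z n)) @ \oo --> Im l).

Definition cmeasurable_on d (T : measurableType d) (D : set T) (f : T -> R[i]) :=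
  measurable_fun D (fun x => Re (f x)) /\ measurable_fun D (fun x => Im (f x)).

Definition cintegral d (T : measurableType d) (mu : {measure set T -> \bar R})
    (D : set T) (f : T -> R[i]) : R[i] :=
  (\int[mu]_(x in D) Re (f x)) +i* (\int[mu]_(x in D) Im (f x)).

Definition vabs2 r (v : 'cV[R[i]]_r) : R := \sum_j cabs2 (v j ord0).

End complex_valued.

Section test_functions.
Context {R : realType} {d : nat}.
Local Notation Rd := 'rV[R]_d.
Local Notation C := R[i].
Implicit Types (Omega K : set Rd) (i : 'I_d) (s : seq 'I_d).

Definition dotp (x y : Rd) : R := \sum_i x ord0 i * y ord0 i.

(* The norm of the library on 'rV[R]_d is the sup norm. *)
Definition enorm (x : Rd) : R := Num.sqrt (dotp x x).

Definition unit_sphere : set Rd := [set x | enorm x = 1].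

Definition compact_in (T : topologicalType) (K X : set T) :=
  compact K /\ K `<=` X.

Definition csupport (f : Rd -> C) : set Rd := closure [set x | f x != 0].

Definition Cc Omega (f : Rd -> C) :=
  ccontinuous_on setT f /\ compact_in (csupport f) Omega.

Definition partial i (f : Rd -> R) (x : Rd) : R := 'D_(delta_mx ord0 i) f x.

Definition partials s (f : Rd -> R) : Rd -> R := foldr partial f s.

Definition smooth (f : Rd -> R) := forall s,
  continuous (partials s f) /\
  (forall i x, derivable (partials s f) x (delta_mx ord0 i)).

Definition cpartials s (f : Rd -> C) (x : Rd) : C :=
  partials s (fun y => Re (f y)) x +i* partials s (fun y => Im (f y)) x.

Definition test_fun Omega (f : Rd -> C) :=
  [/\ smooth (fun x => Re (f x)), smooth (fun x => Im (f x)) &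
      compact_in (csupport f) Omega].

(* Only the values on [test_fun Omega] are meaningful.  The last field is
   continuity in its usual semi-norm form: on test functions supported in K the
   functional is bounded by the sup norms of finitely many derivatives. *)
Record sdistribution Omega := SDistribution {
  dist_fun :> (Rd -> C) -> C;
  dist_linear : forall (a : C) phi psi,
    test_fun Omega phi -> test_fun Omega psi ->
    dist_fun (fun x => a * phi x + psi x) = a * dist_fun phi + dist_fun psi;
  dist_continuous : forall K, compact_in K Omega ->
    exists (c : R) (N : nat), forall phi (B : R),
      test_fun Omega phi -> csupport phi `<=` K ->
      (forall s x, (size s <= N)%N -> cabs (cpartials s phi x) <= B) ->
      cabs (dist_fun phi) <= c * B }.

(* Multi-indices alpha with entries at most m; every alpha with |alpha| <= m is
   one of them. *)
Definition mindex (m : nat) := {ffun 'I_d -> 'I_m.+1}.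

Definition mlen m (alpha : mindex m) : nat := (\sum_i alpha i)%N.

Definition mdirs m (alpha : mindex m) : seq 'I_d :=
  flatten [seq nseq (alpha i) i | i <- enum 'I_d].

Definition mpow m (xi : Rd) (alpha : mindex m) : R :=
  \prod_i xi ord0 i ^+ alpha i.

(* <partial_alpha v, phi> in D'(Omega), for v locally integrable on Omega *)
Definition weak_partial m Omega (alpha : mindex m) (v phi : Rd -> C) : C :=
  (-1) ^+ mlen alpha *
  cintegral (lebesgue_rV d) Omega (fun x => v x * cpartials (mdirs alpha) phi x).

End test_functions.

Arguments unit_sphere : clear implicits.

Section function_spaces.
Context {R : realType} {d : nat}.
Local Notation Rd := 'rV[R]_d.
Local Notation C := R[i].
Local Notation leb := (lebesgue_rV d).
Implicit Types (Omega : set Rd).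

(* exp (- 2 pi i x . xi) *)
Definition fourier_kernel (xi x : Rd) : C :=
  cos (2 * pi * dotp x xi) -i* sin (2 * pi * dotp x xi).

Definition fourier (u : Rd -> C) (xi : Rd) : C :=
  cintegral leb setT (fun x => fourier_kernel xi x * u x).

(* Fourier transform of the compactly supported distribution phi f, as the
   pairing xi |-> <phi f, exp (- 2 pi i x . xi)>. *)
Definition fourier_dist Omega (f : sdistribution Omega) (phi : Rd -> C)
    (xi : Rd) : C :=
  f (fun x => phi x * fourier_kernel xi x).

Definition fourier_distv q Omega (f : 'I_q -> sdistribution Omega)
    (phi : Rd -> C) (xi : Rd) : 'cV[C]_q :=
  \col_k fourier_dist (f k) phi xi.

(* phi f is in H^{-m}(R^d; C^q), i.e. (1 + |xi|^2)^(-m/2) times its Fourier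
   transform is square integrable, for every test function phi. *)
Definition Hneg_loc q Omega (m : nat) (f : 'I_q -> sdistribution Omega) :=
  forall phi, test_fun Omega phi ->
  (\int[leb]_xi (vabs2 (fourier_distv f phi xi) / (1 + enorm xi ^+ 2) ^+ m)%:E
   < +oo)%E.

Definition L2loc r Omega (u : Rd -> 'cV[C]_r) :=
  (forall j, cmeasurable_on Omega (fun x => u x j ord0)) /\
  (forall K, compact_in K Omega -> (\int[leb]_(x in K) (vabs2 (u x))%:E < +oo)%E).

(* Weak convergence to 0 in the Frechet space L^2_loc, whose dual consists of
   the L^2 functions with compact support in Omega. *)
Definition weak_cvg0_L2loc r Omega (u : nat -> Rd -> 'cV[C]_r) :=
  (forall n, L2loc Omega (u n)) /\
  (forall g : Rd -> 'cV[C]_r, L2loc Omega g ->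
    (exists2 K, compact_in K Omega & forall x, ~ K x -> g x = 0) ->
    ccvg (fun n => cintegral leb Omega
      (fun x => \sum_j u n x j ord0 * (g x j ord0)^*)) 0).

(* Local uniform convergence, as uniform convergence on compact subsets. *)
Definition cvg_loc_unif q r Omega (A : nat -> Rd -> 'M[C]_(q, r))
    (A0 : Rd -> 'M[C]_(q, r)) :=
  forall K, compact_in K Omega -> forall e : R, 0 < e ->
  \forall n \near \oo, forall x, K x ->
  forall k j, cabs (A n x k j - A0 x k j) < e.

End function_spaces.

Section radon.
Context {R : realType} {d : nat}.
Local Notation Rd := 'rV[R]_d.
Local Notation C := R[i].
Implicit Types (X E : set (Rd * Rd)).

(* Positive Radon measures on X are represented by Borel measures on Rd * Rd of
   which only the restriction to X matters.  For the spaces X considered, open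
   subsets of closed sets, finiteness on compact sets implies regularity. *)
Definition radon_on X (nu : {measure set (Rd * Rd) -> \bar R}) :=
  forall K, compact_in K X -> (nu K < +oo)%E.

(* The complex Radon measure (rpos - rneg) + i (ipos - ineg). *)
Record cradon X := CRadon {
  rpos : {measure set (Rd * Rd) -> \bar R};
  rneg : {measure set (Rd * Rd) -> \bar R};
  ipos : {measure set (Rd * Rd) -> \bar R};
  ineg : {measure set (Rd * Rd) -> \bar R};
  rpos_radon : radon_on X rpos;
  rneg_radon : radon_on X rneg;
  ipos_radon : radon_on X ipos;
  ineg_radon : radon_on X ineg }.

Definition cradon_conj X (mu : cradon X) : cradon X :=
  CRadon (rpos_radon mu) (rneg_radon mu) (ineg_radon mu) (ipos_radon mu).

(* A complex Radon measure has a value on these sets only. *)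
Definition bounded_borel X E :=
  measurable E /\ exists2 K, compact_in K X & E `<=` K.

Definition cradon_val X (mu : cradon X) E : C :=
  (fine (rpos mu E) - fine (rneg mu E)) +i*
  (fine (ipos mu E) - fine (ineg mu E)).

Definition cradon_integral X (mu : cradon X) E (f : Rd * Rd -> C) : C :=
  (cintegral (rpos mu) E f - cintegral (rneg mu) E f) +
  (0 +i* 1) * (cintegral (ipos mu) E f - cintegral (ineg mu) E f).

Definition hermitian_nonneg r X (mu : 'I_r -> 'I_r -> cradon X) :=
  forall E, bounded_borel X E ->
  (forall i j, cradon_val (mu i j) E = (cradon_val (mu j i) E)^*) /\
  (forall z : 'cV[C]_r,
     0 <= \sum_i \sum_j (z i ord0)^* * cradon_val (mu i j) E * z j ord0).

(* The value on E of the matrix measure p mu^T, where p is a matrix of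
   densities: (p mu^T)_(k, i) = \sum_j p_(k, j) mu_(i, j). *)
Definition mul_tr_radon q r X (p : Rd * Rd -> 'M[C]_(q, r))
    (mu : 'I_r -> 'I_r -> cradon X) E : 'M[C]_(q, r) :=
  \matrix_(k, i) \sum_j cradon_integral (mu i j) E (fun z => p z k j).

Definition is_Hmeasure r (Omega : set Rd) (u : nat -> Rd -> 'cV[C]_r)
    (mu : 'I_r -> 'I_r -> cradon (Omega `*` unit_sphere R d)) :=
  hermitian_nonneg mu /\
  forall (phi1 phi2 psi : Rd -> C),
  Cc Omega phi1 -> Cc Omega phi2 -> ccontinuous_on (unit_sphere R d) psi ->
  forall i j : 'I_r,
  ccvg
    (fun n => cintegral (lebesgue_rV d) setT (fun xi =>
       fourier (fun x => phi1 x * u n x i ord0) xi *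
       (fourier (fun x => phi2 x * u n x j ord0) xi)^* *
       psi ((enorm xi)^-1 *: xi)))
    (cradon_integral (cradon_conj (mu i j)) (Omega `*` unit_sphere R d)
       (fun z => phi1 z.1 * (phi2 z.1)^* * psi z.2)).

Definition principal_symbol q r m (A : mindex m -> Rd -> 'M[C]_(q, r))
    (z : Rd * Rd) : 'M[C]_(q, r) :=
  \sum_(alpha : mindex m | mlen alpha == m)
    ((0 +i* (2 * pi)) ^+ m * (mpow ((enorm z.2)^-1 *: z.2) alpha)%:C) *:
    A alpha z.1.

End radon.

(* Main.v *)
Require Import Defs.
From HB Require Import structures.
From mathcomp Require Import all_boot all_order all_algebra.
From mathcomp Require Import all_classical all_reals all_analysis.
From mathcomp Require Import measurable_realfun.
From mathcomp.real_closed Require Import complex.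
From mathcomp Require Import ring lra finmap.

(* Proof idea. Test the equation against phi * exp (- 2 pi i x . xi). By the
   Leibniz rule, eps_n^(m - l) |xi|^m times
     Q_n(xi) = sum_(|alpha| = m) (2 pi i)^m (xi / |xi|)^alpha F(phi A^alpha u_n)(xi)
   equals F(phi f_n)(xi), up to terms of order at most m in xi that contain
   A_n^alpha - A^alpha, and terms of order less than m in xi. For |xi| >= 1 the
   weight of the hypothesis on f_n is comparable with |xi|^m, because eps_n stays
   between two positive constants. After division by |xi|^m the first kind of terms
   tends to 0 in L^2 because (u_n) is bounded in L^2_loc, and the second because
   F(h u_n) tends to 0 pointwise and boundedly for every bounded h of compact
   support. Hence Q_n tends to 0 in L^2, and the definition of the H-measure,
   applied with phi_2 = phi A^alpha_(k, j), gives the orthogonality of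
   \sum_j p_(k, j) mu_(i, j) to all functions phi_1(x) f(xi). The case of Borel sets
   follows by the pi-lambda theorem, starting from products of open sets.

   Of Plancherel's theorem only an L^2 bound with some constant is needed. It is
   obtained by inserting the weight prod_i max(0, 1 - (xi_i / a)^2), whose Fourier
   transform is dominated by an integrable kernel of norm independent of a. *)

Set Implicit Arguments.
Unset Strict Implicit.
Unset Printing Implicit Defensive.

Import Order.TTheory GRing.Theory Num.Theory.
Import numFieldNormedType.Exports.

Local Open Scope classical_set_scope.
Local Open Scope ring_scope.
Local Open Scope complex_scope.

Local Notation Re := complex.Re.
Local Notation Im := complex.Im.

(** * Complex numbers and product integrals *)

(** The four positive measures behind a complex Radon measure may have infinite mass, while the
    pi-lambda argument needs finite ones. A bounded Borel set E has a relatively compact projection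
    to Omega, so phi is chosen bounded below there. Taking phi_1 = kap * g with kap * phi = 1 on the
    projection both removes the cutoff again and leaves an integrand of compact support, against
    which all four measures are finite.

    Dividing a term of order less than m by |xi|^m leaves at least one factor 1 / |xi|, hence the
    weight 1 / (1 + |xi|^2) on squared moduli. It is small at high frequencies, where only the L^2
    bound is known; what remains is a compact set of frequencies, where dominated convergence
    applies. The same weight is at least 1 / 2 for |xi| <= 1, so it also covers the low frequencies,
    where division by |xi|^m is of no use.

    All estimates concern squared moduli, with crude constants. They may depend on phi, m and the
    bounds of eps_n, but neither on n nor on xi. *)

Section complex_arith.
Context {R : realType}.
Implicit Types z w : R[i].

Lemma ReD z w : Re (z + w) = Re z + Re w. Proof. by case: z w => [? ?] []. Qed.
Lemma ImD z w : Im (z + w) = Im z + Im w. Proof. by case: z w => [? ?] []. Qed.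
Lemma ReN z : Re (- z) = - Re z. Proof. by case: z. Qed.
Lemma ImN z : Im (- z) = - Im z. Proof. by case: z. Qed.
Lemma ReM z w : Re (z * w) = Re z * Re w - Im z * Im w.
Proof. by case: z w => [? ?] []. Qed.
Lemma ImM z w : Im (z * w) = Re z * Im w + Im z * Re w.
Proof. by case: z w => [? ?] []. Qed.
Lemma ReJ z : Re z^* = Re z. Proof. by case: z. Qed.
Lemma ImJ z : Im z^* = - Im z. Proof. by case: z. Qed.

Lemma Re_sum I (s : seq I) (P : pred I) (F : I -> R[i]) :
  Re (\sum_(i <- s | P i) F i) = \sum_(i <- s | P i) Re (F i).
Proof. by apply: (big_morph (@Re R) ReD). Qed.

Lemma Im_sum I (s : seq I) (P : pred I) (F : I -> R[i]) :
  Im (\sum_(i <- s | P i) F i) = \sum_(i <- s | P i) Im (F i).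
Proof. by apply: (big_morph (@Im R) ImD). Qed.

Lemma complexP z w : Re z = Re w -> Im z = Im w -> z = w.
Proof. by case: z w => [? ?] [? ?] /= -> ->. Qed.

Lemma cabs2M z w : cabs2 (z * w) = cabs2 z * cabs2 w.
Proof. by rewrite /cabs2 ReM ImM; ring. Qed.

Lemma cabs2_ge0 z : 0 <= cabs2 z.
Proof. by rewrite addr_ge0 ?sqr_ge0. Qed.

Lemma cabs2J z : cabs2 z^* = cabs2 z.
Proof. by rewrite /cabs2 ReJ ImJ sqrrN. Qed.

Lemma cabs2N z : cabs2 (- z) = cabs2 z.
Proof. by rewrite /cabs2 ReN ImN !sqrrN. Qed.

Lemma cabs2_real (x : R) : cabs2 x%:C = x ^+ 2.
Proof. by rewrite /cabs2 /= expr0n addr0. Qed.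

Lemma cabs20 : cabs2 (0 : R[i]) = 0.
Proof. by rewrite /cabs2 /= expr0n addr0. Qed.

Lemma cabs21 : cabs2 (1 : R[i]) = 1.
Proof. by rewrite /cabs2 /= expr0n expr1n addr0. Qed.

(** Parallelogram identity: the difference of the two sides is |z - w|^2. *)
Lemma cabs2D z w : cabs2 (z + w) <= 2 * (cabs2 z + cabs2 w).
Proof.
rewrite -subr_ge0; apply: (le_trans (cabs2_ge0 (z - w))).
by rewrite /cabs2 !ReD !ImD ReN ImN le_eqVlt; apply/orP; left; apply/eqP; ring.
Qed.

(** Every further term doubles the constant. It only has to depend on nothing but the number of
    terms. *)
Lemma cabs2_sum I (s : seq I) (F : I -> R[i]) :
  cabs2 (\sum_(i <- s) F i) <= 2 ^+ size s * \sum_(i <- s) cabs2 (F i).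
Proof.
elim: s => [|i s IH]; first by rewrite !big_nil cabs20 mulr0.
rewrite !big_cons /= exprS mulrDr; apply: (le_trans (cabs2D _ _)).
rewrite -mulrA -mulrA -mulrDr ler_pM2l//; apply: lerD => //.
by apply: ler_peMl; rewrite ?cabs2_ge0 ?exprn_ege1 ?ler1n.
Qed.

Lemma cabs2_prod I (s : seq I) (F : I -> R[i]) :
  cabs2 (\prod_(i <- s) F i) = \prod_(i <- s) cabs2 (F i).
Proof. exact: (big_morph cabs2 cabs2M cabs21). Qed.

Lemma cabs2X z n : cabs2 (z ^+ n) = cabs2 z ^+ n.
Proof. by elim: n => [|n IH]; rewrite ?cabs21// !exprS cabs2M IH. Qed.

Lemma Re2_le_cabs2 z : Re z ^+ 2 <= cabs2 z.
Proof. by rewrite lerDl sqr_ge0. Qed.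

Lemma Im2_le_cabs2 z : Im z ^+ 2 <= cabs2 z.
Proof. by rewrite lerDr sqr_ge0. Qed.

Lemma Re_le_cabs z : `|Re z| <= cabs z.
Proof. by rewrite -sqrtr_sqr ler_wsqrtr// Re2_le_cabs2. Qed.

Lemma Im_le_cabs z : `|Im z| <= cabs z.
Proof. by rewrite -sqrtr_sqr ler_wsqrtr// Im2_le_cabs2. Qed.

Lemma sqr_cabs z : cabs z ^+ 2 = cabs2 z.
Proof. by rewrite sqr_sqrtr// cabs2_ge0. Qed.

End complex_arith.

Section rV_measurability.
Context {R : realType} {d : nat}.
Local Notation Rd := 'rV[R]_d.

Lemma open_measurable_rV (A : set Rd) : open A -> measurable A.
Proof.
move=> oA; have : <<s [set A : set Rd | open A] >> A by exact: sub_sigma_algebra.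
by rewrite -measurable_rVE.
Qed.

Lemma closed_measurable_rV (A : set Rd) : closed A -> measurable A.
Proof.
by move=> cA; rewrite -(setCK A); apply: measurableC; apply: open_measurable_rV; rewrite openC.
Qed.

Lemma compact_measurable_rV (A : set Rd) : compact A -> measurable A.
Proof.
by move=> cA; apply: closed_measurable_rV; apply: compact_closed => //; exact: norm_hausdorff.
Qed.

Lemma continuous_measurable_rV (f : Rd -> R) :
  continuous f -> measurable_fun setT f.
Proof.
move=> cf; apply: (measurability _ (RGenOpens.measurableE R)).
move=> _ [_ [a [b ->] <-]]; rewrite setTI; apply: open_measurable_rV.
by apply: open_comp; [move=> x _; exact: cf|exact: interval_open].
Qed.

Lemma measurable_dotp d' (T : measurableType d') (f g : T -> Rd) :
  measurable_fun setT f -> measurable_fun setT g ->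
  measurable_fun setT (fun x => dotp (f x) (g x)).
Proof.
move=> mf mg; apply: measurable_sum => i; apply: measurable_funM.
  exact: measurableT_comp (measurable_rV_coord i) mf.
exact: measurableT_comp (measurable_rV_coord i) mg.
Qed.

Lemma measurable_cos_comp d' (T : measurableType d') (f : T -> R) :
  measurable_fun setT f -> measurable_fun setT (fun x => cos (f x)).
Proof.
by apply: measurableT_comp; apply: continuous_measurable_fun; exact: continuous_cos.
Qed.

Lemma measurable_sin_comp d' (T : measurableType d') (f : T -> R) :
  measurable_fun setT f -> measurable_fun setT (fun x => sin (f x)).
Proof.
by apply: measurableT_comp; apply: continuous_measurable_fun; exact: continuous_sin.
Qed.

End rV_measurability.

Section product_integrals.
Context d1 d2 (T1 : measurableType d1) (T2 : measurableType d2) (R : realType).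
Variable m1 : {sigma_finite_measure set T1 -> \bar R}.
Variable m2 : {sigma_finite_measure set T2 -> \bar R}.

Lemma integrable_prodM (f : T1 -> R) (g : T2 -> R) :
  m1.-integrable setT (EFin \o f) -> m2.-integrable setT (EFin \o g) ->
  (m1 \x m2)%E.-integrable setT (EFin \o (fun z => f z.1 * g z.2)).
Proof.
move=> /integrableP[/measurable_EFinP mf If] /integrableP[/measurable_EFinP mg Ig].
have mfg : measurable_fun setT (EFin \o (fun z : T1 * T2 => f z.1 * g z.2)).
  apply/measurable_EFinP; apply: measurable_funM.
    exact: measurableT_comp mf measurable_fst.
  exact: measurableT_comp mg measurable_snd.
apply/integrable12ltyP => //.
have -> : (\int[m1]_x \int[m2]_y `|(f x * g y)%:E| =
   (\int[m1]_x `|(f x)%:E|) * (\int[m2]_y `|(g y)%:E|))%E.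
  transitivity (\int[m1]_x (`|(f x)%:E| * (\int[m2]_y `|(g y)%:E|)))%E.
    apply: eq_integral => x _; rewrite -ge0_integralZl//; last first.
      by apply: measurableT_comp => //; exact/measurable_EFinP.
    by apply: eq_integral => y _ /=; rewrite normrM EFinM.
  rewrite -ge0_integralZr ?integral_ge0//.
  by apply: measurableT_comp => //; exact/measurable_EFinP.
have := If; rewrite -ge0_fin_numE ?integral_ge0// => /fineK <-.
have := Ig; rewrite -ge0_fin_numE ?integral_ge0// => /fineK <-.
by rewrite ltry.
Qed.

Lemma Rintegral_prodM (f : T1 -> R) (g : T2 -> R) :
  m1.-integrable setT (EFin \o f) -> m2.-integrable setT (EFin \o g) ->
  Rintegral (m1 \x m2)%E setT (fun z => f z.1 * g z.2) =
  Rintegral m1 setT f * Rintegral m2 setT g.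
Proof.
move=> If Ig; have Ifg := integrable_prodM If Ig.
rewrite [LHS]/Rintegral -(integral12_prod_meas1 Ifg).
under eq_integral => x _.
  rewrite /fubini_F /=; under eq_integral do rewrite EFinM.
  rewrite integralZl//.
  rewrite -(fineK (integrable_fin_num _ Ig))//.
  rewrite -/(Rintegral m2 setT g).
  over.
by rewrite integralZr//= fineM//; exact: integrable_fin_num.
Qed.

End product_integrals.

Section rV_integrals.
Context {R : realType}.
Local Notation leb := lebesgue_measure.

Lemma ge0_integral_rVS n (f : 'rV[R]_n.+1 -> \bar R) :
  measurable_fun setT f -> (forall x, 0 <= f x)%E ->
  (\int[lebesgue_rV n.+1]_x f x =
   \int[(@leb R \x lebesgue_rV n)%E]_z f (rV_cons z))%E.
Proof.
move=> mf f0; rewrite /= /lebesgue_rV_step ge0_integral_pushforward//.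
by exact: measurable_rV_cons.
Qed.

Lemma rV_cons0 n (z : R * 'rV[R]_n) : rV_cons z ord0 ord0 = z.1.
Proof. by rewrite mxE unlift_none. Qed.

Lemma rV_consS n (z : R * 'rV[R]_n) i : rV_cons z ord0 (lift ord0 i) = z.2 ord0 i.
Proof. by rewrite mxE liftK. Qed.

Lemma ge0_integral_rV_prod n (g : 'I_n -> R -> R) :
  (forall i, measurable_fun setT (g i)) -> (forall i t, 0 <= g i t) ->
  (\int[lebesgue_rV n]_x (\prod_i g i (x ord0 i))%:E =
   \prod_i \int[leb]_t (g i t)%:E)%E.
Proof.
elim: n g => [|n IH] g mg g0.
  rewrite big_ord0; under eq_integral do rewrite big_ord0.
  by rewrite integral_cst//= /lebesgue_rV0 diracT mul1e.
rewrite ge0_integral_rVS; last 2 first.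
- apply/measurable_EFinP; apply: measurable_prod => i _.
  exact: measurableT_comp (mg i) (measurable_rV_coord i).
- by move=> x; rewrite lee_fin prodr_ge0.
under eq_integral do rewrite big_ord_recl rV_cons0.
under eq_integral => z _.
  under eq_bigr do rewrite rV_consS.
  over.
rewrite fubini_tonelli1//=; last 2 first.
- apply/measurable_EFinP; apply: measurable_funM.
    exact: measurableT_comp (mg _) measurable_fst.
  apply: measurable_prod => i _; apply: measurableT_comp (mg _) _.
  exact: measurableT_comp (measurable_rV_coord i) measurable_snd.
- by move=> z; rewrite lee_fin mulr_ge0 ?prodr_ge0.
rewrite big_ord_recl -IH// -ge0_integralZr//; last 3 first.
- by apply/measurable_EFinP; exact: (mg ord0).
- by move=> x _; rewrite lee_fin.
- by apply: integral_ge0 => x _; rewrite lee_fin prodr_ge0.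
apply: eq_integral => x _; rewrite /fubini_F /= -ge0_integralZl//.
- apply/measurable_EFinP; apply: measurable_prod => i _.
  exact: measurableT_comp (mg _) (measurable_rV_coord i).
- by move=> z _; rewrite lee_fin prodr_ge0.
- by rewrite lee_fin.
Qed.

Definition cintegrable d (T : measurableType d) (mu : {measure set T -> \bar R})
    (D : set T) (f : T -> R[i]) :=
  mu.-integrable D (EFin \o (fun x => Re (f x))) /\
  mu.-integrable D (EFin \o (fun x => Im (f x))).

Lemma cintegral_prodM d1 d2 (T1 : measurableType d1) (T2 : measurableType d2)
    (m1 : {sigma_finite_measure set T1 -> \bar R})
    (m2 : {sigma_finite_measure set T2 -> \bar R})
    (f : T1 -> R[i]) (g : T2 -> R[i]) :
  cintegrable m1 setT f -> cintegrable m2 setT g ->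
  cintegrable (m1 \x m2)%E setT (fun z => f z.1 * g z.2) /\
  cintegral (m1 \x m2)%E setT (fun z => f z.1 * g z.2) =
  cintegral m1 setT f * cintegral m2 setT g.
Proof.
move=> [fr fi] [gr gi].
have rr := integrable_prodM fr gr; have ii := integrable_prodM fi gi.
have ri := integrable_prodM fr gi; have ir := integrable_prodM fi gr.
split; first split.
- under eq_fun do rewrite ReM.
  by apply: eq_integrable (integrableB measurableT rr ii) => // z _ /=.
- under eq_fun do rewrite ImM.
  by apply: eq_integrable (integrableD measurableT ri ir) => // z _ /=.
apply: complexP.
  rewrite ReM /= -!Rintegral_prodM// -RintegralB//.
  by apply: eq_Rintegral => z _; rewrite ReM.
rewrite ImM /= -!Rintegral_prodM// -RintegralD//.
by apply: eq_Rintegral => z _; rewrite ImM.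
Qed.

(** Complex-valued because exp (i x . z) is a product over the coordinates, which its real and
    imaginary parts are not. *)
Lemma cintegral_rV_prod n (h : 'I_n -> R -> R[i]) :
  (forall i, cintegrable leb setT (h i)) ->
  cintegrable (lebesgue_rV n) setT (fun x => \prod_i h i (x ord0 i)) /\
  cintegral (lebesgue_rV n) setT (fun x => \prod_i h i (x ord0 i)) =
  \prod_i cintegral leb setT (h i).
Proof.
elim: n h => [|n IH] h ih.
  split; first split.
  - under eq_fun do rewrite big_ord0; apply: finite_measure_integrable_cst => //.
  - under eq_fun do rewrite big_ord0; apply: finite_measure_integrable_cst => //.
  rewrite big_ord0; apply: complexP.
    under [LHS]eq_Rintegral do rewrite big_ord0.
    have l1 : lebesgue_rV 0 [set: 'rV[R]_0] = 1%E by exact: diracT.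
    transitivity (1 * fine (lebesgue_rV 0 [set: 'rV[R]_0])); first exact: Rintegral_cst.
    by rewrite l1 mulr1.
  under [LHS]eq_Rintegral do rewrite big_ord0.
  by rewrite Rintegral_cst//= mul0r.
have [ip ep] := IH (fun i => h (lift ord0 i)) (fun i => ih _).
have [] := cintegral_prodM (ih ord0) ip.
rewrite ep => -[iR iI] e.
have mh i : measurable_fun setT (fun t => Re (h i t)) /\
            measurable_fun setT (fun t => Im (h i t)).
  have [i1 i2] := ih i.
  by split; apply/measurable_EFinP; [exact: (measurable_int _ i1)|exact: (measurable_int _ i2)].
have mprod (s : seq 'I_n.+1) :
   measurable_fun setT (fun x : 'rV_n.+1 => Re (\prod_(i <- s) h i (x ord0 i))) /\
   measurable_fun setT (fun x : 'rV_n.+1 => Im (\prod_(i <- s) h i (x ord0 i))).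
  elim: s => [|i s [IHr IHi]].
    by split; under eq_fun do rewrite big_nil; exact: measurable_cst.
  have mr := measurableT_comp (mh i).1 (measurable_rV_coord i).
  have mi := measurableT_comp (mh i).2 (measurable_rV_coord i).
  split; under eq_fun do rewrite big_cons ?ReM ?ImM.
    by apply: measurable_funB; apply: measurable_funM.
  by apply: measurable_funD; apply: measurable_funM.
have E z : \prod_i h i (rV_cons z ord0 i) =
    h ord0 z.1 * \prod_(i < n) h (lift ord0 i) (z.2 ord0 i).
  by rewrite big_ord_recl rV_cons0; congr (_ * _); apply: eq_bigr => i _; rewrite rV_consS.
split; first split.
- rewrite /= /lebesgue_rV_step; apply: integrable_pushforward => //.
  + exact: measurable_rV_cons.
  + by apply/measurable_EFinP; exact: (mprod _).1.
  + by apply: eq_integrable iR => // z _ /=; rewrite E.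
- rewrite /= /lebesgue_rV_step; apply: integrable_pushforward => //.
  + exact: measurable_rV_cons.
  + by apply/measurable_EFinP; exact: (mprod _).2.
  + by apply: eq_integrable iI => // z _ /=; rewrite E.
rewrite big_ord_recl -e; congr (_ +i* _).
- rewrite /Rintegral /= /lebesgue_rV_step integral_pushforward//.
  + by congr fine; apply: eq_integral => z _ /=; rewrite E.
  + exact: measurable_rV_cons.
  + by apply/measurable_EFinP; exact: (mprod _).1.
  + by apply: eq_integrable iR => // z _ /=; rewrite E.
- rewrite /Rintegral /= /lebesgue_rV_step integral_pushforward//.
  + by congr fine; apply: eq_integral => z _ /=; rewrite E.
  + exact: measurable_rV_cons.
  + by apply/measurable_EFinP; exact: (mprod _).2.
  + by apply: eq_integrable iI => // z _ /=; rewrite E.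
Qed.

End rV_integrals.

(** * A Bessel inequality for the Fourier transform *)

Section one_dimensional_kernel.
Context {R : realType}.
Local Notation leb := (@lebesgue_measure R).

Lemma is_derive_continuous (F : R -> R) (t df : R) : is_derive t 1 F df -> {for t, continuous F}.
Proof.
by move=> dF; apply: differentiable_continuous; apply/derivable1_diffP; exact: ex_derive.
Qed.

Lemma FTC_everywhere (F f : R -> R) (a b : R) : a < b ->
  (forall t : R, is_derive t 1 F (f t)) -> continuous f ->
  leb.-integrable `[a, b] (EFin \o f) /\
  \int[leb]_(t in `[a, b]) f t = F b - F a.
Proof.
move=> ab dF cf.
have cw : {within `[a, b], continuous f} by apply: continuous_subspaceT.
split; first by apply: continuous_compact_integrable => //; exact: segment_compact.
have cF : continuous F.
  by move=> t; exact: is_derive_continuous (dF t).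
rewrite /Rintegral (@continuous_FTC2 _ f F)//.
- split; first by move=> x _; exact: (@ex_derive _ _ _ _ _ _ _ (dF x)).
  + exact/cvg_at_right_filter/cF.
  + exact/cvg_at_left_filter/cF.
- by move=> x _; rewrite derive1E (@derive_val _ _ _ _ _ _ _ (dF x)).
Qed.

Lemma is_derive_sinM (w t : R) : is_derive t 1 (fun s => sin (w * s)) (w * cos (w * t)).
Proof.
have h : is_derive t 1 (fun s : R => w * s) w.
  by apply: is_derive_eq; rewrite /GRing.scale /= mulr1.
have := @is_derive1_comp R sin (fun s => w * s) t _ _ (is_derive_sin (w * t)) h.
by move=> k; apply: (is_derive_eq k); rewrite mulrC.
Qed.

Lemma is_derive_cosM (w t : R) : is_derive t 1 (fun s => cos (w * s)) (- w * sin (w * t)).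
Proof.
have h : is_derive t 1 (fun s : R => w * s) w.
  by apply: is_derive_eq; rewrite /GRing.scale /= mulr1.
have := @is_derive1_comp R cos (fun s => w * s) t _ _ (is_derive_cos (w * t)) h.
by move=> k; apply: (is_derive_eq k); rewrite mulrC mulrN mulNr.
Qed.

Definition parab (a t : R) : R := 1 - (t / a) ^+ 2.

Lemma is_derive_parab (a t : R) : is_derive t 1 (parab a) (- (2 * t / a ^+ 2)).
Proof.
rewrite /parab; apply: is_derive_eq.
rewrite /GRing.scale /= -exprVn; ring.
Qed.

(** Repeated integration by parts, which stops because [parab a] is quadratic. *)
Definition parab_cos_prim (a w t : R) : R :=
  parab a t * sin (w * t) / w - 2 * t / a ^+ 2 * cos (w * t) / w ^+ 2
  + 2 / a ^+ 2 * sin (w * t) / w ^+ 3.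

Definition parab_sin_prim (a w t : R) : R :=
  - parab a t * cos (w * t) / w - 2 * t / a ^+ 2 * sin (w * t) / w ^+ 2
  - 2 / a ^+ 2 * cos (w * t) / w ^+ 3.

Lemma is_derive_parab_cos_prim (a w t : R) : a != 0 -> w != 0 ->
  is_derive t 1 (parab_cos_prim a w) (parab a t * cos (w * t)).
Proof.
move=> a0 w0; have h1 := is_derive_sinM w t; have h2 := is_derive_cosM w t.
have h3 := is_derive_parab a t.
rewrite /parab_cos_prim; apply: is_derive_eq.
rewrite /GRing.scale /= !mulr0 ?add0r ?addr0.
by field; rewrite w0 a0.
Qed.

Lemma is_derive_parab_sin_prim (a w t : R) : a != 0 -> w != 0 ->
  is_derive t 1 (parab_sin_prim a w) (parab a t * sin (w * t)).
Proof.
move=> a0 w0; have h1 := is_derive_sinM w t; have h2 := is_derive_cosM w t.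
have h3 := is_derive_parab a t.
rewrite /parab_sin_prim; apply: is_derive_eq.
rewrite /GRing.scale /= !mulr0 ?add0r ?addr0.
by field; rewrite w0 a0.
Qed.

Lemma continuous_parab (a : R) : continuous (parab a).
Proof. by move=> t; exact: is_derive_continuous (is_derive_parab a t). Qed.

Lemma continuous_sinM (w : R) : continuous (fun s : R => sin (w * s)).
Proof. by move=> t; exact: is_derive_continuous (is_derive_sinM w t). Qed.

Lemma continuous_cosM (w : R) : continuous (fun s : R => cos (w * s)).
Proof. by move=> t; exact: is_derive_continuous (is_derive_cosM w t). Qed.

Definition expi (x : R) : R[i] := cos x +i* sin x.

Lemma expiD (x y : R) : expi (x + y) = expi x * expi y.
Proof.
apply: complexP; rewrite ?ReM ?ImM /expi /=; first exact: cosD.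
by rewrite sinD addrC.
Qed.

Lemma expi_sum I (s : seq I) (F : I -> R) :
  expi (\sum_(i <- s) F i) = \prod_(i <- s) expi (F i).
Proof.
by apply: (big_morph expi expiD); rewrite /expi cos0 sin0.
Qed.

(* Continuous with compact support, increasing to 1 as a grows, and with a
   cosine transform of quadratic decay. *)
Definition wgt (a t : R) : R := Num.max 0 (parab a t).

Lemma wgtE (a : R) : 0 < a -> wgt a = (parab a) \_ `[- a, a].
Proof.
move=> a0; apply/funext => t; rewrite /wgt patchE.
have E : (0 <= parab a t) = (- a <= t <= a).
  rewrite /parab subr_ge0 -[(t / a) ^+ 2]real_normK ?num_real// expr_le1//.
  by rewrite normrM normfV (gtr0_norm a0) ler_pdivrMr// mul1r ler_norml.
rewrite mem_setE in_itv /= -E.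
by case: lerP.
Qed.

Lemma wgt_ge0 (a t : R) : 0 <= wgt a t.
Proof. by rewrite /wgt le_max lexx. Qed.

Lemma wgt_le1 (a t : R) : wgt a t <= 1.
Proof. by rewrite /wgt ge_max ler01 /parab gerBl sqr_ge0. Qed.

Lemma integrable_wgt (a : R) (g : R -> R) : 0 < a -> continuous g ->
  leb.-integrable setT (EFin \o (fun t => wgt a t * g t)) /\
  \int[leb]_t (wgt a t * g t) = \int[leb]_(t in `[- a, a]) (parab a t * g t).
Proof.
move=> a0 cg.
have E : (fun t => wgt a t * g t) = (fun t => parab a t * g t) \_ `[- a, a].
  apply/funext => t; rewrite wgtE// !patchE; case: ifP => // _; exact: mul0r.
have cpg : continuous (fun t => parab a t * g t).
  by move=> t; apply: cvgM; [exact: continuous_parab|exact: cg].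
split; last by rewrite [RHS]Rintegral_mkcond E.
rewrite E -restrict_EFin; apply/(integrable_mkcond _ _).1 => //.
apply: continuous_compact_integrable; first exact: segment_compact.
exact: continuous_subspaceT.
Qed.

Lemma wgt_cos_bound (a w : R) : 0 < a ->
  `|\int[leb]_t (wgt a t * cos (w * t))| <= 2 * a.
Proof.
move=> a0; have [i1 e1] := integrable_wgt a0 (@continuous_cosM w).
have lea : - a <= a by rewrite ge0_cp// ltW.
have m : measurable (`[- a, a]%classic : set R) by exact: measurable_itv.
rewrite e1.
have i2 : leb.-integrable `[- a, a] (EFin \o (fun t => parab a t * cos (w * t))).
  apply: continuous_compact_integrable; first exact: segment_compact.
  apply: continuous_subspaceT => t.
  by apply: cvgM; [exact: continuous_parab|exact: continuous_cosM].
apply: (le_trans (le_normr_Rintegral _ i2)) => //.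
have l : leb `[- a, a]%classic = (2 * a)%:E.
  rewrite lebesgue_measure_itv /= lte_fin.
  have -> : - a < a by rewrite (lt_le_trans _ (ltW a0))// oppr_lt0.
  by congr EFin; ring.
apply: (@le_trans _ _ (\int[leb]_(t in `[- a, a]) 1)).
  apply: le_Rintegral => //.
  - exact: (integrable_norm i2).
  - apply: continuous_compact_integrable; first exact: segment_compact.
    by apply: continuous_subspaceT => t; exact: cvg_cst.
  move=> t; rewrite /= in_itv /= => ta.
  rewrite normrM -[leRHS]mulr1 ler_pM//; last by rewrite ler_norml cos_geN1 cos_le1.
  have := wgtE a0 => /(congr1 (fun f => f t)); rewrite patchE mem_setE in_itv /= ta => <-.
  by rewrite ger0_norm ?wgt_ge0 ?wgt_le1.
by rewrite Rintegral_cst// [X in fine X]l mul1r.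
Qed.

(** [parab a] vanishes at both ends, so the boundary terms of order 1 / w drop out and order 1 / w^2
    remains. *)
Lemma wgt_cos_decay (a w : R) : 0 < a -> 1 <= `|w * a| ->
  `|\int[leb]_t (wgt a t * cos (w * t))| <= 8 / (a * w ^+ 2).
Proof.
move=> a0 wa; have an0 : a != 0 by rewrite gt_eqF.
have w0 : w != 0 by apply: contraTneq wa => ->; rewrite mul0r normr0 -ltNge.
have [_ ->] := integrable_wgt a0 (@continuous_cosM w).
have aa : - a < a by rewrite (lt_le_trans _ (ltW a0))// oppr_lt0.
have [_ ->] := FTC_everywhere aa (fun t => is_derive_parab_cos_prim t an0 w0)
  (fun t => cvgM (@continuous_parab a t) (@continuous_cosM w t)).
have -> : parab_cos_prim a w a - parab_cos_prim a w (- a) =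
    4 / (a * w ^+ 2) * (sin (w * a) / (w * a) - cos (w * a)).
  rewrite /parab_cos_prim /parab mulrN sinN cosN; field; by rewrite w0 an0.
have p : 0 < a * w ^+ 2 by rewrite mulr_gt0// exprn_even_gt0.
rewrite normrM normrM normfV (gtr0_norm p) ger0_norm//.
have -> : 8 / (a * w ^+ 2) = 4 / (a * w ^+ 2) * 2 by field; rewrite w0 an0.
apply: ler_pM => //; first by rewrite divr_ge0// ltW.
apply: (le_trans (ler_normB _ _)).
have -> : (2 : R) = 1 + 1 by [].
apply: lerD; last by rewrite ler_norml cos_geN1 cos_le1.
rewrite normrM normfV ler_pdivrMr ?normr_gt0 ?mulf_neq0// mul1r.
by apply: le_trans wa; rewrite ler_norml sin_geN1 sin_le1.
Qed.

(** The integrand is odd: its antiderivative is even and takes the same value at - a and a. The case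
    w = 0 is separate because the antiderivative divides by w. *)
Lemma wgt_sin (a w : R) : 0 < a -> \int[leb]_t (wgt a t * sin (w * t)) = 0.
Proof.
move=> a0; have an0 : a != 0 by rewrite gt_eqF.
have [->|w0] := eqVneq w 0.
  by under eq_Rintegral do rewrite mul0r sin0 mulr0; rewrite Rintegral_cst// mul0r.
have [_ ->] := integrable_wgt a0 (@continuous_sinM w).
have aa : - a < a by rewrite (lt_le_trans _ (ltW a0))// oppr_lt0.
have [_ ->] := FTC_everywhere aa (fun t => is_derive_parab_sin_prim t an0 w0)
  (fun t => cvgM (@continuous_parab a t) (@continuous_sinM w t)).
rewrite /parab_sin_prim /parab mulrN sinN cosN; field; by rewrite w0 an0.
Qed.

(* Integrable, with integral 16 pi for every a > 0, and an upper bound of the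
   cosine transform of [wgt a]; the constant 16 is not optimal. *)
Definition kern (a z : R) : R := 16 * a / (1 + (a * z) ^+ 2).

Lemma kern_denom_gt0 (x : R) : 0 < 1 + x ^+ 2.
Proof. by rewrite ltr_wpDr ?sqr_ge0. Qed.

Lemma kern_ge0 (a z : R) : 0 < a -> 0 <= kern a z.
Proof. by move=> a0; rewrite divr_ge0 ?mulr_ge0 ?ltW ?kern_denom_gt0. Qed.

(** For |a z| <= 1 the trivial bound 2 a is used, with 1 + (a z)^2 <= 2. Otherwise the decay at w =
    2 pi z applies, and 1 + (a z)^2 <= 2 (a z)^2 turns its constant 8 into 16. *)
Lemma wgt_cos_kern (a z : R) : 0 < a ->
  `|\int[leb]_t (wgt a t * cos (2 * pi * z * t))| <= kern a z.
Proof.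
move=> a0; rewrite /kern ler_pdivlMr ?kern_denom_gt0//.
have [az|az] := lerP (`|a * z|) 1.
  have h : 1 + (a * z) ^+ 2 <= 2.
    by rewrite -[X in _ <= X]/(1 + 1) lerD2l -[(a * z) ^+ 2]real_normK ?num_real// expr_le1.
  apply: (@le_trans _ _ (2 * a * 2)); last by lra.
  apply: ler_pM => //; last exact: wgt_cos_bound.
  by rewrite ltW ?kern_denom_gt0.
have pi2 : 2 <= (pi : R) := pi_ge2 R.
have wa : 1 <= `|2 * pi * z * a|.
  have -> : 2 * pi * z * a = (2 * pi) * (a * z) by ring.
  rewrite normrM ger0_norm; last by lra.
  apply: (le_trans (ltW az)); apply: ler_peMl => //; lra.
have s1 : 1 <= (a * z) ^+ 2 by rewrite -[(a * z) ^+ 2]real_normK ?num_real// exprn_ege1// ltW.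
apply: (@le_trans _ _ (8 / (a * (2 * pi * z) ^+ 2) * (1 + (a * z) ^+ 2))).
  by rewrite ler_pM2r ?kern_denom_gt0//; exact: wgt_cos_decay.
have z0 : z != 0 by apply: contraTneq az => ->; rewrite mulr0 normr0 -leNgt.
have p0 : (pi : R) != 0 by rewrite gt_eqF// pi_gt0.
have an0 : a != 0 by rewrite gt_eqF.
have gen (p : R) : p != 0 -> 8 / (a * (2 * p * z) ^+ 2) * (1 + (a * z) ^+ 2) =
    8 * a * (1 + (a * z) ^+ 2) / ((2 * p) ^+ 2 * (a * z) ^+ 2).
  by move=> pn0; field; rewrite an0 z0 pn0.
rewrite (gen _ p0).
have pp : 1 <= (2 * pi : R) ^+ 2 by apply: exprn_ege1; lra.
rewrite ler_pdivrMr; last by rewrite mulr_gt0// (lt_le_trans ltr01).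
have -> : 16 * a * ((2 * pi) ^+ 2 * (a * z) ^+ 2) = 8 * a * (2 * ((2 * pi) ^+ 2 * (a * z) ^+ 2)) by ring.
rewrite ler_pM2l ?mulr_gt0//.
have : (a * z) ^+ 2 <= (2 * pi) ^+ 2 * (a * z) ^+ 2 by apply: ler_peMl => //; rewrite sqr_ge0.
lra.
Qed.

Lemma is_derive_atan_affine (a x t : R) :
  is_derive t 1 (fun s => 16 * atan (a * (s - x))) (kern a (x - t)).
Proof.
have h : is_derive t 1 (fun s : R => a * (s - x)) a.
  by apply: is_derive_eq; rewrite /GRing.scale /= ?subr0 mulr1.
have k := @is_derive1_comp R atan (fun s => a * (s - x)) t _ _ (is_derive1_atan _) h.
rewrite (_ : (fun s => _) = (fun s => 16 * (atan \o (fun s => a * (s - x))) s)) //.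
apply: is_derive_eq; rewrite /GRing.scale /= /kern.
have -> : (a * (x - t)) ^+ 2 = (a * (t - x)) ^+ 2 by ring.
by rewrite -mulrA [_^-1 * a]mulrC.
Qed.

Lemma continuous_kern (a x : R) : continuous (fun t => kern a (x - t)).
Proof.
move=> t; rewrite /kern; apply: cvgM; first exact: cvg_cst.
apply: cvgV; first by rewrite gt_eqF// kern_denom_gt0.
apply: cvgD; first exact: cvg_cst.
have h : (fun t => a * (x - t)) t @[t --> t] --> a * (x - t).
  by apply: cvgM; [exact: cvg_cst|apply: cvgB; [exact: cvg_cst|exact: cvg_id]].
by under eq_fun do rewrite expr2; rewrite expr2; apply: cvgM.
Qed.

(** The antiderivative 16 atan (a (y - x)) increases by less than 16 pi over any interval. *)
Lemma integral_kern (a x : R) : 0 < a ->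
  (\int[leb]_y (kern a (x - y))%:E <= (16 * pi)%:E)%E.
Proof.
move=> a0.
(* The bound n + 1 keeps the intervals nondegenerate, as [FTC_everywhere] requires. *)
pose F n := `[- n.+1%:R, n.+1%:R]%classic : set R.
have mk : measurable_fun setT (EFin \o (fun y : R => kern a (x - y))).
  by apply/measurable_EFinP; apply: continuous_measurable_fun; exact: continuous_kern.
have UF : \bigcup_i F i = setT.
  apply/seteqP; split=> // t _; exists (Num.bound `|t|) => //.
  rewrite /F /= in_itv /= -ler_norml.
  by rewrite (le_trans (ltW (archi_boundP (normr_ge0 t))))// ler_nat.
have mF i : measurable (F i : set (measurableTypeR R)) by exact: measurable_itv.
have cv : (\int[leb]_(y in F i) (kern a (x - y))%:E @[i --> \oo] -->
    \int[leb]_y (kern a (x - y))%:E)%E.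
  rewrite -UF; apply: ge0_nondecreasing_set_cvg_integral => //.
  - apply/nondecreasing_seqP => n; apply/subsetPset => t; rewrite /F /= !in_itv /= -!ler_norml.
    by move=> h; apply: (le_trans h); rewrite ler_nat.
  - by move=> i; exact: measurable_funTS.
  - by move=> i y _; rewrite lee_fin kern_ge0.
rewrite -(cvg_lim _ cv)//; apply: lime_le; first by apply/cvg_ex; eexists; exact: cv.
apply: nearW => n.
have nn : - n.+1%:R < n.+1%:R :> R by rewrite gtrN// ltr0n.
have [i e] := FTC_everywhere nn (fun t => is_derive_atan_affine a x t) (@continuous_kern a x).
have -> : (\int[leb]_(y in F n) (kern a (x - y))%:E)%E =
    (\int[leb]_(y in F n) kern a (x - y))%:E.
  by rewrite /Rintegral fineK//; apply: integrable_fin_num.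
rewrite lee_fin e -mulrBr ler_pM2l//.
have h1 := atan_ltpi2 (a * (n.+1%:R - x)); have h2 := atan_gtNpi2 (a * (- n.+1%:R - x)).
apply: ltW; lra.
Qed.

End one_dimensional_kernel.

Section integral_helpers.
Context d1 d2 (T1 : measurableType d1) (T2 : measurableType d2) (R : realType).

Lemma integrable_bddM (mu : {measure set T1 -> \bar R}) (D : set T1) (f a : T1 -> R) (c : R) :
  measurable D -> measurable_fun D f -> (forall x, D x -> `|f x| <= c) ->
  mu.-integrable D (EFin \o a) ->
  mu.-integrable D (EFin \o (fun x => f x * a x)).
Proof.
move=> mD mf fc ia; have ma : measurable_fun D a.
  by apply/measurable_EFinP; exact: (measurable_int _ ia).
have ica := integrableZl mD c (integrable_norm ia).
apply: (le_integrable mD _ _ ica).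
  by apply/measurable_EFinP; apply: measurable_funM.
move=> x Dx /=; rewrite lee_fin normrM [leRHS]ger0_norm; last first.
  by rewrite mulr_ge0// (le_trans _ (fc _ Dx)).
by rewrite ler_wpM2r// fc.
Qed.

Lemma integrable_Rle (mu : {measure set T1 -> \bar R}) (D : set T1) (f g : T1 -> R) :
  measurable D -> measurable_fun D f -> (forall x, D x -> `|f x| <= g x) ->
  mu.-integrable D (EFin \o g) -> mu.-integrable D (EFin \o f).
Proof.
move=> mD mf fg ig; apply: (le_integrable mD _ _ ig); first exact/measurable_EFinP.
by move=> x Dx /=; rewrite lee_fin (le_trans (fg _ Dx))// ler_norm.
Qed.

Lemma Rintegral_EFin (mu : {measure set T1 -> \bar R}) (D : set T1) (f : T1 -> R) :
  measurable D -> mu.-integrable D (EFin \o f) ->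
  (\int[mu]_(x in D) (f x)%:E = (\int[mu]_(x in D) f x)%:E)%E.
Proof. by move=> mD fi; rewrite /Rintegral fineK//; exact: (integrable_fin_num _ fi). Qed.

(** Tonelli gives measurability for the positive and the negative part separately, and [fine] is
    measurable; integrability in y does not enter. *)
Lemma measurable_Rintegral_param (m2 : {sigma_finite_measure set T2 -> \bar R})
    (f : T1 * T2 -> R) : measurable_fun setT f ->
  measurable_fun setT (fun x => \int[m2]_y f (x, y)).
Proof.
move=> /measurable_EFinP mf; rewrite /Rintegral.
apply: (measurableT_comp (fine_measurable _)) => //.
rewrite (_ : (fun x => _) =
   (fun x => (\int[m2]_y ((EFin \o f)^\+ (x, y)))%E) \-
   (fun x => \int[m2]_y ((EFin \o f)^\- (x, y)))%E)%E; last first.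
  apply/funext => x; by rewrite [LHS]integralE; congr (_ - _)%E; apply: eq_integral => y _; rewrite unlock.
apply: emeasurable_funB.
  by apply: measurable_fun_fubini_tonelli_F => //; exact: measurable_funepos.
by apply: measurable_fun_fubini_tonelli_F => //; exact: measurable_funeneg.
Qed.

End integral_helpers.

Section kernel_rV.
Context {R : realType} {d : nat}.
Local Notation Rd := 'rV[R]_d.
Local Notation leb := (lebesgue_rV d).

Definition wgtd (a : R) (xi : Rd) : R := \prod_i wgt a (xi ord0 i).
Definition kernd (a : R) (z : Rd) : R := \prod_i kern a (z ord0 i).

Lemma wgtd_ge0 a xi : 0 <= wgtd a xi.
Proof. by rewrite prodr_ge0// => i _; exact: wgt_ge0. Qed.

Lemma kernd_ge0 a z : 0 < a -> 0 <= kernd a z.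
Proof. by move=> a0; rewrite prodr_ge0// => i _; exact: kern_ge0. Qed.

Lemma wgtd_expi_prod a (z xi : Rd) :
  \prod_i ((wgt a (xi ord0 i))%:C * expi (2 * pi * z ord0 i * xi ord0 i)) =
  (wgtd a xi)%:C * expi (2 * pi * dotp z xi).
Proof.
rewrite big_split /= -expi_sum; congr (_ * expi _).
  by rewrite /wgtd rmorph_prod.
by rewrite /dotp mulr_sumr; apply: eq_bigr => i _; rewrite mulrA.
Qed.

(** The transform factorizes over the coordinates; each factor is real because the sine integrals
    vanish, and it is bounded by [kern a]. *)
Lemma wgtd_cos_kernd a (z : Rd) : 0 < a ->
  leb.-integrable setT (EFin \o wgtd a) /\
  `|\int[leb]_xi (wgtd a xi * cos (2 * pi * dotp z xi))| <= kernd a z.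
Proof.
move=> a0.
have ci (y : Rd) i : cintegrable (@lebesgue_measure R) setT
    (fun t => (wgt a t)%:C * expi (2 * pi * y ord0 i * t)).
  split; under eq_fun do rewrite ?ReM ?ImM /= mul0r ?subr0 ?addr0.
    exact: (integrable_wgt a0 (@continuous_cosM _ _)).1.
  exact: (integrable_wgt a0 (@continuous_sinM _ _)).1.
have E (y : Rd) : (fun x : Rd => \prod_i ((wgt a (x ord0 i))%:C *
    expi (2 * pi * y ord0 i * x ord0 i))) =
    (fun x => (wgtd a x)%:C * expi (2 * pi * dotp y x)).
  by apply/funext => x; exact: wgtd_expi_prod.
split.
  (* At z = 0 the exponential is 1 and the product is the weight itself. *)
  have [[+ _] _] := cintegral_rV_prod (ci 0); apply: eq_integrable => // x _ /=.
  rewrite wgtd_expi_prod ReM /= mul0r subr0 /dotp big1 ?mulr0 ?cos0 ?mulr1//.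
  by move=> i _; rewrite mxE mul0r.
have [_] := cintegral_rV_prod (ci z); rewrite E => e.
have {}e : cabs2 (cintegral leb setT (fun x => (wgtd a x)%:C * expi (2 * pi * dotp z x))) <= kernd a z ^+ 2.
  rewrite e cabs2_prod -prodrXl; apply: ler_prod => i _; rewrite cabs2_ge0 /=.
  rewrite /cabs2 /=.
  under eq_Rintegral do rewrite mul0r subr0.
  under [X in _ + X ^+ 2]eq_Rintegral do rewrite mul0r addr0.
  rewrite wgt_sin// expr0n addr0 -real_normK ?num_real// ler_sqr ?nnegrE ?kern_ge0//.
  exact: wgt_cos_kern.
rewrite -ler_sqr ?nnegrE ?kernd_ge0// real_normK ?num_real//; apply: le_trans e.
apply: le_trans (Re2_le_cabs2 _) => /=.
by under [X in _ <= X ^+ 2]eq_Rintegral do rewrite mul0r subr0.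
Qed.

Lemma measurable_kernd a (f : Rd * Rd -> Rd) : measurable_fun setT f ->
  measurable_fun setT (fun z => kernd a (f z)).
Proof.
move=> mf; apply: measurable_prod => i _.
have mk : measurable_fun setT (kern a : R -> R).
  apply: continuous_measurable_fun.
  have -> : kern a = fun t : R => kern a (0 - t) by apply/funext => t; rewrite /kern sub0r mulrN sqrrN.
  exact: continuous_kern.
apply: measurableT_comp mk _; exact: measurableT_comp (measurable_rV_coord i) mf.
Qed.

Lemma integral_kernd a (x : Rd) : 0 < a ->
  (\int[leb]_y (kernd a (x - y))%:E <= ((16 * pi) ^+ d)%:E)%E.
Proof.
move=> a0; rewrite /kernd.
under eq_integral => y _ do under eq_bigr do rewrite !mxE.
rewrite (@ge0_integral_rV_prod R d (fun i t => kern a (x ord0 i - t))); last 2 first.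
- by move=> i; apply: continuous_measurable_fun; exact: continuous_kern.
- by move=> i t; exact: kern_ge0.
rewrite -[d in X in (_ <= X)%E]card_ord -prodr_const -prodEFin.
set F := fun i : 'I_d => (\int[lebesgue_measure]_t (kern a (x ord0 i - t))%:E)%E.
(* Nonnegativity is carried along because products of extended reals are monotone only for
   nonnegative factors. *)
suff : (0 <= \prod_(i < d) F i /\ \prod_(i < d) F i <= \prod_(i < d) (16 * pi)%:E)%E by case.
elim/big_ind2 : _ => // [x1 x2 y1 y2 [h1 h2] [h3 h4]|i _].
  by split; [exact: mule_ge0|exact: lee_pmul].
by split; [apply: integral_ge0 => t _; rewrite lee_fin kern_ge0|exact: integral_kern].
Qed.

Lemma kerndN a (z : Rd) : kernd a (- z) = kernd a z.
Proof. by apply: eq_bigr => i _; rewrite mxE /kern mulrN sqrrN. Qed.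

Lemma wgtd_nd n m (xi : Rd) : (n <= m)%N -> wgtd n.+1%:R xi <= wgtd m.+1%:R xi.
Proof.
move=> nm; apply: ler_prod => i _; rewrite wgt_ge0 /= /wgt ge_max !le_max lexx /=.
apply/orP; right; rewrite /parab lerD2l lerN2 !expr_div_n ler_wpM2l ?sqr_ge0//.
by rewrite lef_pV2 ?posrE ?exprn_gt0 ?ltr0n// ler_sqr ?nnegrE// ler_nat.
Qed.

Lemma wgt_cvg (t : R) : wgt n.+1%:R t @[n --> \oo] --> (1 : R).
Proof.
have h : (fun n => parab n.+1%:R t) @ \oo --> (1 : R).
  rewrite /parab -[X in _ --> X]subr0; apply: cvgB; first exact: cvg_cst.
  under eq_fun do rewrite expr_div_n -exprVn.
  rewrite -(mulr0 (t ^+ 2)); apply: cvgM; first exact: cvg_cst.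
  have h := @cvg_harmonic R; have h2 : (harmonic \* harmonic) n @[n --> \oo] --> (0 * 0 : R) by exact: cvgM.
  by rewrite mulr0 in h2.
apply: (@squeeze_cvgr _ _ _ _ (fun n => parab n.+1%:R t) (fun=> 1)) => //.
- by apply: nearW => n; rewrite wgt_le1 andbT /wgt le_max lexx orbT.
- exact: cvg_cst.
Qed.

Lemma wgtd_cvg (xi : Rd) : wgtd n.+1%:R xi @[n --> \oo] --> (1 : R).
Proof.
rewrite /wgtd; elim: (index_enum _) => [|i s IH].
  by under eq_fun do rewrite big_nil; exact: cvg_cst.
under eq_fun do rewrite big_cons.
have h : (fun n => wgt n.+1%:R (xi ord0 i)) \*
    (fun n => \prod_(j <- s) wgt n.+1%:R (xi ord0 j)) @ \oo --> (1 * 1 : R).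
  by apply: cvgM => //; exact: wgt_cvg.
by rewrite mulr1 in h.
Qed.

End kernel_rV.

Section sigma_finite_product.
Context d1 d2 (T1 : measurableType d1) (T2 : measurableType d2) (R : realType).
Variable m1 : {sigma_finite_measure set T1 -> \bar R}.
Variable m2 : {sigma_finite_measure set T2 -> \bar R}.

(* The library's canonical sigma-finiteness of a product measure is the one of
   products of probabilities, so that the general instance is not inferred. *)
Definition sf_prod : set (T1 * T2) -> \bar R := (m1 \x m2)%E.

HB.instance Definition _ := Measure.on sf_prod.

Let sf_prod_sigma_finite : sigma_finite setT sf_prod.
Proof.
have /sigma_finiteP[F [TF ndF Foo]] := sigma_finiteT m1.
have /sigma_finiteP[G [TG ndG Goo]] := sigma_finiteT m2.
exists (fun k => F k `*` G k).
  apply/seteqP; split=> // -[x y] _.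
  have [i _ Fi] : (\bigcup_k F k) x by rewrite -TF.
  have [j _ Gj] : (\bigcup_k G k) y by rewrite -TG.
  exists (maxn i j) => //; split.
    by move: Fi; exact/subsetPset/ndF/leq_maxl.
  by move: Gj; exact/subsetPset/ndG/leq_maxr.
move=> k; have [mF Fk] := Foo k; have [mG Gk] := Goo k.
split; first exact: measurableX.
by rewrite /sf_prod product_measure1E// lte_mul_pinfty// ge0_fin_numE.
Qed.

HB.instance Definition _ := Measure_isSigmaFinite.Build _ _ _ sf_prod
  sf_prod_sigma_finite.

End sigma_finite_product.

Section bessel.
Context {R : realType} {d : nat}.
Local Notation Rd := 'rV[R]_d.
Local Notation leb := (lebesgue_rV d).
Variable a : Rd -> R.
Hypothesis ia : leb.-integrable setT (EFin \o a).

Let ma : measurable_fun setT a.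
Proof. by apply/measurable_EFinP; exact: (measurable_int _ ia). Qed.

Definition fcos (xi : Rd) : R := \int[leb]_x (cos (2 * pi * dotp x xi) * a x).
Definition fsin (xi : Rd) : R := \int[leb]_x (sin (2 * pi * dotp x xi) * a x).

Lemma measurable_phase d1 (T : measurableType d1) (f g : T -> Rd) :
  measurable_fun setT f -> measurable_fun setT g ->
  measurable_fun setT (fun z => 2 * pi * dotp (f z) (g z)).
Proof. by move=> mf mg; apply: measurable_funM => //; exact: measurable_dotp. Qed.

Lemma measurable_fcos : measurable_fun setT fcos.
Proof.
apply: (measurable_Rintegral_param leb (f := fun z => cos (2 * pi * dotp z.2 z.1) * a z.2)).
apply: measurable_funM; last exact: measurableT_comp ma measurable_snd.
by apply: measurable_cos_comp; apply: measurable_phase.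
Qed.

Lemma measurable_fsin : measurable_fun setT fsin.
Proof.
apply: (measurable_Rintegral_param leb (f := fun z => sin (2 * pi * dotp z.2 z.1) * a z.2)).
apply: measurable_funM; last exact: measurableT_comp ma measurable_snd.
by apply: measurable_sin_comp; apply: measurable_phase.
Qed.

Lemma integrable_cos_phase xi : leb.-integrable setT (EFin \o (fun x => cos (2 * pi * dotp x xi) * a x)).
Proof.
apply: (integrable_bddM (c := 1)) => //.
  by apply: measurable_cos_comp; apply: measurable_phase.
by move=> x _; rewrite ler_norml cos_geN1 cos_le1.
Qed.

Lemma integrable_sin_phase xi : leb.-integrable setT (EFin \o (fun x => sin (2 * pi * dotp x xi) * a x)).
Proof.
apply: (integrable_bddM (c := 1)) => //.
  by apply: measurable_sin_comp; apply: measurable_phase.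
by move=> x _; rewrite ler_norml sin_geN1 sin_le1.
Qed.

Lemma dotpBl (x y z : Rd) : dotp (x - y) z = dotp x z - dotp y z.
Proof. by rewrite /dotp -sumrB; apply: eq_bigr => i _; rewrite !mxE mulrBl. Qed.

Local Notation mm := (sf_prod leb leb).

(** By cos (s - t) = cos s cos t + sin s sin t, the two squares merge into a double integral that
    involves the frequency only through x - y. *)
Lemma fourier_sqrE xi :
  fcos xi ^+ 2 + fsin xi ^+ 2 =
  \int[mm]_z (cos (2 * pi * dotp (z.1 - z.2) xi) * (a z.1 * a z.2)).
Proof.
have ic := integrable_cos_phase xi; have is_ := integrable_sin_phase xi.
rewrite !expr2 -!(Rintegral_prodM (m1 := leb) (m2 := leb))// -RintegralD//.
- apply: eq_Rintegral => z _; rewrite dotpBl mulrBr cosB; ring.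
- exact: (integrable_prodM ic ic).
- exact: (integrable_prodM is_ is_).
Qed.

(* Schur's test: by Fubini the left-hand side is a quadratic form in [a] whose
   kernel is dominated by [kernd A (x - y)]. *)
Lemma wgtd_bessel (A : R) : 0 < A ->
  (\int[leb]_xi (wgtd A xi * (fcos xi ^+ 2 + fsin xi ^+ 2))%:E <=
   ((16 * pi) ^+ d)%:E * \int[leb]_x (a x ^+ 2)%:E)%E.
Proof.
move=> A0.
have iW : leb.-integrable setT (EFin \o wgtd A) := (wgtd_cos_kernd 0 A0).1.
have iaa : mm.-integrable setT (EFin \o (fun z : Rd * Rd => a z.1 * a z.2)) := integrable_prodM ia ia.
pose g (p : Rd * (Rd * Rd)) : R :=
  cos (2 * pi * dotp (p.2.1 - p.2.2) p.1) * (wgtd A p.1 * (a p.2.1 * a p.2.2)).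
have msub : measurable_fun setT (fun z : Rd * Rd => z.1 - z.2).
  apply: measurable_fun_rVP => i; under eq_fun do rewrite !mxE.
  apply: measurable_funB.
    exact: measurableT_comp (measurable_rV_coord i) measurable_fst.
  exact: measurableT_comp (measurable_rV_coord i) measurable_snd.
have ig : (leb \x mm)%E.-integrable setT (EFin \o g).
  have ip := integrable_prodM iW iaa.
  apply: (integrable_bddM (c := 1) (f := fun p : Rd * (Rd * Rd) => cos (2 * pi * dotp (p.2.1 - p.2.2) p.1))
    measurableT _ _ ip) => //.
  - apply: measurable_cos_comp; apply: measurable_phase => //.
    exact: measurableT_comp msub measurable_snd.
  - by move=> x _; rewrite ler_norml cos_geN1 cos_le1.
have -> : (\int[leb]_xi (wgtd A xi * (fcos xi ^+ 2 + fsin xi ^+ 2))%:E =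
    \int[leb]_xi fubini_F mm (EFin \o g) xi)%E.
  apply: eq_integral => xi _; rewrite fourier_sqrE /fubini_F /=.
  have ic : mm.-integrable setT (EFin \o (fun z : Rd * Rd =>
      cos (2 * pi * dotp (z.1 - z.2) xi) * (a z.1 * a z.2))).
    apply: (integrable_bddM (c := 1)) => //.
    - by apply: measurable_cos_comp; apply: measurable_phase.
    - by move=> x _; rewrite ler_norml cos_geN1 cos_le1.
  rewrite -RintegralZl// -Rintegral_EFin//.
    by apply: eq_integral => z _; rewrite /g /= mulrCA.
  exact: (integrableZl _ (wgtd A xi) ic).
(* Fubini: the frequency is now integrated first, which yields the cosine transform of the weight at
   x - y. *)
rewrite (integral12_prod_meas1 ig) -(integral21_prod_meas1 ig).
have mK : measurable_fun setT (fun z : Rd * Rd => kernd A (z.1 - z.2)).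
  exact: measurable_kernd.
have ma1 : measurable_fun setT (fun z : Rd * Rd => a z.1) by exact: measurableT_comp ma measurable_fst.
have ma2 : measurable_fun setT (fun z : Rd * Rd => a z.2) by exact: measurableT_comp ma measurable_snd.
(* |a x a y| <= (a x^2 + a y^2) / 2 splits the form into two symmetric halves. In each of them the
   variable without [a] is integrated first, so only the mass of the kernel counts. *)
apply: (@le_trans _ _ (\int[mm]_z
   ((a z.1 ^+ 2 * kernd A (z.1 - z.2))%:E * 2^-1%:E + (a z.2 ^+ 2 * kernd A (z.1 - z.2))%:E * 2^-1%:E))%E).
  apply: (le_trans (lee_abs _)); apply: (le_trans (le_abse_integral _ _ _)) => //.
    exact: (measurable_fubini_G ig).
  apply: ge0_le_integral => //.
  - by apply: measurableT_comp => //; exact: (measurable_fubini_G ig).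
  - apply: emeasurable_funD; apply: emeasurable_funM => //.
      by apply/measurable_EFinP; apply: measurable_funM => //; exact: measurable_funX.
    by apply/measurable_EFinP; apply: measurable_funM => //; exact: measurable_funX.
  move=> z _.
  have iz : leb.-integrable setT (EFin \o (fun xi => wgtd A xi * cos (2 * pi * dotp (z.1 - z.2) xi))).
    have ic : leb.-integrable setT (EFin \o (fun xi => cos (2 * pi * dotp (z.1 - z.2) xi) * wgtd A xi)).
      apply: (integrable_bddM (c := 1)) => //.
      - by apply: measurable_cos_comp; apply: measurable_phase.
      - by move=> x _; rewrite ler_norml cos_geN1 cos_le1.
    by apply: eq_integrable ic => // x _ /=; rewrite mulrC.
  have -> : fubini_G leb (EFin \o g) z =
     (a z.1 * a z.2 * \int[leb]_xi (wgtd A xi * cos (2 * pi * dotp (z.1 - z.2) xi)))%:E.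
    rewrite -RintegralZl// -Rintegral_EFin//; last exact: (integrableZl _ (a z.1 * a z.2) iz).
    by apply: eq_integral => xi _; rewrite /g /=; congr EFin; ring.
  rewrite -!EFinM -EFinD lee_fin normrM.
  have k0 := kernd_ge0 (z.1 - z.2) A0.
  apply: (@le_trans _ _ (`|a z.1 * a z.2| * kernd A (z.1 - z.2))).
    by rewrite ler_wpM2l//; exact: (wgtd_cos_kernd _ A0).2.
  rewrite [leRHS](_ : _ = (a z.1 ^+ 2 + a z.2 ^+ 2) / 2 * kernd A (z.1 - z.2)); last by field.
  rewrite ler_wpM2r//.
  rewrite normrM -(real_normK (num_real (a z.1))) -(real_normK (num_real (a z.2))).
  have := sqr_ge0 (`|a z.1| - `|a z.2|).
  move: (`|a z.1|) (`|a z.2|) => p q; rewrite sqrrB; lra.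
have m1 : measurable_fun setT (fun z : Rd * Rd => (a z.1 ^+ 2 * kernd A (z.1 - z.2))%:E).
  by apply/measurable_EFinP; apply: measurable_funM => //; exact: measurable_funX.
have m2 : measurable_fun setT (fun z : Rd * Rd => (a z.2 ^+ 2 * kernd A (z.1 - z.2))%:E).
  by apply/measurable_EFinP; apply: measurable_funM => //; exact: measurable_funX.
have g1 z : (0 <= (a z.1 ^+ 2 * kernd A (z.1 - z.2))%:E)%E.
  by rewrite lee_fin mulr_ge0 ?sqr_ge0 ?kernd_ge0.
have g2 z : (0 <= (a z.2 ^+ 2 * kernd A (z.1 - z.2))%:E)%E.
  by rewrite lee_fin mulr_ge0 ?sqr_ge0 ?kernd_ge0.
set M := ((16 * pi) ^+ d)%:E; have M0 : (0 <= M)%E by rewrite lee_fin exprn_ge0// mulr_ge0// pi_ge0.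
have ma22 : measurable_fun setT (fun x => (a x ^+ 2)%:E).
  by apply/measurable_EFinP; exact: measurable_funX.
have mKy x : measurable_fun setT (fun y : Rd => (kernd A (x - y))%:E).
  apply/measurable_EFinP.
  exact: (measurableT_comp mK (@measurable_pair1 _ _ Rd Rd x)).
have kb x : (\int[leb]_y ((a x ^+ 2)%:E * (kernd A (x - y))%:E) <= M * (a x ^+ 2)%:E)%E.
  rewrite ge0_integralZl ?lee_fin ?sqr_ge0//; last by move=> y _; rewrite lee_fin kernd_ge0.
  by rewrite muleC lee_wpmul2r ?lee_fin ?sqr_ge0//; exact: integral_kernd.
have b1 : (\int[mm]_z (a z.1 ^+ 2 * kernd A (z.1 - z.2))%:E <= M * \int[leb]_x (a x ^+ 2)%:E)%E.
  rewrite fubini_tonelli1// -ge0_integralZl//; last by move=> x _; rewrite lee_fin sqr_ge0.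
  apply: ge0_le_integral => //.
  - by move=> x _; apply: integral_ge0.
  - exact: measurable_fun_fubini_tonelli_F.
  - exact: measurable_funeM.
  by move=> x _; rewrite /fubini_F /=; under eq_integral do rewrite EFinM; exact: kb.
have b2 : (\int[mm]_z (a z.2 ^+ 2 * kernd A (z.1 - z.2))%:E <= M * \int[leb]_x (a x ^+ 2)%:E)%E.
  rewrite fubini_tonelli2// -ge0_integralZl//; last by move=> x _; rewrite lee_fin sqr_ge0.
  apply: ge0_le_integral => //.
  - by move=> x _; apply: integral_ge0.
  - exact: measurable_fun_fubini_tonelli_G.
  - exact: measurable_funeM.
  by move=> x _; rewrite /fubini_G /=; under eq_integral do rewrite EFinM -kerndN opprB; exact: kb.
rewrite ge0_integralD//; last 4 first.
- by move=> z _; rewrite mule_ge0// lee_fin.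
- by apply: emeasurable_funM.
- by move=> z _; rewrite mule_ge0// lee_fin.
- by apply: emeasurable_funM.
rewrite !ge0_integralZr//.
rewrite -ge0_muleDl ?integral_ge0//.
rewrite -[leRHS]mule1 (_ : 1%E = (2 * 2^-1)%:E :> \bar R); last by rewrite divff.
rewrite EFinM muleA lee_wpmul2r ?lee_fin//.
rewrite (_ : 2%:E = 1 + 1)%E// ge0_muleDr// !mule1; exact: leeD.
Qed.

(** The constant of [wgtd_bessel] does not depend on the weight, which increases to 1 and is removed
    by monotone convergence. The parameter n + 1 keeps its width positive. *)
Lemma bessel :
  (\int[leb]_xi (fcos xi ^+ 2 + fsin xi ^+ 2)%:E <=
   ((16 * pi) ^+ d)%:E * \int[leb]_x (a x ^+ 2)%:E)%E.
Proof.
have mT : measurable_fun setT (fun xi => fcos xi ^+ 2 + fsin xi ^+ 2).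
  by apply: measurable_funD; apply: measurable_funX; [exact: measurable_fcos|exact: measurable_fsin].
have T0 xi : 0 <= fcos xi ^+ 2 + fsin xi ^+ 2 by rewrite addr_ge0 ?sqr_ge0.
have mW n : measurable_fun setT (fun xi => (wgtd n.+1%:R xi * (fcos xi ^+ 2 + fsin xi ^+ 2))%:E).
  apply/measurable_EFinP; apply: measurable_funM => //.
  by apply/measurable_EFinP; exact: (measurable_int _ (wgtd_cos_kernd 0 (ltr0Sn R n)).1).
have cv : (\int[leb]_xi (wgtd n.+1%:R xi * (fcos xi ^+ 2 + fsin xi ^+ 2))%:E @[n --> \oo] -->
   \int[leb]_xi (fcos xi ^+ 2 + fsin xi ^+ 2)%:E)%E.
  rewrite [X in _ --> X](_ : _ = (\int[leb]_xi
     limn (fun n => (wgtd n.+1%:R xi * (fcos xi ^+ 2 + fsin xi ^+ 2))%:E))%E); last first.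
    apply: eq_integral => xi _; apply/esym/cvg_lim => //.
    apply: cvg_EFin; first exact: nearW.
    set c := fcos xi ^+ 2 + _.
    have h : (fun n => wgtd n.+1%:R xi) \* (fun=> c) @ \oo --> (1 * c).
      by apply: cvgM; [exact: wgtd_cvg|exact: cvg_cst].
    by rewrite mul1r in h.
  apply: cvg_monotone_convergence => //.
  - by move=> n xi _; rewrite lee_fin mulr_ge0 ?wgtd_ge0.
  - by move=> xi _ n m nm; rewrite lee_fin ler_wpM2r// wgtd_nd.
rewrite -(cvg_lim _ cv)//; apply: lime_le; first by apply/cvg_ex; eexists; exact: cv.
by apply: nearW => n; exact: wgtd_bessel.
Qed.

End bessel.

(** * Weakly null sequences in L^2 are bounded *)

Section square_integrable.
Context d (T : measurableType d) (R : realType).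
Variables (mu : {measure set T -> \bar R}) (D : set T).
Hypothesis mD : measurable D.

Definition sqint (f : T -> R) :=
  measurable_fun D f /\ mu.-integrable D (EFin \o (fun x => f x ^+ 2)).

Lemma sqintM f g : sqint f -> sqint g ->
  mu.-integrable D (EFin \o (fun x => f x * g x)).
Proof.
move=> [mf if2] [mg ig2].
apply: (integrable_Rle (g := fun x => f x ^+ 2 + g x ^+ 2)) => //.
- exact: measurable_funM.
- move=> x _; rewrite normrM -(real_normK (num_real (f x))) -(real_normK (num_real (g x))).
  have := sqr_ge0 (`|f x| - `|g x|); rewrite sqrrB => h.
  have : 0 <= `|f x| * `|g x| by rewrite mulr_ge0.
  by move: h; move: (`|f x|) (`|g x|) => p q; lra.
- by apply: eq_integrable (integrableD mD if2 ig2).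
Qed.

Lemma sqintZ c f : sqint f -> sqint (fun x => c * f x).
Proof.
move=> [mf if2]; split; first exact: measurable_funM.
apply: eq_integrable (integrableZl mD (c ^+ 2) if2) => // x _ /=.
by rewrite exprMn EFinM.
Qed.

Lemma sqint_le (f g : T -> R) : measurable_fun D f -> (forall x, D x -> f x ^+ 2 <= g x) ->
  mu.-integrable D (EFin \o g) -> sqint f.
Proof.
move=> mf fg ig; split => //; apply: (integrable_Rle (g := g)) => //.
  exact: measurable_funX.
by move=> x Dx; rewrite ger0_norm ?sqr_ge0// fg.
Qed.

Lemma Rintegral_sumr (I : Type) (s : seq I) (f : I -> T -> R) :
  (forall i, mu.-integrable D (EFin \o f i)) ->
  mu.-integrable D (EFin \o (fun x => \sum_(i <- s) f i x)) /\
  \int[mu]_(x in D) (\sum_(i <- s) f i x) = \sum_(i <- s) \int[mu]_(x in D) f i x.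
Proof.
move=> fi; elim: s => [|i s [IHi IH]].
  rewrite big_nil; split.
    by apply: eq_integrable (integrable0 _ _) => // x _ /=; rewrite big_nil.
  under eq_Rintegral do rewrite big_nil.
  by rewrite Rintegral_cst// mul0r.
split.
  by apply: eq_integrable (integrableD mD (fi i) IHi) => // x _ /=; rewrite big_cons.
by under eq_Rintegral do rewrite big_cons; rewrite RintegralD// IH big_cons.
Qed.

(** Cauchy-Schwarz with the weights 2^-j, whose sum is at most 2; the induction splits off the first
    term by (x + y)^2 <= 2 (x^2 + y^2). *)
Lemma sum_sqr_geometric n (a : nat -> R) :
  (\sum_(j < n) a j) ^+ 2 <= 2 * \sum_(j < n) 2 ^+ j * a j ^+ 2.
Proof.
elim: n a => [|n IH] a; first by rewrite !big_ord0 expr0n mulr0.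
rewrite !big_ord_recl /= expr0 mul1r.
have := IH (fun j => a j.+1); set A := \sum_(j < n) a _; set B := \sum_(j < n) _ => h.
rewrite -/A.
have -> : \sum_(i < n) 2 ^+ bump 0 i * a (bump 0 i) ^+ 2 = 2 * B.
  by rewrite mulr_sumr; apply: eq_bigr => i _; rewrite /bump /= add1n exprS mulrA.
apply: (@le_trans _ _ (2 * (a 0 ^+ 2 + A ^+ 2))).
  have := sqr_ge0 (a 0%N - A); rewrite !expr2; lra.
by rewrite ler_pM2l// lerD2l.
Qed.

Lemma geometric_half_le n : \sum_(j < n) (2^-1 : R) ^+ j <= 2.
Proof.
suff -> : \sum_(j < n) (2^-1 : R) ^+ j = 2 - 2 * 2^-1 ^+ n.
  by rewrite gerBl mulr_ge0// exprn_ge0.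
elim: n => [|n IH]; first by rewrite big_ord0 expr0 mulr1 subrr.
rewrite big_ord_recr /= IH exprS; by move: (_ ^+ n) => z; field.
Qed.

Lemma Rdominated_convergence (f_ : nat -> T -> R) (f : T -> R) (g : T -> \bar R) :
  (forall n, measurable_fun D (f_ n)) -> measurable_fun D f ->
  (forall x, D x -> f_ ^~ x @ \oo --> f x) -> mu.-integrable D g ->
  (forall n x, D x -> (`|f_ n x|%:E <= g x)%E) ->
  mu.-integrable D (EFin \o f) /\
  (fun n => \int[mu]_(x in D) f_ n x) @ \oo --> \int[mu]_(x in D) f x.
Proof.
move=> mf_ mf cv ig fg.
have [|||||i1 _ h] := @dominated_convergence _ _ _ mu D mD (fun n => EFin \o f_ n) (EFin \o f) g.
- by move=> n; apply/measurable_EFinP.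
- exact/measurable_EFinP.
- by apply: aeW => x Dx; apply: cvg_EFin; [exact: nearW|exact: cv].
- exact: ig.
- by apply: aeW => x n Dx; exact: fg.
by split => //; apply: fine_cvg; rewrite -Rintegral_EFin.
Qed.

(* The library has no completeness of L^2, so that Banach-Steinhaus is not
   available: a function on which a weakly null unbounded sequence is unbounded is
   the sum of the series with terms 2^-k y_k / |y_k|, made absolutely convergent
   almost everywhere by the integrability of [H]. *)
Section gliding_hump.
Variable y : nat -> T -> R.
Hypothesis ysq : forall k, sqint (y k).
Let ip j k := \int[mu]_(x in D) (y j x * y k x).
Hypothesis y_diag : forall k, 16 ^+ k <= ip k k.
Hypothesis y_off : forall j k, j <> k -> `|ip j k| <= 1.

Let nrm k := Num.sqrt (ip k k).
Let b k : R := 2^-1 ^+ k / nrm k.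

Let nrm_ge k : 4 ^+ k <= nrm k.
Proof.
have -> : 4 ^+ k = Num.sqrt ((4 ^+ k) ^+ 2) :> R by rewrite sqrtr_sqr ger0_norm// exprn_ge0.
rewrite /nrm ler_wsqrtr// -exprM mulnC exprM (_ : 4 ^+ 2 = 16 :> R)//; ring.
Qed.

Let nrm_ge1 k : 1 <= nrm k.
Proof. by apply: le_trans (nrm_ge k); rewrite exprn_ege1// ler1n. Qed.

Let nrm_gt0 k : 0 < nrm k. Proof. exact: lt_le_trans (nrm_ge1 k). Qed.

Let b_ge0 k : 0 <= b k.
Proof. by rewrite divr_ge0 ?exprn_ge0// ltW. Qed.

Let b_le k : b k <= 2^-1 ^+ k.
Proof. by rewrite ler_pdivrMr// ler_peMr// exprn_ge0. Qed.

(** b_k |y_k|^2 = 2^-k |y_k| with |y_k| >= 4^k: the k-th term alone makes the pairing with y_k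
    large. *)
Let bip k : 2 ^+ k <= b k * ip k k.
Proof.
have ipE : ip k k = nrm k * nrm k.
  by rewrite -expr2 sqr_sqrtr// (le_trans _ (y_diag k))// exprn_ge0.
rewrite ipE /b mulrA divfK ?gt_eqF//.
apply: le_trans (ler_wpM2l _ (nrm_ge k)); last by rewrite exprn_ge0.
rewrite -exprMn; apply: lerXn2r; rewrite ?nnegrE//; lra.
Qed.

(** The squared terms with the weights of [sum_sqr_geometric]; the integral of [w k] is 2^k * 4^-k =
    2^-k, hence summable. *)
Let w k x : R := 2 ^+ k * (b k * y k x) ^+ 2.
Let H x : \bar R := (\sum_(k <oo) (w k x)%:E)%E.

Let w_ge0 k x : 0 <= w k x.
Proof. by apply: mulr_ge0; [exact: exprn_ge0|exact: sqr_ge0]. Qed.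

Let iw k : mu.-integrable D (EFin \o w k) /\ \int[mu]_(x in D) w k x = 2^-1 ^+ k.
Proof.
have [mb ib] := sqintZ (b k) (ysq k).
split; first exact: (integrableZl mD (2 ^+ k) ib).
rewrite RintegralZl//.
have -> : \int[mu]_(x in D) (b k * y k x) ^+ 2 = b k ^+ 2 * ip k k.
  rewrite -RintegralZl//; last exact: sqintM.
  by apply: eq_Rintegral => x _; rewrite exprMn expr2 [y k x ^+ 2]expr2.
have ipE : ip k k = nrm k ^+ 2.
  by rewrite sqr_sqrtr// (le_trans _ (y_diag k))// exprn_ge0.
rewrite ipE /b -exprMn divfK ?gt_eqF// -exprM mulnC exprM -exprMn; congr (_ ^+ _); by field.
Qed.

Let mw k : measurable_fun D (EFin \o w k).
Proof. exact: (measurable_int _ (iw k).1). Qed.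

Let mH : measurable_fun D H.
Proof.
by apply: ge0_emeasurable_sum => [k x Dx _|k _]; [by rewrite lee_fin; exact: w_ge0|exact: mw].
Qed.

Let iH : (\int[mu]_(x in D) H x < +oo)%E.
Proof.
rewrite integral_nneseries//; last by move=> k x _; rewrite lee_fin; exact: w_ge0.
apply: (@le_lt_trans _ _ 2%:E); last exact: ltry.
apply: lime_le; first by apply: is_cvg_nneseries => k _ _; apply: integral_ge0 => x _; rewrite lee_fin; exact: w_ge0.
apply: nearW => n.
rewrite big_mkord; under eq_bigr => k _ do rewrite (Rintegral_EFin mD (iw k).1) (iw k).2.
by rewrite sumEFin lee_fin geometric_half_le.
Qed.

Let iHD : mu.-integrable D H.
Proof.
apply/integrableP; split; first exact: mH.
under eq_integral => x _.
  rewrite gee0_abs; last by apply: nneseries_ge0 => k _ _; rewrite lee_fin; exact: w_ge0.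
  over.
exact: iH.
Qed.

Let S n x := \sum_(j < n) b j * y j x.
Let E := D `&` [set x | (H x < +oo)%E].
(** Restricted to E, which has full measure in D, the partial sums converge at every point, so g is
    measurable without exceptional sets. *)
Let g x := limn (fun n => (S n \_ E) x).

Let S_le n x : (\sum_(j < n) `|b j * y j x|) ^+ 2 <= 2 * \sum_(j < n) w j x.
Proof.
apply: (le_trans (sum_sqr_geometric n (fun j => `|b j * y j x|))).
rewrite ler_pM2l// ler_sum// => j _.
by rewrite /w real_normK ?num_real.
Qed.

Let w_le n x : ((\sum_(j < n) w j x)%:E <= H x)%E.
Proof.
rewrite -sumEFin -(big_mkord xpredT (fun j => (w j x)%:E)).
by apply: nneseries_lim_ge => k _ _; rewrite lee_fin; exact: w_ge0.
Qed.

Let H_ge0 x : (0 <= H x)%E.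
Proof. by apply: nneseries_ge0 => k _ _; rewrite lee_fin; exact: w_ge0. Qed.

Let w_le_fine n x : E x -> \sum_(j < n) w j x <= fine (H x).
Proof.
move=> [Dx Hx]; rewrite -lee_fin fineK ?ge0_fin_numE//; exact: w_le.
Qed.

Let S_norm n x : `|S n x| <= \sum_(j < n) `|b j * y j x|.
Proof. exact: ler_norm_sum. Qed.

Let S_sqr n x : E x -> S n x ^+ 2 <= 2 * fine (H x).
Proof.
move=> Ex; rewrite -(real_normK (num_real _)).
apply: (@le_trans _ _ ((\sum_(j < n) `|b j * y j x|) ^+ 2)).
  by rewrite ler_sqr ?nnegrE ?sumr_ge0//; exact: S_norm.
apply: (le_trans (S_le n x)); rewrite ler_pM2l//; exact: w_le_fine.
Qed.

Let S_cvg x : (fun n => (S n \_ E) x) @ \oo --> g x.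
Proof.
suff : cvgn (fun n => (S n \_ E) x) by [].
have [Ex|nEx] := pselect (E x); last first.
  rewrite (_ : (fun n => _) = fun=> 0); first exact: is_cvg_cst.
  by apply/funext => n; rewrite patchE memNset.
rewrite (_ : (fun n => _) = series (fun j => b j * y j x)); last first.
  by apply/funext => n; rewrite patchE mem_set// /series /= big_mkord.
apply: normed_cvg; apply: nondecreasing_is_cvgn.
  apply: nondecreasing_series => k _ _; exact: normr_ge0.
(* The sum t of the absolute values satisfies t^2 <= 2 H, and (t - 1)^2 >= 0 turns this into 2 t <=
   1 + 2 H. *)
exists (1 + 2 * fine (H x)) => _ [n _ <-].
rewrite [leLHS](_ : _ = \sum_(j < n) `|b j * y j x|); last first.
  by rewrite -(big_mkord xpredT (fun j => `|b j * y j x|)).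
have /= := S_le n x; set t := \sum_(j < n) _.
have := w_le_fine n Ex; set v := \sum_(j < n) _ => h1 h2.
have : 0 <= fine (H x) by rewrite fine_ge0.
have : 0 <= (t - 1) ^+ 2 by exact: sqr_ge0.
rewrite sqrrB !expr2; rewrite expr2 in h2; lra.
Qed.

Let mE : measurable E.
Proof.
have := mH mD (emeasurable_itv `]-oo, +oo%E[).
rewrite (_ : D `&` _ = E)//; apply/seteqP; split => x /= [Dx]; by rewrite in_itv.
Qed.

Let mS n : measurable_fun D (S n).
Proof.
apply: measurable_sum => j; apply: measurable_funM => //; exact: (ysq j).1.
Qed.

Let mSE n : measurable_fun D (S n \_ E).
Proof.
by apply/(measurable_restrict _ mE mD); apply: measurable_funS (mS n).
Qed.

Let mg : measurable_fun D g.
Proof. by apply: (measurable_fun_cvg mSE) => x Dx; exact: S_cvg. Qed.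

Let SE_sqr n x : (((S n \_ E) x ^+ 2)%:E <= 2%:E * H x)%E.
Proof.
have [Ex|nEx] := pselect (E x); last first.
  by rewrite patchE memNset// expr0n /= mule_ge0.
rewrite patchE mem_set// -[H x]fineK ?ge0_fin_numE//; last by case: Ex.
by rewrite -EFinM lee_fin S_sqr.
Qed.

Let g_sqr x : ((g x ^+ 2)%:E <= 2%:E * H x)%E.
Proof.
have h : (fun n => ((S n \_ E) x ^+ 2)%:E) @ \oo --> (g x ^+ 2)%:E.
  apply: cvg_EFin; first exact: nearW.
  have : (fun n => (S n \_ E) x) \* (fun n => (S n \_ E) x) @ \oo --> g x * g x.
    by apply: cvgM; exact: S_cvg.
  by rewrite -expr2.
rewrite -(cvg_lim _ h)//; apply: lime_le; first by apply/cvg_ex; eexists; exact: h.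
by apply: nearW => n; exact: SE_sqr.
Qed.

Let i2H : mu.-integrable D (fun x => 2%:E * H x)%E := integrableZl mD 2 iHD.

Lemma gliding_hump : exists2 f : T -> R, sqint f &
  forall k, 2 ^+ k - 2 <= \int[mu]_(x in D) (y k x * f x).
Proof.
have gsq : sqint g.
  split=> //; apply: (le_integrable mD _ _ i2H).
    by apply/measurable_EFinP; exact: measurable_funX.
  move=> x Dx; rewrite /= ger0_norm ?sqr_ge0// gee0_abs ?mule_ge0//.
exists g => // k.
have msk n : measurable_fun D (fun x => y k x * (S n \_ E) x).
  by apply: measurable_funM; [exact: (ysq k).1|exact: mSE].
have [_ cv] : mu.-integrable D (EFin \o (fun x => y k x * g x)) /\
    (fun n => \int[mu]_(x in D) (y k x * (S n \_ E) x)) @ \oo --> \int[mu]_(x in D) (y k x * g x).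
  apply: (Rdominated_convergence (g := fun x => (y k x ^+ 2)%:E + 2%:E * H x)%E) => //.
  - by apply: measurable_funM; [exact: (ysq k).1|exact: mg].
  - by move=> x Dx; apply: cvgM; [exact: cvg_cst|exact: S_cvg].
  - exact: (integrableD mD (ysq k).2 i2H).
  move=> n x Dx; apply: (@le_trans _ _ (y k x ^+ 2 + (S n \_ E) x ^+ 2)%:E).
    rewrite lee_fin normrM -(real_normK (num_real (y k x))) -(real_normK (num_real ((S n \_ E) x))).
    have := sqr_ge0 (`|y k x| - `|(S n \_ E) x|); rewrite sqrrB => h.
    have : 0 <= `|y k x| * `|(S n \_ E) x| by rewrite mulr_ge0.
    by move: h; move: (`|y k x|) (`|(S n \_ E) x|) => p q; lra.
  by rewrite EFinD; apply: leeD => //; exact: SE_sqr.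
rewrite -(cvg_lim _ cv)//; apply: limr_ge; first by apply/cvg_ex; eexists; exact: cv.
(* From n = k + 1 on, the partial sum contains the term j = k. *)
exists k.+1 => // n /= kn.
have -> : \int[mu]_(x in D) (y k x * (S n \_ E) x) = \int[mu]_(x in D) (y k x * S n x).
  congr fine; apply: ae_eq_integral => //.
  - exact/measurable_EFinP.
  - by apply/measurable_EFinP; apply: measurable_funM => //; exact: (ysq k).1.
  apply: filterS (integrable_ae mD iHD) => x Hfin Dx; congr EFin; congr (_ * _).
  rewrite patchE mem_set//; split => //=.
  by move: (Hfin Dx); rewrite ge0_fin_numE.
have -> : \int[mu]_(x in D) (y k x * S n x) = \sum_(j < n) b j * ip k j.
  under eq_Rintegral do rewrite /S mulr_sumr.
  have ii j : mu.-integrable D (EFin \o (fun x => y k x * (b j * y j x))).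
    by apply: sqintM => //; exact: sqintZ.
  rewrite (Rintegral_sumr _ (fun j : 'I_n => ii j)).2; apply: eq_bigr => j _.
  rewrite -RintegralZl//; last exact: sqintM.
  by apply: eq_Rintegral => x _; rewrite mulrCA.
(* The term j = k is at least 2^k. The others are at least - b_j >= - 2^-j each, hence at least - 2
   together. *)
rewrite (bigD1 (Ordinal kn))//=; apply: lerD; first exact: bip.
apply: (@le_trans _ _ (- \sum_(j < n) 2^-1 ^+ j)).
  by rewrite lerN2 geometric_half_le.
rewrite [X in - X](bigD1 (Ordinal kn))//= opprD -[leRHS]add0r; apply: lerD.
  by rewrite oppr_le0 exprn_ge0.
rewrite -sumrN; apply: ler_sum => j jk.
have /y_off h : k <> j by move=> kj; move/eqP: jk; apply; apply: val_inj.
apply: (@le_trans _ _ (- b j)); first by rewrite lerN2.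
rewrite -[leLHS]mulr1 mulNr -mulrN ler_wpM2l//.
by move: h; rewrite ler_norml => /andP[].
Qed.

End gliding_hump.

(** If the norms were unbounded, some subsequence would have rapidly growing norms and almost
    orthogonal terms, since each h i is itself an admissible test function. The function given by
    [gliding_hump] then contradicts weak convergence. *)
Lemma weak_null_bounded (h : nat -> T -> R) : (forall n, sqint (h n)) ->
  (forall f, sqint f -> (fun n => \int[mu]_(x in D) (h n x * f x)) @ \oo --> (0 : R)) ->
  exists C : R, forall n, \int[mu]_(x in D) (h n x ^+ 2) <= C.
Proof.
move=> hsq hw; apply: contrapT => /forallNP unb.
have big (C : R) : exists n, C < \int[mu]_(x in D) (h n x ^+ 2).
  have /existsNP[n /negP] := unb C; rewrite -ltNge => ?; by exists n.
have s0 i : 0 <= \int[mu]_(x in D) (h i x ^+ 2).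
  by apply: Rintegral_ge0 => x _; exact: sqr_ge0.
(* The first N integrals are finite: exceeding C plus their sum forces n >= N. *)
have bigN (C : R) N : 0 <= C -> exists2 n, (N <= n)%N & C <= \int[mu]_(x in D) (h n x ^+ 2).
  move=> C0; have [n nC] := big (C + \sum_(i < N) \int[mu]_(x in D) (h i x ^+ 2)).
  exists n; last by apply: le_trans (ltW nC); rewrite lerDl sumr_ge0.
  rewrite leqNgt; apply/negP => nN; move: nC.
  rewrite (bigD1 (Ordinal nN))//= addrCA gtrDl ltNge => /negP; apply.
  by rewrite addr_ge0// sumr_ge0.
pose ip i j := \int[mu]_(x in D) (h i x * h j x).
(* The new index is almost orthogonal to all h i with i <= p, not only to the selected ones, so that
   the choice depends on the last index alone. *)
have next (kp : nat * nat) : exists n, [/\ (kp.2 < n)%N, 16 ^+ kp.1 <= ip n n &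
    forall i, (i <= kp.2)%N -> `|ip n i| <= 1].
  case: kp => k p /=.
  have : \forall n \near \oo, forall i : 'I_p.+1, `|ip n i| <= 1.
    apply: filter_forall => i.
    have := hw (h i) (hsq i) => /cvgr0Pnorm_le; exact.
  move=> [N _ NP].
  have [n Nn nk] := bigN (16 ^+ k) (maxn N p.+1) (exprn_ge0 _ (ler0n _ _)).
  move: Nn; rewrite geq_max => /andP[Nn pn]; exists n; split=> //.
  by move=> i ip'; have := NP n Nn (inord i); rewrite /= inordK.
have [F FP] := choice next.
pose s := fix s k := if k is k'.+1 then F (k, s k') else F (0%N, 0%N).
have s_lt k : (s k < s k.+1)%N by have [] := FP (k.+1, s k).
have s_mono j k : (j <= k)%N -> (s j <= s k)%N.
  by apply: (homo_leq (leqnn) leq_trans) => i; exact: ltnW.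
have s_ge k : (k <= s k)%N.
  by elim: k => // k IH; exact: leq_ltn_trans IH (s_lt k).
have ipC i j : ip i j = ip j i by apply: eq_Rintegral => x _; rewrite mulrC.
have lt_off j k : (j < k)%N -> `|ip (s k) (s j)| <= 1.
  case: k => // k; rewrite ltnS => jk; have [_ _] := FP (k.+1, s k); apply; exact: s_mono.
have [|j k jk|f fsq fP] := @gliding_hump (fun k => h (s k)) (fun k => hsq _).
- by case=> [|k]; [have [] := FP (0%N, 0%N)|have [] := FP (k.+1, s k)].
- rewrite -/(ip _ _); have [kj|kj|//] := ltngtP j k; last exact: lt_off.
  by rewrite ipC; exact: lt_off.
have /cvgr0Pnorm_le/(_ 1 ltr01)[N _ NP] := hw f fsq.
(* At this index the pairing is at most 1 by weak convergence, but at least 2^2 - 2 = 2 by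
   construction. *)
have := NP (s (maxn N 2)) (leq_trans (leq_maxl _ _) (s_ge _)).
rewrite /= ler_norml => /andP[_ le1].
have := le_trans (fP (maxn N 2)) le1.
rewrite lerBlDr leNgt => /negP; apply.
apply: (@lt_le_trans _ _ (2 ^+ 2)); first by rewrite expr2; lra.
by rewrite ler_eXn2l ?leq_maxr// ltr1n.
Qed.

End square_integrable.

(** * Test functions *)

Section flat_function.
Context {R : realType}.

(* The derivatives of exp (- 1 / t) are linear combinations of these functions. *)
Definition flat (n : nat) (t : R) : R :=
  if 0 < t then t^-1 ^+ n * expR (- t^-1) else 0.

(** s / n <= exp (s / n), raised to the power n. *)
Lemma expn_le_expR (s : R) n : 0 <= s -> s ^+ n <= n%:R ^+ n * expR s.
Proof.
move=> s0; case: n => [|n].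
  by rewrite !expr0 mul1r (le_trans _ (expR_ge1Dx s))// lerDl.
have n0 : 0 < n.+1%:R :> R by rewrite ltr0n.
have -> : expR s = expR (s / n.+1%:R) ^+ n.+1.
  by rewrite -expRM_natr divfK ?gt_eqF.
rewrite -exprMn; apply: lerXn2r; rewrite ?nnegrE ?mulr_ge0 ?expR_ge0//.
rewrite -ler_pdivrMl// mulrC (le_trans _ (expR_ge1Dx _))// lerDr.
exact: ler01.
Qed.

Lemma flat_ge0 n t : 0 <= flat n t.
Proof.
rewrite /flat; case: ltP => // t0.
by rewrite mulr_ge0 ?expR_ge0 ?exprn_ge0 ?invr_ge0 ?ltW.
Qed.

(** t^-n = t^2 t^-(n + 2), and the second factor is absorbed by the exponential. Quadratic vanishing
    makes [flat n] differentiable at 0, with derivative 0. *)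
Lemma flat_le n t : flat n t <= n.+2%:R ^+ n.+2 * t ^+ 2.
Proof.
rewrite /flat; case: ltP => t0; last by apply: mulr_ge0; [exact: exprn_ge0|exact: sqr_ge0].
have t20 : 0 < t ^+ 2 by rewrite exprn_gt0.
rewrite -ler_pdivrMr// mulrAC.
have -> : t^-1 ^+ n / t ^+ 2 = t^-1 ^+ n.+2 by rewrite -exprVn -exprD addn2.
rewrite expRN ler_pdivrMr ?expR_gt0//.
by apply: expn_le_expR; rewrite invr_ge0 ltW.
Qed.

Lemma is_derive_flat n (t : R) :
  is_derive t 1 (flat n) (flat n.+2 t - n%:R * flat n.+1 t).
Proof.
have [t0|t0|->] := ltgtP t 0.
- rewrite /flat !ltNge (ltW t0) /= mulr0 subrr.
  apply: (@near_eq_is_derive _ _ _ (cst 0)).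
  near=> s; rewrite /flat ltNge; suff -> : s <= 0 by [].
  by apply: ltW; near: s; exact: lt_nbhsl.
- have tn0 : t != 0 by rewrite gt_eqF.
  apply: (@near_eq_is_derive _ _ _ (fun s : R => s^-1 ^+ n * expR (- s^-1))).
    near=> s; rewrite /flat; suff -> : 0 < s by [].
    by near: s; exact: lt_nbhsr.
  have hV : is_derive t 1 (fun s : R => s^-1) (- t ^- 2).
    have := @is_deriveV R id t 1 1 tn0 (is_derive_id t 1) => h.
    by apply: (is_derive_eq h); rewrite /GRing.scale /= mulr1.
  have hE : is_derive t 1 (fun s : R => expR (- s^-1)) (expR (- t^-1) * t ^- 2).
    have hN : is_derive t 1 (fun s : R => - s^-1) (t ^- 2).
      by apply: is_derive_eq; rewrite opprK.
    exact: (@is_derive1_comp R expR _ t _ _ (is_derive_expR _) hN).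
  have hX k : is_derive t 1 (fun s : R => s^-1 ^+ k) (- (k%:R * t^-1 ^+ k.+1)).
    elim: k => [|k IH].
      by rewrite mul0r oppr0; exact: (is_derive_cst (1 : R)).
    rewrite (_ : (fun s : R => _) = (fun s => s^-1) * (fun s => s^-1 ^+ k)); last first.
      by apply/funext => s; rewrite exprS.
    apply: (is_derive_eq (is_deriveM hV IH)); rewrite /GRing.scale /=.
    by rewrite -exprVn -natr1 !exprS expr0; ring.
  rewrite /flat t0; apply: (is_derive_eq (is_deriveM (hX n) hE)); rewrite /GRing.scale /=.
  by rewrite -exprVn !exprS expr0; ring.
- have fl0 k : flat k 0 = 0 by rewrite /flat ltxx.
  rewrite !fl0 mulr0 subrr.
  have cv : (fun h : R => h^-1 *: ((flat n \o shift 0) (h *: 1) - flat n 0)) @ 0^' --> (0 : R).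
    pose C : R := n.+2%:R ^+ n.+2; have C0 : 0 < C by rewrite exprn_gt0.
    apply/cvgr0Pnorm_lt => e e0; near=> h.
    rewrite fl0 subr0 /= addr0 [h *: 1]mulr1 /GRing.scale /= normrM normfV.
    have h0 : 0 < `|h| by rewrite normr_gt0; near: h; exact: nbhs_dnbhs_neq.
    rewrite mulrC ltr_pdivrMr// (ger0_norm (flat_ge0 _ _)).
    apply: (le_lt_trans (flat_le n h)); rewrite -/C -(real_normK (num_real h)) expr2 mulrA.
    rewrite ltr_pM2r// mulrC -ltr_pdivlMr//; near: h.
    have : \forall h \near (0 : R), `|h| < e / C.
      by apply: nbhs0_lt; rewrite divr_gt0.
    exact: nbhs_dnbhs.
  by apply: DeriveDef; [apply/cvg_ex; exists 0|apply: cvg_lim].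
Unshelve. all: by end_near. Qed.

End flat_function.

Section directional.
Context {R : realType} {d : nat}.
Local Notation Rd := 'rV[R]_d.

Lemma is_derive_line (f : Rd -> R) (x v : Rd) (df : R) :
  is_derive (0 : R) 1 (fun h : R => f (h *: v + x)) df -> is_derive x v f df.
Proof.
move=> [h1 h2]; apply: DeriveDef; first exact/derivable1P.
have E : (fun h : R => h^-1 *: ((f \o shift x) (h *: v) - f x)) =
  (fun h : R => h^-1 *: (((fun h => f (h *: v + x)) \o shift 0) (h *: 1) - f (0 *: v + x))).
  by apply/funext => h /=; rewrite scale0r add0r addr0 [h *: 1]mulr1.
by rewrite -h2 /derive E.
Qed.

(** L is affine along v, so the one-variable chain rule on the line through x suffices. *)
Lemma is_derive_along (L : Rd -> R) (g : R -> R) (x v : Rd) (c dg : R) :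
  (forall h : R, L (h *: v + x) = c * h + L x) ->
  is_derive (L x) 1 g dg -> is_derive x v (fun y => g (L y)) (dg * c).
Proof.
move=> hL hg; apply: is_derive_line.
rewrite (_ : (fun h => _) = g \o (fun h => c * h + L x)); last first.
  by apply/funext => h /=; rewrite hL.
apply: is_derive1_comp; first by rewrite mulr0 add0r.
by apply: is_derive_eq; rewrite /GRing.scale /= mulr1 addr0.
Qed.

(* Functions generated by [B]; they are smooth as soon as the partial derivatives
   of the generators are again generated by [B]. *)
Inductive smooth_alg (B : set (Rd -> R)) : (Rd -> R) -> Prop :=
| alg_base f : B f -> smooth_alg B f
| alg_cst c : smooth_alg B (fun=> c)
| alg_add f g : smooth_alg B f -> smooth_alg B g -> smooth_alg B (fun x => f x + g x)
| alg_mul f g : smooth_alg B f -> smooth_alg B g -> smooth_alg B (fun x => f x * g x).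

Lemma smooth_alg_smooth (B : set (Rd -> R)) :
  (forall f, B f -> [/\ continuous f,
     forall i x, derivable f x (delta_mx ord0 i) &
     forall i, smooth_alg B (partial i f)]) ->
  forall f, smooth_alg B f -> smooth f.
Proof.
move=> hB.
have key f : smooth_alg B f -> [/\ continuous f,
     forall i x, derivable f x (delta_mx ord0 i) &
     forall i, smooth_alg B (partial i f)].
  elim=> {f} [f /hB //|c|f g Af [cf df pf] Ag [cg dg pg]|f g Af [cf df pf] Ag [cg dg pg]].
  - split => [|i x|i]; [exact: cst_continuous|exact: derivable_cst|].
    rewrite (_ : partial i _ = fun=> 0); first exact: alg_cst.
    by apply/funext => x; exact: derive_cst.
  - split => [x|i x|i]; [by apply: continuousD; [exact: cf|exact: cg]|exact: derivableD|].
    rewrite (_ : partial i _ = fun x => partial i f x + partial i g x); first exact: alg_add.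
    by apply/funext => x; rewrite /partial (deriveD (df i x) (dg i x)).
  - split => [x|i x|i]; [by apply: continuousM; [exact: cf|exact: cg]|exact: derivableM|].
    rewrite (_ : partial i _ = fun x => f x * partial i g x + g x * partial i f x).
      by apply: alg_add; apply: alg_mul.
    by apply/funext => x; rewrite /partial (deriveM (df i x) (dg i x)).
move=> f Af s.
suff : smooth_alg B (partials s f) by case/key.
by elim: s => //= i s /key[].
Qed.

Lemma partials_rcons s i (f : Rd -> R) : partials s (partial i f) = partials (rcons s i) f.
Proof. by rewrite /partials foldr_rcons. Qed.

Lemma smooth_partial i (f : Rd -> R) : smooth f -> smooth (partial i f).
Proof. by move=> sf s; rewrite partials_rcons; exact: sf. Qed.

Lemma smooth_alg_smoothE (f : Rd -> R) : smooth_alg (@smooth R d) f -> smooth f.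
Proof.
apply: smooth_alg_smooth => {}f sf; split; first exact: (sf [::]).1.
  exact: (sf [::]).2.
by move=> i; apply: alg_base; exact: smooth_partial.
Qed.

Lemma smooth_cst (c : R) : smooth (fun _ : Rd => c).
Proof. by apply: smooth_alg_smoothE; exact: alg_cst. Qed.

Lemma smoothD (f g : Rd -> R) : smooth f -> smooth g -> smooth (fun x => f x + g x).
Proof. by move=> sf sg; apply: smooth_alg_smoothE; apply: alg_add; exact: alg_base. Qed.

Lemma smoothM (f g : Rd -> R) : smooth f -> smooth g -> smooth (fun x => f x * g x).
Proof. by move=> sf sg; apply: smooth_alg_smoothE; apply: alg_mul; exact: alg_base. Qed.

Lemma smooth_sum I (s : seq I) (F : I -> Rd -> R) : (forall i, smooth (F i)) ->
  smooth (fun x => \sum_(i <- s) F i x).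
Proof.
move=> sF; elim: s => [|i s IH].
  by rewrite (_ : (fun x => _) = fun=> 0); [exact: smooth_cst|apply/funext => x; rewrite big_nil].
rewrite (_ : (fun x => _) = fun x => F i x + \sum_(j <- s) F j x); first exact: (smoothD (sF i) IH).
by apply/funext => x; rewrite big_cons.
Qed.

Lemma smooth_prod I (s : seq I) (F : I -> Rd -> R) : (forall i, smooth (F i)) ->
  smooth (fun x => \prod_(i <- s) F i x).
Proof.
move=> sF; elim: s => [|i s IH].
  by rewrite (_ : (fun x => _) = fun=> 1); [exact: smooth_cst|apply/funext => x; rewrite big_nil].
rewrite (_ : (fun x => _) = fun x => F i x * \prod_(j <- s) F j x); first exact: (smoothM (sF i) IH).
by apply/funext => x; rewrite big_cons.
Qed.

Lemma coord_line (j i : 'I_d) (s a : R) (x : Rd) h :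
  s * (h *: delta_mx ord0 i + x) ord0 j + a = (s * (j == i)%:R) * h + (s * x ord0 j + a).
Proof. by rewrite !mxE eqxx /=; ring. Qed.

(** By [is_derive_flat], the functions [flat n] of one fixed affine form in a coordinate generate
    their own partial derivatives. *)
Lemma smooth_flat (j : 'I_d) (s a : R) n : smooth (fun x : Rd => flat n (s * x ord0 j + a)).
Proof.
pose B := [set f | exists n, f = fun x : Rd => flat n (s * x ord0 j + a)].
have dB n' i x : is_derive x (delta_mx ord0 i) (fun x : Rd => flat n' (s * x ord0 j + a))
   ((flat n'.+2 (s * x ord0 j + a) - n'%:R * flat n'.+1 (s * x ord0 j + a)) * (s * (j == i)%:R)).
  apply: (is_derive_along (L := fun x : Rd => s * x ord0 j + a) (fun h => coord_line _ _ _ _ _ _)).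
  exact: is_derive_flat.
apply: (@smooth_alg_smooth B); last by apply: alg_base; exists n.
move=> _ [n' ->]; split.
- move=> x; apply: (@continuous_comp _ _ _ (fun x : Rd => s * x ord0 j + a) (flat n')).
    apply: continuousD; last exact: cst_continuous.
    apply: continuousM; [exact: cst_continuous|exact: coord_continuous].
  exact: is_derive_continuous (is_derive_flat n' _).
- by move=> i x; exact: (@ex_derive _ _ _ _ _ _ _ (dB n' i x)).
move=> i.
rewrite (_ : partial i _ = fun x => (flat n'.+2 (s * x ord0 j + a) +
   (- n'%:R) * flat n'.+1 (s * x ord0 j + a)) * (s * (j == i)%:R)).
  apply: alg_mul; last exact: alg_cst.
  apply: alg_add; first by apply: alg_base; exists n'.+2.
  by apply: alg_mul; [exact: alg_cst|apply: alg_base; exists n'.+1].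
by apply/funext => x; rewrite /partial (@derive_val _ _ _ _ _ _ _ (dB n' i x)) mulNr.
Qed.

Lemma dotp_line (i : 'I_d) (c : R) (xi x : Rd) h :
  c * dotp (h *: delta_mx ord0 i + x) xi = (c * xi ord0 i) * h + c * dotp x xi.
Proof.
rewrite /dotp; under eq_bigr do rewrite !mxE eqxx /= mulrDl.
rewrite big_split /= mulrDr; congr (_ + _).
rewrite (bigD1 i)//= eqxx big1 ?addr0; first by rewrite mulr1; ring.
by move=> j /negbTE ->; rewrite mulr0 mul0r.
Qed.

Lemma is_derive_cos_dotp (i : 'I_d) (c : R) (xi x : Rd) :
  is_derive x (delta_mx ord0 i) (fun y => cos (c * dotp y xi))
    (- sin (c * dotp x xi) * (c * xi ord0 i)).
Proof.
apply: (is_derive_along (L := fun y => c * dotp y xi) (fun h => dotp_line _ _ _ _ _)).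
Qed.

Lemma is_derive_sin_dotp (i : 'I_d) (c : R) (xi x : Rd) :
  is_derive x (delta_mx ord0 i) (fun y => sin (c * dotp y xi))
    (cos (c * dotp x xi) * (c * xi ord0 i)).
Proof.
apply: (is_derive_along (L := fun y => c * dotp y xi) (fun h => dotp_line _ _ _ _ _)).
Qed.

Lemma continuous_dotp (f g : Rd -> Rd) : continuous f -> continuous g ->
  continuous (fun x => dotp (f x) (g x)).
Proof.
move=> cf cg; apply: (@continuous_big R^o 'I_d +%R 0 xpredT _ Rd (index_enum 'I_d)
  (fun i x => f x ord0 i * g x ord0 i)); first exact: add_continuous.
move=> i _ x; apply: (continuousM (s := fun x => f x ord0 i)).
  by apply: (@continuous_comp _ _ _ f (fun y : Rd => y ord0 i)); [exact: cf|exact: coord_continuous].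
by apply: (@continuous_comp _ _ _ g (fun y : Rd => y ord0 i)); [exact: cg|exact: coord_continuous].
Qed.

Lemma smooth_cos_sin (c : R) (xi : Rd) :
  smooth (fun x => cos (c * dotp x xi)) /\ smooth (fun x => sin (c * dotp x xi)).
Proof.
pose B := [set f : Rd -> R | f = (fun x => cos (c * dotp x xi)) \/ f = (fun x => sin (c * dotp x xi))].
have cd : continuous (fun x => c * dotp x xi).
  move=> x; apply: (continuousM (s := fun=> c) (t := fun x => dotp x xi)); first exact: cst_continuous.
  apply: (continuous_dotp (f := id) (g := fun=> xi)) => y; [exact: cvg_id|exact: cst_continuous].
suff h f : smooth_alg B f -> smooth f.
  by split; apply: h; apply: alg_base; [left|right].
apply: smooth_alg_smooth => {}f [|] ->; split.
- move=> x; apply: (@continuous_comp _ _ _ (fun x => c * dotp x xi) cos); [exact: cd|exact: continuous_cos].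
- by move=> i x; exact: (@ex_derive _ _ _ _ _ _ _ (is_derive_cos_dotp i c xi x)).
- move=> i; rewrite (_ : partial i _ = fun x => sin (c * dotp x xi) * (- (c * xi ord0 i))).
    by apply: alg_mul; [apply: alg_base; right|exact: alg_cst].
  by apply/funext => x; rewrite /partial (@derive_val _ _ _ _ _ _ _ (is_derive_cos_dotp i c xi x)) mulNr mulrN.
- move=> x; apply: (@continuous_comp _ _ _ (fun x => c * dotp x xi) sin); [exact: cd|exact: continuous_sin].
- by move=> i x; exact: (@ex_derive _ _ _ _ _ _ _ (is_derive_sin_dotp i c xi x)).
- move=> i; rewrite (_ : partial i _ = fun x => cos (c * dotp x xi) * (c * xi ord0 i)).
    by apply: alg_mul; [apply: alg_base; left|exact: alg_cst].
  by apply/funext => x; rewrite /partial (@derive_val _ _ _ _ _ _ _ (is_derive_sin_dotp i c xi x)).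
Qed.

End directional.

Lemma smooth_continuous {R : realType} {d : nat} (f : 'rV[R]_d -> R) : smooth f -> continuous f.
Proof. by move=> /(_ [::])[]. Qed.

Lemma smooth_derivable {R : realType} {d : nat} i x (f : 'rV[R]_d -> R) :
  smooth f -> derivable f x (delta_mx ord0 i).
Proof. by move=> /(_ [::])[_]; exact. Qed.

(* Prevents unification from unfolding the quantification over all directions. *)
Opaque smooth.

(** * Cutoff functions *)

Section smooth_cutoff.
Context {R : realType} {d : nat}.
Local Notation Rd := 'rV[R]_d.

(** Positive exactly on the open cube of half-width e around p, with one factor for each face. The
    coefficients 1 and -1 fit the affine form in [smooth_flat]. *)
Definition bump (p : Rd) (e : R) (x : Rd) : R :=
  \prod_i (flat 0 (1 * x ord0 i + (e - p ord0 i)) * flat 0 (-1 * x ord0 i + (e + p ord0 i))).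

Lemma smooth_bump p e : smooth (bump p e).
Proof. by apply: smooth_prod => i; apply: smoothM; exact: smooth_flat. Qed.

Lemma bump_ge0 p e x : 0 <= bump p e x.
Proof. by rewrite prodr_ge0// => i _; rewrite mulr_ge0 ?flat_ge0. Qed.

Lemma flat0_gt0 (t : R) : (0 < flat 0 t) = (0 < t).
Proof. by rewrite /flat; case: (ltP 0 t); rewrite ?ltxx// expr0 mul1r expR_gt0. Qed.

Definition cube (p : Rd) (e : R) : set Rd := [set x | forall i, `|x ord0 i - p ord0 i| <= e].

Lemma bump_gt0 (p x : Rd) (e : R) : (forall i, `|x ord0 i - p ord0 i| < e) -> 0 < bump p e x.
Proof.
move=> h; rewrite prodr_gt0// => i _; have := h i; rewrite ltr_norml => /andP[h1 h2].
by rewrite mulr_gt0// flat0_gt0 ?mul1r ?mulN1r; lra.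
Qed.

Lemma bump_neq0 p e x : bump p e x != 0 -> cube p e x.
Proof.
move=> /prodf_neq0 h i; have := h i isT; rewrite mulf_eq0 negb_or => /andP[h1 h2].
have fl t : flat 0 t != 0 -> 0 < t :> R.
  by move=> ft; rewrite -flat0_gt0 lt_neqAle flat_ge0 eq_sym ft.
by move: (fl _ h1) (fl _ h2); rewrite ler_norml mul1r mulN1r => ? ?; apply/andP; split; lra.
Qed.

Lemma compact_cube p e : compact (cube p e).
Proof.
have -> : cube p e = [set v : Rd | forall i, `[p ord0 i - e, p ord0 i + e]%classic (v ord0 i)].
  apply/seteqP; split => x /= h i; have := h i; rewrite /= in_itv /= ?ler_distl//.
by apply: (@rV_compact _ _ (fun i => `[p ord0 i - e, p ord0 i + e]%classic)) => i; exact: segment_compact.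
Qed.

Lemma open_cube_nbhs (Omega : set Rd) x : open Omega -> Omega x ->
  exists2 e : R, 0 < e & cube x e `<=` Omega.
Proof.
move=> oO Ox; have /nbhs_ballP[e /= e0 xeO] : nbhs x Omega by exact: open_nbhs_nbhs.
exists (e / 2); first by rewrite divr_gt0.
move=> y yx; apply: xeO; split=> // i j; rewrite !ord1 /ball /= distrC.
by rewrite (le_lt_trans (yx j))// ltr_pdivrMr// ltr_pMr// ltr1n.
Qed.

Lemma nbhs_lt_cube (x : Rd) (e : R) : 0 < e ->
  nbhs x [set y : Rd | forall i, `|y ord0 i - x ord0 i| < e].
Proof.
move=> e0; apply/nbhs_ballP; exists e => // y [_ xy] i.
by have := xy ord0 i; rewrite /ball /= distrC.
Qed.

(* A lower bound on K suffices below, where the cutoff is divided by itself. *)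
Lemma smooth_cutoff (Omega K : set Rd) : open Omega -> compact_in K Omega ->
  exists chi : Rd -> R, [/\ smooth chi, forall x, 0 <= chi x,
    compact_in (closure [set x | chi x != 0]) Omega &
    exists2 c : R, 0 < c & forall x, K x -> c <= chi x].
Proof.
move=> oO [cK KO].
have /choice[e eP] : forall x, exists e : R, Omega x -> 0 < e /\ cube x e `<=` Omega.
  move=> x; have [Ox|nOx] := pselect (Omega x); last by exists 0.
  by have [e e0 eO] := open_cube_nbhs oO Ox; exists e.
pose f (x : Rd) := interior [set y : Rd | forall i, `|y ord0 i - x ord0 i| < e x].
move: (cK); rewrite compact_cover => /(_ _ Omega f) [].
- by move=> i _; exact: open_interior.
- by move=> x Kx; exists x; [exact: KO|apply: nbhs_lt_cube; exact: (eP x (KO _ Kx)).1].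
move=> D DO KD.
have DOm (x : Rd) : x \in D -> Omega x by move=> xD; exact: set_mem (DO x xD).
pose chi x := \sum_(p <- enum_fset D) bump p (e p) x.
have schi : smooth chi by apply: smooth_sum => p; exact: smooth_bump.
have chi0 x : 0 <= chi x by apply: sumr_ge0 => p _; exact: bump_ge0.
(* This finite union of closed cubes in Omega is compact, hence closed, and so contains the closure
   of the set where chi is not 0. *)
pose U := \big[setU/set0]_(p <- enum_fset D | p \in D) cube p (e p).
have cU : compact U by apply: bigsetU_compact => p _; exact: compact_cube.
have UO : U `<=` Omega.
  rewrite /U; elim/big_ind : _ => //; first by move=> A B AO BO x [/AO|/BO].
  by move=> p pD; exact: (eP p (DOm _ pD)).2.
have sU : [set x | chi x != 0] `<=` U.
  move=> x /= h; apply: contrapT => nU; move/eqP: h; apply.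
  rewrite /chi big_seq big1// => p pD; apply: contrapT => /eqP b0; apply: nU.
  rewrite /U (big_rem p)//= pD; left; exact: bump_neq0.
have clU : closure [set x | chi x != 0] `<=` U.
  have /closure_id -> : closed U by apply: compact_closed => //; exact: norm_hausdorff.
  exact: closureS.
exists chi; split => //.
  split; last exact: subset_trans clU UO.
  by apply: subclosed_compact cU clU; exact: closed_closure.
have chiK x : K x -> 0 < chi x.
  move=> /KD[p /= pD] /interior_subset /= xp.
  by rewrite /chi (big_rem p)//= ltr_pwDl ?bump_gt0// sumr_ge0// => ? _; exact: bump_ge0.
(* The lower bound of chi on K comes from the boundedness of 1 / chi on this compact set. *)
have cinv : {within K, continuous (fun x => (chi x)^-1)}.
  apply/subspace_continuousP => x Kx.
  apply: cvgV; first by rewrite gt_eqF// chiK.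
  apply: cvg_within_filter; exact: (smooth_continuous schi).
have [M [_ hM]] := compact_bounded (continuous_compact cinv cK).
have M1 : M < `|M| + 1 by rewrite (le_lt_trans (ler_norm M))// ltrDl.
have M0 : 0 < `|M| + 1 by rewrite ltr_wpDl.
exists (`|M| + 1)^-1; first by rewrite invr_gt0.
move=> x Kx; have /= := hM _ M1 (chi x)^-1; rewrite ger0_norm ?invr_ge0// => h.
rewrite -[leRHS]invrK lef_pV2 ?posrE ?invr_gt0 ?chiK//; apply: h.
by exists x.
Qed.

End smooth_cutoff.

(** * The Leibniz rule for an amplitude times the exponential *)

Section complex_smooth.
Context {R : realType} {d : nat}.
Local Notation Rd := 'rV[R]_d.
Local Notation C := R[i].

Definition csmooth (f : Rd -> C) := smooth (fun x => Re (f x)) /\ smooth (fun x => Im (f x)).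

Definition cpartial (i : 'I_d) (f : Rd -> C) (x : Rd) : C :=
  partial i (fun y => Re (f y)) x +i* partial i (fun y => Im (f y)) x.

Lemma cpartials_cons i s (f : Rd -> C) : cpartials (i :: s) f = cpartial i (cpartials s f).
Proof. by []. Qed.

Lemma cpartials_nil (f : Rd -> C) : cpartials [::] f = f.
Proof. by apply/funext => x; rewrite /cpartials /=; case: (f x). Qed.

Lemma csmooth_cpartial i f : csmooth f -> csmooth (cpartial i f).
Proof. by move=> [sr si]; split; exact: smooth_partial. Qed.

Lemma csmooth_cpartials s f : csmooth f -> csmooth (cpartials s f).
Proof.
move=> sf; elim: s => [|i s IH]; first by rewrite cpartials_nil.
by rewrite cpartials_cons; exact: (csmooth_cpartial i IH).
Qed.

Lemma csmoothD f g : csmooth f -> csmooth g -> csmooth (fun x => f x + g x).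
Proof.
move=> [fr fi] [gr gi]; split; under eq_fun do rewrite ?ReD ?ImD; exact: smoothD.
Qed.

Lemma csmooth_cst (c : C) : csmooth (fun=> c).
Proof. by split; exact: smooth_cst. Qed.

Lemma csmoothM f g : csmooth f -> csmooth g -> csmooth (fun x => f x * g x).
Proof.
move=> [fr fi] [gr gi]; split; under eq_fun do rewrite ?ReM ?ImM.
  rewrite (_ : (fun x => _) = fun x => Re (f x) * Re (g x) + -1 * (Im (f x) * Im (g x))).
    by apply: smoothD; [exact: smoothM|apply: smoothM; [exact: smooth_cst|exact: smoothM]].
  by apply/funext => x; rewrite mulN1r.
by apply: smoothD; exact: smoothM.
Qed.

Lemma csmooth_sum I (s : seq I) (F : I -> Rd -> C) : (forall i, csmooth (F i)) ->
  csmooth (fun x => \sum_(i <- s) F i x).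
Proof.
move=> sF; elim: s => [|i s IH].
  by rewrite (_ : (fun x => _) = fun=> 0); [exact: csmooth_cst|apply/funext => x; rewrite big_nil].
rewrite (_ : (fun x => _) = fun x => F i x + \sum_(j <- s) F j x); first exact: (csmoothD (sF i) IH).
by apply/funext => x; rewrite big_cons.
Qed.

Lemma partialD i x (f g : Rd -> R) : smooth f -> smooth g ->
  partial i (fun y => f y + g y) x = partial i f x + partial i g x.
Proof. by move=> sf sg; rewrite /partial deriveD//; exact: smooth_derivable. Qed.

Lemma partialM i x (f g : Rd -> R) : smooth f -> smooth g ->
  partial i (fun y => f y * g y) x = f x * partial i g x + g x * partial i f x.
Proof. by move=> sf sg; rewrite /partial deriveM//; exact: smooth_derivable. Qed.

Lemma partial_cst i x (c : R) : partial i (fun _ : Rd => c) x = 0.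
Proof. exact: derive_cst. Qed.

Lemma cpartialD i f g x : csmooth f -> csmooth g ->
  cpartial i (fun y => f y + g y) x = cpartial i f x + cpartial i g x.
Proof.
move=> [fr fi] [gr gi]; apply: complexP; rewrite ?ReD ?ImD /=.
  by under eq_fun do rewrite ReD; exact: partialD.
by under eq_fun do rewrite ImD; exact: partialD.
Qed.

Lemma cpartialM i f g x : csmooth f -> csmooth g ->
  cpartial i (fun y => f y * g y) x = f x * cpartial i g x + cpartial i f x * g x.
Proof.
move=> [fr fi] [gr gi]; apply: complexP; rewrite ?ReD ?ImD ?ReM ?ImM /=.
  under eq_fun do rewrite ReM -mulN1r.
  have sii := smoothM fi gi; have s1 := smooth_cst (d := d) (-1 : R).
  rewrite (partialD i x (smoothM fr gr) (smoothM s1 sii)) (partialM i x s1 sii).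
  rewrite (partialM i x fr gr) (partialM i x fi gi) partial_cst; ring.
under eq_fun do rewrite ImM.
rewrite (partialD i x (smoothM fr gi) (smoothM fi gr)) (partialM i x fr gi) (partialM i x fi gr); ring.
Qed.

Lemma cpartial_cst i (c : C) x : cpartial i (fun=> c) x = 0.
Proof. by apply: complexP; rewrite /= partial_cst. Qed.

Lemma cpartial_sum i I (s : seq I) (F : I -> Rd -> C) x : (forall j, csmooth (F j)) ->
  cpartial i (fun y => \sum_(j <- s) F j y) x = \sum_(j <- s) cpartial i (F j) x.
Proof.
move=> sF; elim: s => [|j s IH].
  rewrite big_nil (_ : (fun x => _) = fun=> 0); first exact: cpartial_cst.
  by apply/funext => y; rewrite big_nil.
rewrite big_cons -IH -cpartialD//; last exact: csmooth_sum.
by congr (cpartial i _ x); apply/funext => y; rewrite big_cons.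
Qed.

Lemma csmooth_kernel (xi : Rd) : csmooth (fourier_kernel xi).
Proof.
have [sc ss] := smooth_cos_sin (2 * pi) xi; split; first exact: sc.
rewrite (_ : (fun x => _) = fun x => -1 * sin (2 * pi * dotp x xi)); last first.
  by apply/funext => x; rewrite mulN1r.
exact: (smoothM (smooth_cst (-1)) ss).
Qed.

Definition kernel_dir (xi : Rd) (i : 'I_d) : C := 0 +i* (- (2 * pi * xi ord0 i)).

Lemma cpartial_kernel i (xi x : Rd) :
  cpartial i (fourier_kernel xi) x = kernel_dir xi i * fourier_kernel xi x.
Proof.
have hc := is_derive_cos_dotp i (2 * pi) xi x; have hs := is_derive_sin_dotp i (2 * pi) xi x.
apply: complexP; rewrite ?ReM ?ImM /= /partial.
  by rewrite (@derive_val _ _ _ _ _ _ _ hc); ring.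
rewrite (_ : (fun y => _) = - (fun y => sin (2 * pi * dotp y xi)))//.
rewrite deriveN; last exact: (@ex_derive _ _ _ _ _ _ _ hs).
by rewrite (@derive_val _ _ _ _ _ _ _ hs); ring.
Qed.

(* The pairs of complementary sublists of [s]: the directions in which the
   exponential, resp. the amplitude, is differentiated in the Leibniz rule. *)
Fixpoint splits (s : seq 'I_d) : seq (seq 'I_d * seq 'I_d) :=
  if s is i :: s' then [seq (i :: p.1, p.2) | p <- splits s'] ++
                       [seq (p.1, i :: p.2) | p <- splits s']
  else [:: ([::], [::])].

Definition kernel_dirs (xi : Rd) (a : seq 'I_d) : C := \prod_(i <- a) kernel_dir xi i.

(** There is one term for each way to decide which factor every single derivative hits; repeated
    terms take the place of binomial coefficients. *)
Lemma cpartials_kernel s (phi : Rd -> C) (xi x : Rd) : csmooth phi ->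
  cpartials s (fun y => phi y * fourier_kernel xi y) x =
  \sum_(p <- splits s) kernel_dirs xi p.1 * (cpartials p.2 phi x * fourier_kernel xi x).
Proof.
move=> sphi; elim: s x => [|i s IH] x.
  by rewrite cpartials_nil big_seq1 /kernel_dirs big_nil mul1r cpartials_nil.
have sK := csmooth_kernel xi.
rewrite cpartials_cons (_ : cpartials s _ = fun y =>
  \sum_(p <- splits s) kernel_dirs xi p.1 * (cpartials p.2 phi y * fourier_kernel xi y)); last first.
  by apply/funext => y; exact: IH.
have sp p : csmooth (fun y => cpartials p phi y * fourier_kernel xi y).
  exact: (csmoothM (csmooth_cpartials p sphi) sK).
have sq p : csmooth (fun y => kernel_dirs xi p.1 * (cpartials p.2 phi y * fourier_kernel xi y)).
  exact: (csmoothM (csmooth_cst _) (sp p.2)).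
rewrite (cpartial_sum i _ x sq).
rewrite /= big_cat !big_map /= -big_split /=; apply: eq_bigr => p _.
rewrite (cpartialM i x (csmooth_cst _) (sp p.2)).
rewrite cpartial_cst mul0r addr0 (cpartialM i x (csmooth_cpartials _ sphi) sK).
rewrite cpartial_kernel /kernel_dirs big_cons -cpartials_cons; ring.
Qed.

Lemma splits_size s p : p \in splits s -> (size p.1 <= size s)%N.
Proof.
elim: s p => [|i s IH] p /=; first by rewrite inE => /eqP ->.
rewrite mem_cat => /orP[] /mapP[q /IH qs ->] //=; exact: leq_trans qs (leqnSn _).
Qed.

(** Isolates the only term in which all derivatives fall on the exponential, the one of highest
    order in xi. *)
Lemma splits_head s : exists t, splits s = (s, [::]) :: t /\ all (fun p => (size p.1 < size s)%N) t.
Proof.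
elim: s => [|i s [t [E At]]]; first by exists [::].
rewrite /= E /=; eexists; split; first by [].
rewrite all_cat /= ltnSn /= !all_map; apply/andP; split.
  by apply: sub_all At => p /=; rewrite ltnS.
by apply: sub_all At => p /= h; exact: ltnW.
Qed.

Lemma cpartials_support s (phi : Rd -> C) :
  csupport (cpartials s phi) `<=` csupport phi.
Proof.
suff h : [set x | cpartials s phi x != 0] `<=` csupport phi.
  have /closure_id e : closed (csupport phi) by exact: closed_closure.
  by rewrite [X in _ `<=` X]e; exact: closureS.
have key (f : Rd -> R) (x : Rd) : (\forall y \near x, f y = 0) -> \forall y \near x, partials s f y = 0.
  (* Differentiation at a point y near x needs the function to vanish near y, hence the passage to
     the interior. *)
  move=> f0; elim: s => //= i s /nbhs_interior.
  apply: filterS => y fy; rewrite /partial.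
  rewrite -(near_eq_derive (f := fun=> 0)); first exact: derive_cst.
  by apply: filterS fy => z ->.
move=> x /= sx B xB; apply: contrapT => /set0P/negP/negPn/eqP B0.
have phi0 : \forall y \near x, phi y = 0.
  apply: filterS xB => y By; apply: contrapT => /eqP py.
  by have : ([set x | phi x != 0] `&` B) y by []; rewrite B0.
move/eqP: sx; apply; apply: complexP.
  by apply: (nbhs_singleton (key _ _ _)); apply: filterS phi0 => y ->.
by apply: (nbhs_singleton (key _ _ _)); apply: filterS phi0 => y ->.
Qed.

Lemma csupportS (f g : Rd -> C) : (forall x, g x = 0 -> f x = 0) -> csupport f `<=` csupport g.
Proof. by move=> gf; apply: closureS => x /=; apply: contra_neq; exact: gf. Qed.

Lemma csupport_compact_in (Omega S : set Rd) (f : Rd -> C) :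
  csupport f `<=` S -> compact_in S Omega -> compact_in (csupport f) Omega.
Proof.
move=> fS [cS SO]; split; last exact: subset_trans fS SO.
by apply: subclosed_compact cS fS; exact: closed_closure.
Qed.

Lemma test_fun_cpartials (Omega : set Rd) s phi :
  test_fun Omega phi -> test_fun Omega (cpartials s phi).
Proof.
move=> [sr si hS]; have [cr ci] := csmooth_cpartials s (conj sr si).
by split=> //; exact: csupport_compact_in (@cpartials_support s phi) hS.
Qed.

Lemma test_fun_kernel (Omega : set Rd) phi xi :
  test_fun Omega phi -> test_fun Omega (fun x => phi x * fourier_kernel xi x).
Proof.
move=> [sr si hS]; have [cr ci] := csmoothM (conj sr si) (csmooth_kernel xi).
split=> //; apply: csupport_compact_in hS.
by apply: csupportS => x ->; rewrite mul0r.
Qed.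

Lemma csmooth_ccontinuous f : csmooth f -> ccontinuous_on setT f.
Proof.
by move=> [/smooth_continuous cr /smooth_continuous ci]; split; apply: continuous_subspaceT.
Qed.

Lemma test_fun_Cc (Omega : set Rd) phi : test_fun Omega phi -> Cc Omega phi.
Proof. by move=> [sr si cS]; split => //; apply: csmooth_ccontinuous. Qed.

End complex_smooth.

(** * Fourier transforms of weakly null sequences *)

Section fourier_L2.
Context {R : realType} {d : nat}.
Local Notation Rd := 'rV[R]_d.
Local Notation C := R[i].
Local Notation leb := (lebesgue_rV d).

Lemma coord_le_norm (x : Rd) i : `|x ord0 i| <= `|x|.
Proof.
have /mapP[j Hj ->] : `|x ord0 i| \in [seq `|x y.1 y.2| | y : 'I_1 * 'I_d].
  by apply/mapP; exists (ord0, i) => //=; rewrite mem_enum.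
by rewrite [leRHS]/Num.norm /= mx_normrE; apply/bigmax_geP; right => /=; exists j.
Qed.

Lemma lebesgue_rV_compact (K : set Rd) : compact K -> (leb K < +oo)%E.
Proof.
move=> cK; have [M [_ hM]] := compact_bounded cK.
have M1 : M < `|M| + 1 by rewrite (le_lt_trans (ler_norm M))// ltrDl.
have bx (i : 'I_d) : - (`|M| + 1) <= `|M| + 1 by rewrite ge0_cp// addr_ge0.
have mB : measurable [set x : Rd | forall i, - (`|M| + 1) <= x ord0 i <= `|M| + 1].
  apply: compact_measurable_rV.
  rewrite (_ : mkset _ = cube 0 (`|M| + 1)); first exact: compact_cube.
  by apply/seteqP; split => x /= h i; have := h i; rewrite mxE subr0 ler_norml.
apply: (@le_lt_trans _ _ (leb [set x : Rd | forall i, - (`|M| + 1) <= x ord0 i <= `|M| + 1])).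
  have := @le_measure _ _ _ leb _ _ (mem_set (compact_measurable_rV cK)) (mem_set mB); apply.
  move=> x /(hM _ M1) xM i; rewrite -ler_norml; apply: le_trans xM.
  exact: coord_le_norm.
by rewrite (lebesgue_rV_box bx) ltry.
Qed.

Definition locfun (K : set Rd) (w : Rd -> C) :=
  [/\ cmeasurable_on setT w, forall x, ~ K x -> w x = 0 &
      leb.-integrable setT (EFin \o (fun x => cabs2 (w x)))].

Lemma measurable_cabs2 d' (T : measurableType d') (D : set T) (w : T -> C) :
  cmeasurable_on D w -> measurable_fun D (fun x => cabs2 (w x)).
Proof. by move=> [mr mi]; apply: measurable_funD; exact: measurable_funX. Qed.

Lemma cmeasurableM d' (T : measurableType d') (D : set T) (v w : T -> C) :
  cmeasurable_on D v -> cmeasurable_on D w -> cmeasurable_on D (fun x => v x * w x).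
Proof.
move=> [vr vi] [wr wi]; split; under eq_fun do rewrite ?ReM ?ImM.
  by apply: measurable_funB; exact: measurable_funM.
by apply: measurable_funD; exact: measurable_funM.
Qed.

Lemma cmeasurable_sum d' (T : measurableType d') (D : set T) I (s : seq I) (v : I -> T -> C) :
  (forall i, cmeasurable_on D (v i)) -> cmeasurable_on D (fun x => \sum_(i <- s) v i x).
Proof.
move=> mv; split; under eq_fun do rewrite ?Re_sum ?Im_sum; apply: measurable_sum => i.
  exact: (mv i).1.
exact: (mv i).2.
Qed.

Lemma cmeasurable_cst d' (T : measurableType d') (D : set T) (c : C) :
  cmeasurable_on D (fun=> c).
Proof. by split; exact: measurable_cst. Qed.

Lemma ccontinuous_measurable (w : Rd -> C) : ccontinuous_on setT w -> cmeasurable_on setT w.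
Proof.
move=> [/(continuous_subspace_setT _).2 cr /(continuous_subspace_setT _).2 ci].
by split; apply: continuous_measurable_rV; [exact: cr|exact: ci].
Qed.

Lemma cmeasurable_restrict (Omega : set Rd) (w : Rd -> C) : measurable Omega ->
  (forall x, ~ Omega x -> w x = 0) -> cmeasurable_on Omega w -> cmeasurable_on setT w.
Proof.
move=> mO w0 [mr mi]; split.
- move/(measurable_restrictT _ mO) : mr; congr measurable_fun; apply/funext => x.
  by rewrite patchE; case: ifPn => //; rewrite notin_setE => /w0 ->.
- move/(measurable_restrictT _ mO) : mi; congr measurable_fun; apply/funext => x.
  by rewrite patchE; case: ifPn => //; rewrite notin_setE => /w0 ->.
Qed.

Section locfun_facts.
Variable K : set Rd.
Hypothesis cK : compact K.

Let mK : measurable K. Proof. exact: compact_measurable_rV. Qed.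

Lemma integrable_indicK : leb.-integrable setT (EFin \o (\1_K : Rd -> R)).
Proof.
apply/integrableP; split; first by apply/measurable_EFinP; exact: measurable_indic.
under eq_integral do rewrite /= ger0_norm//.
by rewrite integral_indic// setIT lebesgue_rV_compact.
Qed.

Lemma locfun_sqr w : locfun K w ->
  leb.-integrable setT (EFin \o (fun x => Re (w x) ^+ 2)) /\
  leb.-integrable setT (EFin \o (fun x => Im (w x) ^+ 2)).
Proof.
move=> [[mr mi] _ i2]; split.
  apply: (integrable_Rle (g := fun x => cabs2 (w x))) => //; first exact: measurable_funX.
  by move=> x _; rewrite ger0_norm ?sqr_ge0// Re2_le_cabs2.
apply: (integrable_Rle (g := fun x => cabs2 (w x))) => //; first exact: measurable_funX.
by move=> x _; rewrite ger0_norm ?sqr_ge0// Im2_le_cabs2.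
Qed.

(** |a| <= 1 + a^2, and the constant 1 is integrable over K. *)
Lemma sqint_suppK_integrable (a : Rd -> R) : measurable_fun setT a ->
  (forall x, ~ K x -> a x = 0) -> leb.-integrable setT (EFin \o (fun x => a x ^+ 2)) ->
  leb.-integrable setT (EFin \o a).
Proof.
move=> ma a0 ia2; apply: (integrable_Rle (g := fun x => \1_K x + a x ^+ 2)) => //.
  move=> x _; have [Kx|nKx] := pselect (K x); last first.
    by rewrite a0// normr0 addr_ge0// sqr_ge0.
  rewrite indicE mem_set//= -(real_normK (num_real (a x))).
  have := sqr_ge0 (`|a x| - 1); rewrite sqrrB !expr2; have := normr_ge0 (a x); lra.
exact: (integrableD measurableT integrable_indicK ia2).
Qed.

(** Cauchy-Schwarz, from the nonnegativity of the integral of (|a| - c)^2 over K with c = X / L.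
    Adding 1 to the measure of K keeps L positive when K is null. *)
Lemma sqr_Rintegral_le (a : Rd -> R) : measurable_fun setT a ->
  (forall x, ~ K x -> a x = 0) -> leb.-integrable setT (EFin \o (fun x => a x ^+ 2)) ->
  (\int[leb]_x `|a x|) ^+ 2 <= (fine (leb K) + 1) * \int[leb]_x (a x ^+ 2).
Proof.
move=> ma a0 ia2; have ia := sqint_suppK_integrable ma a0 ia2.
set L := fine (leb K) + 1; set X := \int[leb]_x `|a x|; set Y := \int[leb]_x (a x ^+ 2).
have L0 : 0 < L by rewrite ltr_wpDl// fine_ge0.
pose c := X / L.
have ine : 0 <= \int[leb]_x (a x ^+ 2 + (- (2 * c) * `|a x| + c ^+ 2 * \1_K x)).
  apply: Rintegral_ge0 => x _; have [Kx|nKx] := pselect (K x); last first.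
    by rewrite a0// normr0 indicE memNset//= !mulr0 !addr0 expr0n.
  rewrite indicE mem_set//= mulr1 -(real_normK (num_real (a x))).
  by have := sqr_ge0 (`|a x| - c); rewrite sqrrB; lra.
have ina : leb.-integrable setT (EFin \o (fun x => `|a x|)) := integrable_norm ia.
have i1 := integrableZl measurableT (- (2 * c)) ina.
have i2 := integrableZl measurableT (c ^+ 2) integrable_indicK.
have i12 : leb.-integrable setT (EFin \o (fun x => - (2 * c) * `|a x| + c ^+ 2 * \1_K x)).
  exact: (integrableD measurableT i1 i2).
move: ine; rewrite RintegralD// RintegralD// RintegralZl// RintegralZl//; last exact: integrable_indicK.
rewrite -/X -/Y.
have -> : \int[leb]_x \1_K x = L - 1.
  by rewrite /Rintegral integral_indic// setIT /L addrK.
rewrite /c => ine; rewrite mulrC -ler_pdivrMr//.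
have e : X ^+ 2 / L = 2 * (X / L) * X - (X / L) ^+ 2 * L.
  by field; rewrite gt_eqF.
have : 0 <= (X / L) ^+ 2 by exact: sqr_ge0.
rewrite e; lra.
Qed.

Lemma locfun_integrable w : locfun K w -> cintegrable leb setT w.
Proof.
move=> lw; have [i1 i2] := locfun_sqr lw; have [[mr mi] w0 _] := lw.
by split; apply: sqint_suppK_integrable => // x /w0 ->.
Qed.

End locfun_facts.

Lemma fourierE (w : Rd -> C) xi : cintegrable leb setT w ->
  fourier w xi = (fcos (fun x => Re (w x)) xi + fsin (fun x => Im (w x)) xi) +i*
                 (fcos (fun x => Im (w x)) xi - fsin (fun x => Re (w x)) xi).
Proof.
move=> [ir ii]; apply: complexP => /=.
  rewrite -RintegralD//; [|exact: integrable_cos_phase|exact: integrable_sin_phase].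
  by apply: eq_Rintegral => x _; rewrite ReM /=; ring.
rewrite -RintegralB//; [|exact: integrable_cos_phase|exact: integrable_sin_phase].
by apply: eq_Rintegral => x _; rewrite ImM /=; ring.
Qed.

Lemma measurable_fourier (w : Rd -> C) : cintegrable leb setT w ->
  cmeasurable_on setT (fourier w).
Proof.
move=> iw; have [ir ii] := iw; split.
  rewrite (_ : (fun x => _) = fun xi => fcos (fun x => Re (w x)) xi + fsin (fun x => Im (w x)) xi).
    by apply: measurable_funD; [exact: measurable_fcos|exact: measurable_fsin].
  by apply/funext => xi; rewrite fourierE.
rewrite (_ : (fun x => _) = fun xi => fcos (fun x => Im (w x)) xi - fsin (fun x => Re (w x)) xi).
  by apply: measurable_funB; [exact: measurable_fcos|exact: measurable_fsin].
by apply/funext => xi; rewrite fourierE.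
Qed.

Lemma cabs2_fourier_le (w : Rd -> C) xi : cintegrable leb setT w ->
  cabs2 (fourier w xi) <=
  2 * ((fcos (fun x => Re (w x)) xi ^+ 2 + fsin (fun x => Re (w x)) xi ^+ 2) +
       (fcos (fun x => Im (w x)) xi ^+ 2 + fsin (fun x => Im (w x)) xi ^+ 2)).
Proof.
move=> iw; rewrite fourierE// /cabs2 /=.
move: (fcos _ _) (fcos _ _) (fsin _ _) (fsin _ _) => a b c e.
have := sqr_ge0 (a + c); have := sqr_ge0 (b - e); rewrite !expr2; lra.
Qed.

(** The factor 2 is that of [cabs2_fourier_le], the price of treating real and imaginary parts
    separately. *)
Definition bessel_cst : R := 2 * (16 * pi) ^+ d.

Lemma bessel_cst_ge0 : 0 <= bessel_cst.
Proof. by rewrite mulr_ge0// exprn_ge0// mulr_ge0// pi_ge0. Qed.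

Lemma fourier_bessel K (w : Rd -> C) : compact K -> locfun K w ->
  (\int[leb]_xi (cabs2 (fourier w xi))%:E <=
   bessel_cst%:E * \int[leb]_x (cabs2 (w x))%:E)%E.
Proof.
move=> cK lw; have iw := locfun_integrable cK lw; have [ir ii] := iw.
have [[mr mi] _ _] := lw.
have mT (a : Rd -> R) (ia : leb.-integrable setT (EFin \o a)) :
   measurable_fun setT (fun xi => fcos a xi ^+ 2 + fsin a xi ^+ 2).
  by apply: measurable_funD; apply: measurable_funX; [exact: measurable_fcos|exact: measurable_fsin].
have T0 (a : Rd -> R) xi : 0 <= fcos a xi ^+ 2 + fsin a xi ^+ 2 by rewrite addr_ge0 ?sqr_ge0.
apply: (@le_trans _ _ (\int[leb]_xi (2%:E *
  ((fcos (fun x => Re (w x)) xi ^+ 2 + fsin (fun x => Re (w x)) xi ^+ 2)%:E +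
       (fcos (fun x => Im (w x)) xi ^+ 2 + fsin (fun x => Im (w x)) xi ^+ 2)%:E)))%E).
  apply: ge0_le_integral => //.
  - by move=> xi _; rewrite lee_fin cabs2_ge0.
  - by apply/measurable_EFinP; apply: measurable_cabs2; exact: measurable_fourier.
  - by apply: measurable_funeM; apply: emeasurable_funD; apply/measurable_EFinP; exact: mT.
  by move=> xi _; rewrite -EFinD -EFinM lee_fin; exact: cabs2_fourier_le.
rewrite ge0_integralZl//; last 2 first.
- by apply: emeasurable_funD; apply/measurable_EFinP; exact: mT.
- by move=> xi _; rewrite adde_ge0// lee_fin.
rewrite ge0_integralD//; last 4 first.
- by move=> xi _; rewrite lee_fin.
- by apply/measurable_EFinP; exact: mT.
- by move=> xi _; rewrite lee_fin.
- by apply/measurable_EFinP; exact: mT.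
have -> : (\int[leb]_x (cabs2 (w x))%:E = \int[leb]_x (Re (w x) ^+ 2)%:E + \int[leb]_x (Im (w x) ^+ 2)%:E)%E.
  rewrite -ge0_integralD//.
  - by move=> x _; rewrite lee_fin sqr_ge0.
  - by apply/measurable_EFinP; exact: measurable_funX.
  - by move=> x _; rewrite lee_fin sqr_ge0.
  - by apply/measurable_EFinP; exact: measurable_funX.
rewrite /bessel_cst EFinM -muleA; apply: lee_wpmul2l => //.
rewrite ge0_muleDr; [|by apply: integral_ge0 => x _; rewrite lee_fin sqr_ge0..].
by apply: leeD; exact: bessel.
Qed.

(** The transform is bounded by the L^1 norm, hence by the L^2 norm on K. Being uniform in xi, the
    bound serves as majorant for dominated convergence on bounded sets of frequencies. *)
Lemma fourier_pointwise K (w : Rd -> C) xi : compact K -> locfun K w ->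
  cabs2 (fourier w xi) <= 4 * (fine (leb K) + 1) * \int[leb]_x (cabs2 (w x)).
Proof.
move=> cK lw; have iw := locfun_integrable cK lw; have [ir ii] := iw.
have [[mr mi] w0 _] := lw; have [r2 i2] := locfun_sqr lw.
have b (a : Rd -> R) (ia : leb.-integrable setT (EFin \o a)) :
   `|fcos a xi| <= \int[leb]_x `|a x| /\ `|fsin a xi| <= \int[leb]_x `|a x|.
  have ic := integrable_cos_phase ia xi; have is_ := integrable_sin_phase ia xi.
  have ina : leb.-integrable setT (EFin \o (fun x => `|a x|)) := integrable_norm ia.
  split; apply: (le_trans (le_normr_Rintegral _ _)) => //; apply: le_Rintegral => //.
  - exact: (integrable_norm ic).
  - by move=> x _; rewrite normrM ler_piMl// ler_norml cos_geN1 cos_le1.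
  - exact: (integrable_norm is_).
  - by move=> x _; rewrite normrM ler_piMl// ler_norml sin_geN1 sin_le1.
have wr0 x : ~ K x -> Re (w x) = 0 by move=> /w0 ->.
have wi0 x : ~ K x -> Im (w x) = 0 by move=> /w0 ->.
have hr := sqr_Rintegral_le cK mr wr0 r2; have hi := sqr_Rintegral_le cK mi wi0 i2.
have -> : \int[leb]_x (cabs2 (w x)) = \int[leb]_x (Re (w x) ^+ 2) + \int[leb]_x (Im (w x) ^+ 2).
  by rewrite -RintegralD.
apply: (le_trans (cabs2_fourier_le xi iw)).
have sq a x : `|a| <= x -> a ^+ 2 <= x ^+ 2 :> R.
  by move=> ax; rewrite -(real_normK (num_real a)) ler_sqr ?nnegrE// (le_trans _ ax).
have [/sq c1 /sq s1] := b _ ir; have [/sq c2 /sq s2] := b _ ii.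
rewrite mulrDr -!mulrA; move: hr hi c1 s1 c2 s2; lra.
Qed.

End fourier_L2.

Section eventually_small.
Context {R : realType}.
Implicit Types s t : nat -> \bar R.

(** Convergence to 0 for nonnegative sequences, in a form that passes to smaller sequences without
    any finiteness condition. *)
Definition ev0 s := forall e : R, 0 < e -> \forall n \near \oo, (s n <= e%:E)%E.

Lemma ev0_cvg s : (forall n, 0 <= s n)%E -> s @ \oo --> 0%E -> ev0 s.
Proof.
move=> s0 /fine_cvgP[fs cs] e e0; move/cvgr0Pnorm_le : cs => /(_ e e0) cs.
near=> n; have fn : s n \is a fin_num by near: n.
rewrite -(fineK fn) lee_fin (le_trans (ler_norm _))//; near: n; exact: cs.
Unshelve. all: by end_near. Qed.

Lemma ev0_le s t : (forall n, s n <= t n)%E -> ev0 t -> ev0 s.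
Proof. by move=> st t0 e /t0; apply: filterS => n; exact: le_trans. Qed.

Lemma ev0D s t : ev0 s -> ev0 t -> ev0 (fun n => s n + t n)%E.
Proof.
move=> s0 t0 e e0; have e20 : 0 < e / 2 by rewrite divr_gt0.
near=> n; rewrite [e]splitr EFinD; apply: leeD; near: n; [exact: s0|exact: t0].
Unshelve. all: by end_near. Qed.

Lemma ev0Z (c : R) s : 0 <= c -> ev0 s -> ev0 (fun n => c%:E * s n)%E.
Proof.
move=> c0 s0 e e0; have c1 : 0 < c + 1 by rewrite ltr_wpDl.
near=> n; apply: (@le_trans _ _ (c%:E * (e / (c + 1))%:E)%E).
  by apply: lee_wpmul2l => //; near: n; apply: s0; rewrite divr_gt0.
rewrite -EFinM lee_fin mulrCA ger_pMr// ler_pdivrMr// mul1r lerDl//.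
Unshelve. all: by end_near. Qed.

Lemma ev0_0 : ev0 (fun=> 0%E).
Proof. by move=> e e0; apply: nearW => n; rewrite lee_fin ltW. Qed.

Lemma ev0_sum I (l : seq I) (s : I -> nat -> \bar R) : (forall i, ev0 (s i)) ->
  ev0 (fun n => \sum_(i <- l) s i n)%E.
Proof.
move=> s0; elim: l => [|i l IH].
  by apply: ev0_le ev0_0 => n; rewrite big_nil.
by apply: ev0_le (ev0D (s0 i) IH) => n; rewrite big_cons.
Qed.

End eventually_small.

Section L2loc_sequences.
Context {R : realType} {d r : nat}.
Local Notation Rd := 'rV[R]_d.
Local Notation C := R[i].
Local Notation leb := (lebesgue_rV d).
Variables (Omega : set Rd) (u : nat -> Rd -> 'cV[C]_r).
Hypothesis oO : open Omega.
Hypothesis hu : weak_cvg0_L2loc Omega u.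

Let mO : measurable Omega. Proof. exact: open_measurable_rV. Qed.

Lemma measurable_vabs2 (D : set Rd) (v : Rd -> 'cV[C]_r) :
  (forall j, cmeasurable_on D (fun x => v x j ord0)) ->
  measurable_fun D (fun x => vabs2 (v x)).
Proof. by move=> mv; apply: measurable_sum => j; apply: measurable_cabs2. Qed.

Lemma cintegral_mkcond (w : Rd -> C) : (forall x, ~ Omega x -> w x = 0) ->
  cintegral leb Omega w = cintegral leb setT w.
Proof.
move=> w0; rewrite /cintegral; congr (_ +i* _); rewrite Rintegral_mkcond; congr Rintegral;
  by apply/funext => x; rewrite patchE; case: ifPn => //; rewrite notin_setE => /w0 ->.
Qed.

Section fixed_compact.
Variable K : set Rd.
Hypothesis hK : compact_in K Omega.

Let cK : compact K. Proof. by case: hK. Qed.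
Let KO : K `<=` Omega. Proof. by case: hK. Qed.
Let mK : measurable K. Proof. exact: compact_measurable_rV. Qed.

Lemma u_integrable n j : leb.-integrable K (EFin \o (fun x => cabs2 (u n x j ord0))).
Proof.
have [mu_ iu] := hu.1 n; have mKu i : cmeasurable_on K (fun x => u n x i ord0).
  by have [mr mi] := mu_ i; split; [exact: measurable_funS mr|exact: measurable_funS mi].
apply: (integrable_Rle (g := fun x => vabs2 (u n x))) => //; first exact: measurable_cabs2.
  move=> x _; rewrite ger0_norm ?cabs2_ge0// /vabs2 (bigD1 j)//= lerDl.
  by rewrite sumr_ge0// => i _; exact: cabs2_ge0.
apply/integrableP; split; first by apply/measurable_EFinP; exact: measurable_vabs2.
under eq_integral => x _.
  rewrite /= ger0_norm; last by rewrite sumr_ge0// => i _; exact: cabs2_ge0.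
  over.
exact: iu.
Qed.

(** The conjugate cancels the one in the pairing of [weak_cvg0_L2loc]. *)
Definition test_col j (g : Rd -> C) (x : Rd) : 'cV[C]_r :=
  \col_i (if i == j then g x else 0)^*.

Lemma test_colE j g n x :
  \sum_i u n x i ord0 * (test_col j g x i ord0)^* = u n x j ord0 * g x.
Proof.
rewrite (bigD1 j)//= !mxE eqxx conjCK big1 ?addr0// => i /negbTE ij.
by rewrite mxE ij !rmorph0 mulr0.
Qed.

Lemma locfun_test_weak j (g : Rd -> C) : locfun K g ->
  ccvg (fun n => cintegral leb setT (fun x => u n x j ord0 * g x)) 0.
Proof.
move=> [mg g0 ig].
have vE x : vabs2 (test_col j g x) = cabs2 (g x).
  rewrite /vabs2 (bigD1 j)//= mxE eqxx cabs2J big1 ?addr0// => i /negbTE ij.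
  by rewrite mxE ij cabs2J cabs20.
have [||cr ci] := hu.2 (test_col j g).
- split.
    move=> i; have [mr mi] := mg; split; under eq_fun do rewrite mxE ?ReJ ?ImJ.
      case: (i == j); last exact: measurable_cst.
      exact: measurable_funS mr.
    case: (i == j); last exact: measurable_cst.
    exact: (measurable_funN (measurable_funS measurableT (@subsetT _ Omega) mi)).
  move=> K' [cK' _]; under eq_integral do rewrite vE.
  move/integrableP : ig => [m]; apply: le_lt_trans.
  apply: (@le_trans _ _ (\int[leb]_(x in K') `|(cabs2 (g x))%:E|)%E).
    apply: ge0_le_integral => //; first exact: compact_measurable_rV.
    - by move=> x _; rewrite lee_fin cabs2_ge0.
    - exact: measurable_funS m.
    - by apply: measurableT_comp => //; exact: measurable_funS m.
    - by move=> x _; rewrite lee_abs.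
  apply: ge0_subset_integral => //; first exact: compact_measurable_rV.
  by apply: measurableT_comp.
- exists K => // x nKx; apply/colP => i; rewrite !mxE g0//.
  by case: ifP; rewrite rmorph0.
have E : (fun n => cintegral leb setT (fun x => u n x j ord0 * g x)) =
   (fun n => cintegral leb Omega (fun x => \sum_i u n x i ord0 * (test_col j g x i ord0)^*)).
  apply/funext => n; rewrite -cintegral_mkcond; last first.
    by move=> x nOx; rewrite g0 ?mulr0// => /KO.
  by congr cintegral; apply/funext => x; rewrite test_colE.
by rewrite E; split.
Qed.

(** The real and imaginary parts of a component are weakly null in the real L^2 space of K, as is
    seen by testing with functions extended by 0; [weak_null_bounded] applies to each. *)
Lemma u_bounded j : exists2 B : R, 0 <= B & forall n,
  \int[leb]_(x in K) cabs2 (u n x j ord0) <= B.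
Proof.
have mKu n : cmeasurable_on K (fun x => u n x j ord0).
  by have [mr mi] := (hu.1 n).1 j; split; [exact: measurable_funS mr|exact: measurable_funS mi].
have sqr_ n : sqint leb K (fun x => Re (u n x j ord0)).
  apply: (sqint_le mK (mKu n).1 _ (u_integrable n j)) => x _; exact: Re2_le_cabs2.
have sqi n : sqint leb K (fun x => Im (u n x j ord0)).
  apply: (sqint_le mK (mKu n).2 _ (u_integrable n j)) => x _; exact: Im2_le_cabs2.
have tst (f : Rd -> R) : sqint leb K f -> locfun K (fun x => ((f \_ K) x)%:C).
  move=> [mf if2]; split.
  - by split => /=; [apply/(measurable_restrictT _ mK)|exact: measurable_cst].
  - by move=> x nKx; rewrite patchE memNset.
  under eq_fun do rewrite cabs2_real.
  rewrite (_ : EFin \o _ = (EFin \o (fun x => f x ^+ 2)) \_ K).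
    exact/(integrable_mkcond _ mK).1.
  by apply/funext => x; rewrite /= !patchE; case: ifP => //; rewrite expr0n.
have wk (f : Rd -> R) : sqint leb K f ->
   (fun n => \int[leb]_(x in K) (Re (u n x j ord0) * f x)) @ \oo --> (0 : R) /\
   (fun n => \int[leb]_(x in K) (Im (u n x j ord0) * f x)) @ \oo --> (0 : R).
  move=> /tst /(locfun_test_weak j)[cr ci]; split.
    rewrite (_ : (fun n => _) = fun n => Re (cintegral leb setT (fun x => u n x j ord0 * ((f \_ K) x)%:C))).
      exact: cr.
    apply/funext => n /=; rewrite [LHS]Rintegral_mkcond.
    apply: eq_Rintegral => x _; rewrite ReM /= mulr0 subr0 !patchE.
    by case: ifP; rewrite ?mulr0.
  rewrite (_ : (fun n => _) = fun n => Im (cintegral leb setT (fun x => u n x j ord0 * ((f \_ K) x)%:C))).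
    exact: ci.
  apply/funext => n /=; rewrite [LHS]Rintegral_mkcond.
  apply: eq_Rintegral => x _; rewrite ImM /= mulr0 add0r !patchE.
  by case: ifP; rewrite ?mulr0.
have [B1 hB1] := weak_null_bounded mK sqr_ (fun f sf => (wk f sf).1).
have [B2 hB2] := weak_null_bounded mK sqi (fun f sf => (wk f sf).2).
have hB n : \int[leb]_(x in K) cabs2 (u n x j ord0) <= B1 + B2.
  rewrite RintegralD//; [exact: lerD|exact: (sqr_ n).2|exact: (sqi n).2].
exists (B1 + B2) => //; apply: le_trans (hB 0%N).
by apply: Rintegral_ge0 => x _; exact: cabs2_ge0.
Qed.

Definition bcoef (M : R) (h : Rd -> C) :=
  [/\ cmeasurable_on setT h, forall x, ~ K x -> h x = 0 & forall x, cabs2 (h x) <= M].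

Lemma locfun_coef M h n j : bcoef M h ->
  locfun K (fun x => h x * u n x j ord0) /\
  \int[leb]_x cabs2 (h x * u n x j ord0) <= M * \int[leb]_(x in K) cabs2 (u n x j ord0).
Proof.
move=> [mh h0 hM].
have m1 : cmeasurable_on setT (fun x => h x * u n x j ord0).
  apply: (cmeasurable_restrict mO); first by move=> x nO; rewrite h0 ?mul0r// => /KO.
  apply: cmeasurableM; last exact: (hu.1 n).1.
  by have [mr mi] := mh; split; [exact: measurable_funS mr|exact: measurable_funS mi].
have iu := u_integrable n j.
have E : (fun x => M * cabs2 (u n x j ord0)) \_ K = (fun x => M * (cabs2 \o (fun x => u n x j ord0)) x) \_ K by [].
have iM : leb.-integrable setT (EFin \o ((fun x => M * cabs2 (u n x j ord0)) \_ K)).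
  rewrite -restrict_EFin; apply/(integrable_mkcond _ mK).1; exact: (integrableZl mK M iu).
have le x : cabs2 (h x * u n x j ord0) <= ((fun x => M * cabs2 (u n x j ord0)) \_ K) x.
  rewrite patchE; case: ifPn => [_|]; first by rewrite cabs2M ler_wpM2r// cabs2_ge0.
  by rewrite notin_setE => /h0 ->; rewrite mul0r cabs20.
have i1 : leb.-integrable setT (EFin \o (fun x => cabs2 (h x * u n x j ord0))).
  apply: (integrable_Rle _ _ _ iM) => //; first exact: measurable_cabs2.
  by move=> x _; rewrite ger0_norm ?cabs2_ge0.
split; first by split=> // x nK; rewrite h0// mul0r.
rewrite -RintegralZl// [leRHS]Rintegral_mkcond; exact: le_Rintegral.
Qed.

Lemma fourier_coef_le M h n j : bcoef M h ->
  (\int[leb]_xi (cabs2 (fourier (fun x => h x * u n x j ord0) xi))%:E <=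
   (bessel_cst (R := R) (d := d) * M * \int[leb]_(x in K) cabs2 (u n x j ord0))%:E)%E.
Proof.
move=> bh; have [lw le] := locfun_coef n j bh.
apply: (le_trans (fourier_bessel cK lw)).
rewrite (Rintegral_EFin measurableT); last by case: lw.
by rewrite -EFinM lee_fin -mulrA ler_wpM2l// bessel_cst_ge0.
Qed.

Lemma fourier_coef_unif0 (h : nat -> Rd -> C) j :
  (forall n, exists M, bcoef M (h n)) ->
  (forall e : R, 0 < e -> \forall n \near \oo, forall x, cabs2 (h n x) <= e) ->
  ev0 (fun n => \int[leb]_xi (cabs2 (fourier (fun x => h n x * u n x j ord0) xi))%:E)%E.
Proof.
move=> bh h0 e e0; have [B B0 hB] := u_bounded j.
pose c : R := bessel_cst (R := R) (d := d) * B + 1.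
have b0 : 0 <= bessel_cst (R := R) (d := d) by exact: bessel_cst_ge0.
have c0 : 0 < c by rewrite ltr_wpDl// mulr_ge0.
have := h0 _ (divr_gt0 e0 c0); apply: filterS => n hn.
have [M [mh hs _]] := bh n.
(* The bound M may depend on n; for large n the uniform bound e / c takes its place. *)
have bn : bcoef (e / c) (h n) by split.
apply: (le_trans (fourier_coef_le n j bn)); rewrite lee_fin.
have ec : 0 <= e / c by rewrite divr_ge0// ltW.
apply: (@le_trans _ _ (bessel_cst (R := R) (d := d) * (e / c) * B)).
  by rewrite ler_wpM2l// mulr_ge0.
rewrite mulrAC mulrA ler_pdivrMr// mulrC ler_wpM2l ?ltW//.
by rewrite /c ltrDl.
Qed.

(** For fixed xi the transform is the pairing of u_n with the exponential times h, a bounded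
    function supported in K. *)
Lemma fourier_coef_pointwise M h j xi : bcoef M h ->
  (fun n => cabs2 (fourier (fun x => h x * u n x j ord0) xi)) @ \oo --> (0 : R).
Proof.
move=> [mh h0 hM].
have K1 x : cabs2 (fourier_kernel xi x) = 1.
  by rewrite /cabs2 /= sqrrN cos2Dsin2.
have lg : locfun K (fun x => fourier_kernel xi x * h x).
  have mg : cmeasurable_on setT (fun x => fourier_kernel xi x * h x).
    apply: cmeasurableM => //; apply: ccontinuous_measurable; apply: csmooth_ccontinuous.
    exact: csmooth_kernel.
  split=> //; first by move=> x nK; rewrite h0// mulr0.
  have iK := integrableZl measurableT M (integrable_indicK cK).
  apply: (integrable_Rle _ _ _ iK) => //; first exact: measurable_cabs2.
  move=> x _; rewrite ger0_norm ?cabs2_ge0// cabs2M K1 mul1r.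
  have [Kx|nK] := pselect (K x); first by rewrite indicE mem_set// mulr1.
  by rewrite h0// cabs20 indicE memNset// mulr0.
have [cr ci] := locfun_test_weak j lg.
have E n : fourier (fun x => h x * u n x j ord0) xi =
    cintegral leb setT (fun x => u n x j ord0 * (fourier_kernel xi x * h x)).
  by congr cintegral; apply/funext => x; rewrite mulrA mulrC.
rewrite (_ : 0 = (0 : R) * 0 + 0 * 0); last by rewrite mulr0 addr0.
rewrite (_ : (fun n => _) = fun n =>
   Re (cintegral leb setT (fun x => u n x j ord0 * (fourier_kernel xi x * h x))) *
   Re (cintegral leb setT (fun x => u n x j ord0 * (fourier_kernel xi x * h x))) +
   Im (cintegral leb setT (fun x => u n x j ord0 * (fourier_kernel xi x * h x))) *
   Im (cintegral leb setT (fun x => u n x j ord0 * (fourier_kernel xi x * h x)))).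
  by apply: cvgD; apply: cvgM; [exact: cr|exact: cr|exact: ci|exact: ci].
by apply/funext => n; rewrite E /cabs2 !expr2.
Qed.

Lemma coord_le_enorm (xi : Rd) i : `|xi ord0 i| <= enorm xi.
Proof.
rewrite -sqrtr_sqr ler_wsqrtr// /dotp (bigD1 i)//= -expr2 lerDl sumr_ge0// => j _.
by rewrite -expr2 sqr_ge0.
Qed.

Lemma enorm_ge0 (xi : Rd) : 0 <= enorm xi.
Proof. exact: sqrtr_ge0. Qed.

Lemma measurable_enorm : measurable_fun setT (@enorm R d).
Proof.
apply: (measurableT_comp (f := @Num.sqrt R)); last exact: measurable_dotp.
by apply: continuous_measurable_fun; exact: sqrt_continuous.
Qed.

(** Decays like |xi|^-2, the square of what a term of order at most m - 1 gains from division by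
    |xi|^m. *)
Definition lowpass (xi : Rd) : R := (1 + enorm xi ^+ 2)^-1.

Lemma lowpass_gt0 xi : 0 < lowpass xi.
Proof. by rewrite invr_gt0 kern_denom_gt0. Qed.

Lemma lowpass_le1 xi : lowpass xi <= 1.
Proof. by rewrite invf_le1 ?kern_denom_gt0// lerDl sqr_ge0. Qed.

Lemma measurable_lowpass : measurable_fun setT lowpass.
Proof.
rewrite (_ : lowpass = fun xi => kern 1 (0 - enorm xi) * 16^-1); last first.
  by apply/funext => xi; rewrite /kern /lowpass sub0r mul1r sqrrN mulr1 mulrAC divff// mul1r.
have mk : measurable_fun setT (fun t : R => kern 1 (0 - t)).
  by apply: continuous_measurable_fun; exact: continuous_kern.
by apply: measurable_funM => //; exact: (measurableT_comp mk measurable_enorm).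
Qed.

(** Outside a large cube of frequencies the weight is small and the L^2 bound suffices; inside,
    dominated convergence applies with the majorant of [fourier_pointwise]. *)
Lemma fourier_coef_lowpass M h j : bcoef M h ->
  ev0 (fun n => \int[leb]_xi
    (cabs2 (fourier (fun x => h x * u n x j ord0) xi) * lowpass xi)%:E)%E.
Proof.
move=> bh e e0; have [B B0 hB] := u_bounded j.
have M0 : 0 <= M by case: bh => _ _ /(_ 0); apply: le_trans; exact: cabs2_ge0.
have b0 : 0 <= bessel_cst (R := R) (d := d) by exact: bessel_cst_ge0.
pose c : R := bessel_cst (R := R) (d := d) * M * B + 1.
have c0 : 0 < c by rewrite ltr_wpDl// mulr_ge0// mulr_ge0.
(* Since rho >= 1, outside the cube |xi|^2 >= |xi| >= rho, so that the weight is at most e / (2 c)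
   there. *)
pose rho : R := 2 * c / e + 1.
have rho1 : 1 <= rho by rewrite lerDr divr_ge0 ?mulr_ge0// ltW.
pose Q := cube (0 : Rd) rho.
have cQ : compact Q by exact: compact_cube.
have mQ : measurable Q by exact: compact_measurable_rV.
pose F n xi := cabs2 (fourier (fun x => h x * u n x j ord0) xi).
have lw n := (locfun_coef n j bh).1.
have mF n : measurable_fun setT (F n).
  by apply: measurable_cabs2; apply: measurable_fourier; exact: (locfun_integrable cK (lw n)).
have F0 n xi : 0 <= F n xi by exact: cabs2_ge0.
have lp xi : lowpass xi <= \1_Q xi + e / (2 * c).
  have p0 : 0 <= e / (2 * c) by rewrite divr_ge0 ?mulr_ge0// ltW.
  have [Qxi|nQ] := pselect (Q xi).
    by rewrite indicE mem_set//= (le_trans (lowpass_le1 xi))// lerDl.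
  rewrite indicE memNset//= add0r.
  have [i ri] : exists i, rho < `|xi ord0 i|.
    move: nQ => /existsNP[i /negP]; rewrite -ltNge mxE subr0 => ?; by exists i.
  have er : rho <= enorm xi by apply: ltW; apply: lt_le_trans ri _; exact: coord_le_enorm.
  rewrite -[leRHS]invrK invf_div /lowpass lef_pV2 ?posrE ?divr_gt0 ?mulr_gt0 ?kern_denom_gt0//.
  have er2 : rho <= enorm xi ^+ 2.
    by apply: (le_trans er); rewrite expr2 ler_peMl ?enorm_ge0// (le_trans rho1).
  have : 2 * c / e <= rho by rewrite /rho lerDl.
  lra.
have cv : (fun n => \int[leb]_xi (F n xi * \1_Q xi)) @ \oo --> \int[leb]_(xi in [set: Rd]) (0 : R).
  pose D := 4 * (fine (leb K) + 1) * (M * B).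
  have iD := integrableZl measurableT D (integrable_indicK cQ).
  have [||||_ //] := @Rdominated_convergence _ _ _ leb setT measurableT
    (fun n xi => F n xi * \1_Q xi) (fun=> 0) _ _ _ _ iD.
  - by move=> n; apply: measurable_funM => //; exact: measurable_indic.
  - exact: measurable_cst.
  - move=> xi _; rewrite -(mul0r (\1_Q xi : R)); apply: cvgM; last exact: cvg_cst.
    exact: fourier_coef_pointwise bh.
  move=> n xi _; rewrite ger0_norm ?mulr_ge0// -EFinM lee_fin ler_wpM2r//.
  apply: (le_trans (fourier_pointwise xi cK (lw n))).
  rewrite ler_wpM2l ?mulr_ge0 ?addr_ge0 ?fine_ge0//.
  by apply: (le_trans (locfun_coef n j bh).2); rewrite ler_wpM2l.
rewrite Rintegral_cst// mul0r in cv.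
have e20 : 0 < e / 2 by rewrite divr_gt0.
move/cvgr0Pnorm_le : cv => /(_ _ e20); apply: filterS => n hn.
have i1 : leb.-integrable setT (EFin \o (fun xi => F n xi * \1_Q xi)).
  have iD := integrableZl measurableT (4 * (fine (leb K) + 1) * (\int[leb]_x cabs2 (h x * u n x j ord0))) (integrable_indicK cQ).
  apply: (integrable_Rle _ _ _ iD) => //.
    by apply: measurable_funM => //; exact: measurable_indic.
  move=> xi _; rewrite ger0_norm ?mulr_ge0//= ler_wpM2r//; exact: fourier_pointwise.
apply: (@le_trans _ _ (\int[leb]_xi ((F n xi * \1_Q xi)%:E + (e / (2 * c))%:E * (F n xi)%:E))%E).
  apply: ge0_le_integral => //.
  - by move=> xi _; rewrite lee_fin mulr_ge0 ?cabs2_ge0// ltW// lowpass_gt0.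
  - by apply/measurable_EFinP; apply: measurable_funM; [exact: (mF n)|exact: measurable_lowpass].
  - apply: emeasurable_funD.
      by apply/measurable_EFinP; apply: measurable_funM => //; exact: measurable_indic.
    by apply: measurable_funeM; exact/measurable_EFinP.
  move=> xi _; rewrite -EFinM -EFinD lee_fin [e / _ * _]mulrC -mulrDr.
  by apply: ler_wpM2l; [exact: F0|exact: lp].
rewrite ge0_integralD//; last 4 first.
- by move=> xi _; rewrite lee_fin mulr_ge0.
- by apply/measurable_EFinP; apply: measurable_funM => //; exact: measurable_indic.
- by move=> xi _; rewrite -EFinM lee_fin; apply: mulr_ge0 (F0 n xi); rewrite divr_ge0 ?mulr_ge0// ltW.
- by apply: measurable_funeM; exact/measurable_EFinP.
rewrite [X in (_ <= X%:E)%E](splitr e) EFinD; apply: leeD.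
  by rewrite (Rintegral_EFin measurableT i1) lee_fin (le_trans (ler_norm _)).
have p0 : 0 <= e / (2 * c) by rewrite divr_ge0 ?mulr_ge0// ltW.
have mFn : measurable_fun setT (EFin \o F n) by apply/measurable_EFinP; exact: (mF n).
rewrite (ge0_integralZl leb measurableT mFn)//; last by move=> xi _; rewrite lee_fin; exact: F0.
apply: (@le_trans _ _ ((e / (2 * c))%:E * c%:E)%E).
  apply: lee_wpmul2l => //; apply: (le_trans (fourier_coef_le n j bh)).
  rewrite lee_fin /c; apply: (@le_trans _ _ (bessel_cst * M * B)).
    by apply: ler_wpM2l => //; exact: mulr_ge0.
  by rewrite lerDl.
by rewrite -EFinM lee_fin le_eqVlt; apply/orP; left; apply/eqP; field; rewrite gt_eqF.
Qed.

End fixed_compact.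
End L2loc_sequences.

(** * The localized equation *)

Section complex_integral.
Context {R : realType} d (T : measurableType d) (nu : {measure set T -> \bar R}) (D : set T).
Hypothesis mD : measurable D.
Local Notation C := R[i].

Lemma cintegral_sum I (s : seq I) (w : I -> T -> C) : (forall i, cintegrable nu D (w i)) ->
  cintegrable nu D (fun x => \sum_(i <- s) w i x) /\
  cintegral nu D (fun x => \sum_(i <- s) w i x) = \sum_(i <- s) cintegral nu D (w i).
Proof.
move=> iw.
have [ir er] := Rintegral_sumr mD s (fun i => (iw i).1).
have [ii ei] := Rintegral_sumr mD s (fun i => (iw i).2).
have Er : (fun x => Re (\sum_(i <- s) w i x)) = fun x => \sum_(i <- s) Re (w i x).
  by apply/funext => x; rewrite Re_sum.
have Ei : (fun x => Im (\sum_(i <- s) w i x)) = fun x => \sum_(i <- s) Im (w i x).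
  by apply/funext => x; rewrite Im_sum.
split; first by split; rewrite ?Er ?Ei.
by apply: complexP; rewrite ?Re_sum ?Im_sum /cintegral /= ?Er ?Ei.
Qed.

Lemma cintegralZ (c : C) (w : T -> C) : cintegrable nu D w ->
  cintegrable nu D (fun x => c * w x) /\
  cintegral nu D (fun x => c * w x) = c * cintegral nu D w.
Proof.
move=> [ir ii].
have Er : (fun x => Re (c * w x)) = fun x => Re c * Re (w x) - Im c * Im (w x).
  by apply/funext => x; rewrite ReM.
have Ei : (fun x => Im (c * w x)) = fun x => Re c * Im (w x) + Im c * Re (w x).
  by apply/funext => x; rewrite ImM.
have i1 a := integrableZl mD a ir; have i2 a := integrableZl mD a ii.
split; first split.
- by rewrite Er; exact: (integrableB mD (i1 (Re c)) (i2 (Im c))).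
- by rewrite Ei; exact: (integrableD mD (i2 (Re c)) (i1 (Im c))).
apply: complexP; rewrite ?ReM ?ImM /cintegral /= ?Er ?Ei.
  by rewrite RintegralB ?RintegralZl//; [exact: (i1 (Re c))|exact: (i2 (Im c))].
by rewrite RintegralD ?RintegralZl//; [exact: (i2 (Re c))|exact: (i1 (Im c))].
Qed.

Lemma cintegralD (v w : T -> C) : cintegrable nu D v -> cintegrable nu D w ->
  cintegral nu D (fun x => v x + w x) = cintegral nu D v + cintegral nu D w.
Proof.
move=> [vr vi] [wr wi]; apply: complexP; rewrite ?ReD ?ImD /cintegral /=.
  by under eq_Rintegral do rewrite ReD; rewrite RintegralD.
by under eq_Rintegral do rewrite ImD; rewrite RintegralD.
Qed.

End complex_integral.

Section coefficients.
Context {R : realType} {d : nat}.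
Local Notation Rd := 'rV[R]_d.
Local Notation C := R[i].
Local Notation leb := (lebesgue_rV d).
Variable Omega : set Rd.
Hypothesis oO : open Omega.

Lemma ccontinuous_onP (a : Rd -> C) : ccontinuous_on Omega a <->
  forall x, Omega x -> {for x, continuous (fun y => Re (a y))} /\
                       {for x, continuous (fun y => Im (a y))}.
Proof.
rewrite /ccontinuous_on !continuous_open_subspace//; split.
  by move=> [cr ci] x Ox; split; [apply: cr|apply: ci]; exact: mem_set.
by move=> h; split=> x /set_mem /h[].
Qed.

Lemma ccontinuous_onM (a b : Rd -> C) : ccontinuous_on Omega a -> ccontinuous_on Omega b ->
  ccontinuous_on Omega (fun x => a x * b x).
Proof.
move=> /ccontinuous_onP ca /ccontinuous_onP cb; apply/ccontinuous_onP => x Ox.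
have [ar ai] := ca x Ox; have [br bi] := cb x Ox; split.
  rewrite (_ : (fun y => _) = (fun y => Re (a y) * Re (b y) - Im (a y) * Im (b y))).
    by apply: (continuousB (f := fun y => Re (a y) * Re (b y)) (g := fun y => Im (a y) * Im (b y)));
      exact: continuousM.
  by apply/funext => y; rewrite ReM.
rewrite (_ : (fun y => _) = (fun y => Re (a y) * Im (b y) + Im (a y) * Re (b y))).
  by apply: (continuousD (f := fun y => Re (a y) * Im (b y)) (g := fun y => Im (a y) * Re (b y)));
    exact: continuousM.
by apply/funext => y; rewrite ImM.
Qed.

Lemma csupport_out (f : Rd -> C) x : ~ csupport f x -> f x = 0.
Proof. by move=> nf; apply: contrapT => /eqP f0; apply: nf; exact: subset_closure. Qed.

(** The values of [a] outside Omega are arbitrary, but h vanishes near such points because its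
    support is closed and contained in Omega. *)
Lemma Cc_mul (h a : Rd -> C) : Cc Omega h -> ccontinuous_on Omega a ->
  Cc Omega (fun x => h x * a x).
Proof.
move=> [ch [cS SO]] ca.
have sub : csupport (fun x => h x * a x) `<=` csupport h.
  by apply: csupportS => x ->; rewrite mul0r.
have chO : ccontinuous_on Omega h.
  apply/ccontinuous_onP => x _; have [cr ci] := ch.
  by split; apply: (continuous_subspace_setT _).2.
split; last exact: csupport_compact_in sub (conj cS SO).
have /ccontinuous_onP cha := ccontinuous_onM chO ca.
have key x : {for x, continuous (fun y => Re (h y * a y))} /\
             {for x, continuous (fun y => Im (h y * a y))}.
  have [/cha//|nO] := pselect (Omega x).
  have ho : open (~` csupport h) by rewrite openC; exact: closed_closure.
  have nx : \forall y \near x, h y = 0.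
    have : nbhs x (~` csupport h) by apply: open_nbhs_nbhs; split=> // /SO.
    by apply: filterS => y; exact: csupport_out.
  have hx : h x = 0 by exact: nbhs_singleton nx.
  have cz (g : Rd -> R) : (\forall y \near x, g y = g x) -> {for x, continuous g}.
    by move=> gx; suff hg : g y @[y --> nbhs x] --> g x; [exact: hg|exact: cvg_near_cst].
  by split; apply: cz; apply: filterS nx => y ->; rewrite hx !mul0r.
by split; apply: continuous_subspaceT => x; [exact: (key x).1|exact: (key x).2].
Qed.

Lemma Cc_bounded (h : Rd -> C) : Cc Omega h ->
  exists2 M : R, 0 <= M & forall x, cabs2 (h x) <= M.
Proof.
move=> [[cr ci] [cS SO]].
have b (g : Rd -> R) : {within setT, continuous g} -> exists M : R,
    forall x, csupport h x -> `|g x| <= M.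
  move=> cg; have cg' : {within csupport h, continuous g}.
    by apply: continuous_subspaceW cg.
  have [M [_ hM]] := compact_bounded (continuous_compact cg' cS).
  by exists (`|M| + 1) => x Sx; apply: (hM (`|M| + 1)); [rewrite (le_lt_trans (ler_norm M))// ltrDl|exists x].
have [M1 h1] := b _ cr; have [M2 h2] := b _ ci.
exists (M1 ^+ 2 + M2 ^+ 2); first by rewrite addr_ge0 ?sqr_ge0.
move=> x; have [Sx|/csupport_out ->] := pselect (csupport h x); last first.
  by rewrite cabs20 addr_ge0 ?sqr_ge0.
have sq a y : `|a| <= y -> a ^+ 2 <= y ^+ 2 :> R.
  by move=> ay; rewrite -(real_normK (num_real a)) ler_sqr ?nnegrE// (le_trans _ ay).
by apply: lerD; apply: sq; [exact: h1|exact: h2].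
Qed.

Lemma Cc_bcoef (K : set Rd) (h : Rd -> C) : Cc Omega h -> csupport h `<=` K ->
  exists M, bcoef K M h.
Proof.
move=> ch hK; have [M _ hM] := Cc_bounded ch; exists M; split=> //.
  by case: ch => /ccontinuous_measurable.
by move=> x nK; apply: csupport_out => /hK.
Qed.

(** The usual three-epsilon argument on a closed cube around x, with p standing for the real or the
    imaginary part. It makes phi times an entry of the limit admissible in [is_Hmeasure]. *)
Lemma cvg_loc_unif_ccontinuous q r (A : nat -> Rd -> 'M[C]_(q, r)) (A0 : Rd -> 'M[C]_(q, r)) :
  (forall n k j, ccontinuous_on Omega (fun x => A n x k j)) -> cvg_loc_unif Omega A A0 ->
  forall k j, ccontinuous_on Omega (fun x => A0 x k j).
Proof.
move=> cA AA k j; apply/ccontinuous_onP => x Ox.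
have [e e0 eO] := open_cube_nbhs oO Ox.
have hc : compact_in (cube x e) Omega by split=> //; exact: compact_cube.
have nc : nbhs x (cube x e).
  by apply: filterS (nbhs_lt_cube x e0) => y h i; apply: ltW; exact: h.
have xc : cube x e x by exact: nbhs_singleton.
have key (p : C -> R) : (forall z w, `|p z - p w| <= cabs (z - w)) ->
    (forall n, {for x, continuous (fun y => p (A n y k j))}) ->
    {for x, continuous (fun y => p (A0 y k j))}.
  move=> pl cp.
  suff h : p (A0 y k j) @[y --> nbhs x] --> p (A0 x k j) by exact: h.
  apply/cvgrPdist_lt => /= e1 e10.
  have e30 : 0 < e1 / 3 by rewrite divr_gt0.
  have [n _ /(_ n (leqnn n)) hn] := AA _ hc _ e30.
  have /cvgrPdist_lt/(_ _ e30) := cp n; apply: filterS2 nc => y cy /= hy.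
  have h1 := le_lt_trans (pl _ _) (hn x xc k j).
  have h2 := le_lt_trans (pl _ _) (hn y cy k j).
  rewrite (_ : _ - _ = - (p (A n x k j) - p (A0 x k j)) +
     (p (A n x k j) - p (A n y k j)) + (p (A n y k j) - p (A0 y k j))); last by ring.
  rewrite (le_lt_trans (ler_normD _ _))//; have := ler_normD (- (p (A n x k j) - p (A0 x k j))) (p (A n x k j) - p (A n y k j)).
  rewrite normrN; lra.
have cn n := (ccontinuous_onP _).1 (cA n k j) x Ox.
split; apply: key => [z w|n].
- by rewrite -ReN -ReD Re_le_cabs.
- exact: (cn n).1.
- by rewrite -ImN -ImD Im_le_cabs.
- exact: (cn n).2.
Qed.

End coefficients.

Section multi_indices.
Context {R : realType} {d m : nat}.
Local Notation Rd := 'rV[R]_d.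
Local Notation C := R[i].
Implicit Types (alpha : @mindex d m) (xi : Rd).

Lemma size_mdirs alpha : size (mdirs alpha) = mlen alpha.
Proof.
rewrite /mdirs size_flatten /shape -map_comp sumnE big_map big_enum /=.
by apply: eq_bigr => i _; rewrite size_nseq.
Qed.

(** The sign cancels against the factor (-1)^|alpha| of [weak_partial], which leaves the (2 pi
    i)^|alpha| of the symbol. *)
Lemma kernel_dirs_mdirs alpha xi :
  kernel_dirs xi (mdirs alpha) = (- (0 +i* (2 * pi))) ^+ mlen alpha * (mpow xi alpha)%:C.
Proof.
rewrite /kernel_dirs /mdirs big_flatten big_map /mpow rmorph_prod -prodrXr -big_split /= big_enum.
apply: eq_bigr => i _; rewrite big_nseq -Monoid.iteropE /= -[iterop _ _ _ _]/(_ ^+ _) rmorphXn -exprMn.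
by congr (_ ^+ _); apply: complexP; rewrite ?ReM ?ImM ?ReN ?ImN /=; ring.
Qed.

Lemma cabs2_kernel_dirs xi a :
  cabs2 (kernel_dirs xi a) <= ((2 * pi * enorm xi) ^+ 2) ^+ size a.
Proof.
rewrite /kernel_dirs cabs2_prod ; elim: a => [|i a IH].
  by rewrite big_nil.
rewrite big_cons [leRHS]exprS; apply: ler_pM => //; first exact: cabs2_ge0.
  by rewrite -cabs2_prod cabs2_ge0.
rewrite /cabs2 /= expr0n add0r sqrrN !exprMn ler_wpM2l ?mulr_ge0 ?sqr_ge0 ?pi_ge0//.
by rewrite -(real_normK (num_real (xi ord0 i))) ler_sqr ?nnegrE ?enorm_ge0 ?coord_le_enorm.
Qed.

Lemma mpowZ (c : R) xi alpha : mpow (c *: xi) alpha = c ^+ mlen alpha * mpow xi alpha.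
Proof.
rewrite /mpow /mlen -prodrXr -big_split /=; apply: eq_bigr => i _.
by rewrite mxE exprMn.
Qed.

Lemma mpow_direction_le1 alpha xi : mpow ((enorm xi)^-1 *: xi) alpha ^+ 2 <= 1.
Proof.
rewrite /mpow -prodrXl; apply: prodr_ile1 => i _; rewrite exprAC exprn_ge0 ?sqr_ge0//=.
rewrite exprn_ile1 ?sqr_ge0// mxE exprMn exprVn.
(* At xi = 0 the inverse of the norm is 0, and so is the direction. *)
have [->|x0] := eqVneq (enorm xi) 0; first by rewrite expr0n invr0 mul0r.
have e0 : 0 < enorm xi by rewrite lt_neqAle eq_sym x0 enorm_ge0.
rewrite ler_pdivrMl ?exprn_gt0// mulr1 -(real_normK (num_real (xi ord0 i))).
by rewrite ler_sqr ?nnegrE ?enorm_ge0 ?coord_le_enorm.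
Qed.

End multi_indices.

Section localization.
Context {R : realType} {d r : nat}.
Local Notation Rd := 'rV[R]_d.
Local Notation C := R[i].
Local Notation leb := (lebesgue_rV d).
Variables (Omega : set Rd) (u : nat -> Rd -> 'cV[C]_r).
Hypothesis oO : open Omega.
Hypothesis hu : weak_cvg0_L2loc Omega u.

Definition fourier_comb (h : 'I_r -> Rd -> C) n (xi : Rd) : C :=
  \sum_j fourier (fun x => h j x * u n x j ord0) xi.

Section fixed_support.
Variable K : set Rd.
Hypothesis hK : compact_in K Omega.

Lemma measurable_fourier_coef M h n j : bcoef K M h ->
  cmeasurable_on setT (fourier (fun x => h x * u n x j ord0)).
Proof.
move=> bh; apply: measurable_fourier.
exact: (locfun_integrable hK.1 (locfun_coef oO hu hK n j bh).1).
Qed.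

Lemma measurable_fourier_comb (h : 'I_r -> Rd -> C) n : (forall j, exists M, bcoef K M (h j)) ->
  cmeasurable_on setT (fourier_comb h n).
Proof.
move=> bh; apply: cmeasurable_sum => j; have [M bj] := bh j.
exact: measurable_fourier_coef bj.
Qed.

Lemma integral_fourier_comb_le (h : 'I_r -> Rd -> C) n (g : Rd -> R) :
  (forall j, exists M, bcoef K M (h j)) ->
  measurable_fun setT g -> (forall x, 0 <= g x) ->
  (\int[leb]_xi (cabs2 (fourier_comb h n xi) * g xi)%:E <=
   (2 ^+ size (index_enum 'I_r))%:E * \sum_j
     \int[leb]_xi (cabs2 (fourier (fun x => (h j) x * u n x j ord0) xi) * g xi)%:E)%E.
Proof.
move=> bh mg g0.
have mj j : measurable_fun setT (fun xi =>
    (cabs2 (fourier (fun x => (h j) x * u n x j ord0) xi) * g xi)%:E).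
  apply/measurable_EFinP; apply: measurable_funM => //; apply: measurable_cabs2.
  by have [M bj] := bh j; exact: measurable_fourier_coef bj.
have p0 : 0 <= 2 ^+ size (index_enum 'I_r) :> R by rewrite exprn_ge0.
have j0 j xi : (0 <= (cabs2 (fourier (fun x => (h j) x * u n x j ord0) xi) * g xi)%:E)%E.
  by rewrite lee_fin mulr_ge0 ?cabs2_ge0.
rewrite -(ge0_integral_sum _ measurableT mj (fun j x _ => j0 j x)) -ge0_integralZl//; last 2 first.
- by apply: emeasurable_sum => j; exact: mj.
- by move=> x _; apply: sume_ge0 => j _; exact: j0.
apply: ge0_le_integral => //.
- by move=> xi _; rewrite lee_fin mulr_ge0 ?cabs2_ge0.
- apply/measurable_EFinP; apply: measurable_funM => //; apply: measurable_cabs2.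
  exact: measurable_fourier_comb.
- by apply: measurable_funeM; apply: emeasurable_sum => j; exact: mj.
move=> xi _; rewrite sumEFin -EFinM lee_fin -mulr_suml mulrA ler_wpM2r//.
exact: cabs2_sum.
Qed.

Lemma fourier_comb_unif0 (h : nat -> 'I_r -> Rd -> C) :
  (forall n j, exists M, bcoef K M (h n j)) ->
  (forall j (e : R), 0 < e -> \forall n \near \oo, forall x, cabs2 (h n j x) <= e) ->
  ev0 (fun n => \int[leb]_xi (cabs2 (fourier_comb (h n) n xi))%:E)%E.
Proof.
move=> bh h0.
pose s j n := (\int[leb]_xi (cabs2 (fourier (fun x => h n j x * u n x j ord0) xi))%:E)%E.
have s0 j : ev0 (s j).
  exact: (@fourier_coef_unif0 _ _ _ _ _ oO hu _ hK (fun n => h n j) j (fun n => bh n j) (h0 j)).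
apply: (ev0_le _ (ev0Z (exprn_ge0 (size (index_enum 'I_r)) (ler0n R 2)) (ev0_sum (index_enum 'I_r) s0))) => n.
have := @integral_fourier_comb_le (h n) n (fun=> 1) (bh n) (@measurable_cst _ _ _ _ _ _) (fun=> ler01).
under eq_integral do rewrite mulr1.
by under eq_bigr do under eq_integral do rewrite mulr1.
Qed.

Lemma fourier_comb_lowpass (h : 'I_r -> Rd -> C) :
  (forall j, exists M, bcoef K M (h j)) ->
  ev0 (fun n => \int[leb]_xi (cabs2 (fourier_comb h n xi) * lowpass xi)%:E)%E.
Proof.
move=> bh.
pose s j n := (\int[leb]_xi (cabs2 (fourier (fun x => h j x * u n x j ord0) xi) * lowpass xi)%:E)%E.
have s0 j : ev0 (s j) by have [M bj] := bh j; exact: (fourier_coef_lowpass oO hu hK j bj).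
apply: (ev0_le _ (ev0Z (exprn_ge0 (size (index_enum 'I_r)) (ler0n R 2)) (ev0_sum (index_enum 'I_r) s0))) => n.
apply: integral_fourier_comb_le => //; first exact: measurable_lowpass.
by move=> x; apply: ltW; exact: lowpass_gt0.
Qed.

(** Joins the r transforms into a single integral, the form in which the equation produces them. *)
Lemma fourier_comb_integrable (h : 'I_r -> Rd -> C) n xi :
  (forall j, exists M, bcoef K M (h j)) ->
  cintegrable leb setT (fun x => fourier_kernel xi x * \sum_j h j x * u n x j ord0) /\
  fourier_comb h n xi =
  cintegral leb setT (fun x => fourier_kernel xi x * \sum_j h j x * u n x j ord0).
Proof.
move=> bh.
have bk j : exists M, bcoef K M (fun x => fourier_kernel xi x * h j x).
  have [M [mh h0 hM]] := bh j; exists M; split.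
  - apply: cmeasurableM => //; apply: ccontinuous_measurable; apply: csmooth_ccontinuous.
    exact: csmooth_kernel.
  - by move=> x nK; rewrite h0// mulr0.
  move=> x; rewrite cabs2M (_ : cabs2 (fourier_kernel xi x) = 1) ?mul1r//.
  by rewrite /cabs2 /= sqrrN cos2Dsin2.
pose w j x := fourier_kernel xi x * h j x * u n x j ord0.
have iw j : cintegrable leb setT (w j).
  have [M bj] := bk j; exact: (locfun_integrable hK.1 (locfun_coef oO hu hK n j bj).1).
have [isum esum] := cintegral_sum measurableT (index_enum 'I_r) iw.
have E : (fun x => fourier_kernel xi x * \sum_j h j x * u n x j ord0) = fun x => \sum_j w j x.
  by apply/funext => x; rewrite mulr_sumr; apply: eq_bigr => j _; rewrite /w mulrA.
rewrite E; split=> //; rewrite esum; apply: eq_bigr => j _; congr cintegral.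
by apply/funext => x; rewrite /w mulrA.
Qed.

End fixed_support.
End localization.

Lemma measurable_invr {R : realType} : measurable_fun setT (fun t : R => t^-1).
Proof.
have o0 : open [set t : R | t != 0].
  rewrite (_ : [set t : R | t != 0] = ~` [set 0]); last first.
    by apply/seteqP; split=> t /= /eqP.
  by rewrite openC; exact: closed_eq.
rewrite -(setUv [set t : R | t != 0]); apply/measurable_funU.
- exact: open_measurable.
- by apply: measurableC; exact: open_measurable.
split.
  apply: open_continuous_measurable_fun => // t /set_mem /= t0; exact: inv_continuous.
apply: (eq_measurable_fun (fun=> 0 : R)); last exact: measurable_cst.
by move=> t /set_mem /= /negP; rewrite negbK => /eqP ->; rewrite invr0.
Qed.

Section pde_symbol.
Context {R : realType} {d r q m l : nat}.
Local Notation Rd := 'rV[R]_d.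
Local Notation C := R[i].
Local Notation leb := (lebesgue_rV d).
Local Notation mi := (@mindex d m).
Variables (Omega : set Rd) (u : nat -> Rd -> 'cV[C]_r) (eps : nat -> R)
  (eps_0 eps_infty : R) (A : nat -> mi -> Rd -> 'M[C]_(q, r)) (Alim : mi -> Rd -> 'M[C]_(q, r))
  (f : nat -> 'I_q -> sdistribution Omega).
Hypothesis oO : open Omega.
Hypothesis lm : (l <= m)%N.
Hypothesis hu : weak_cvg0_L2loc Omega u.
Hypothesis eps_00 : 0 < eps_0.
Hypothesis heps : forall n, eps_0 <= eps n <= eps_infty.
Hypothesis cA : forall n (alpha : mi), (l <= mlen alpha <= m)%N ->
    forall k j, ccontinuous_on Omega (fun x => A n alpha x k j).
Hypothesis hA : forall alpha : mi, (l <= mlen alpha <= m)%N ->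
    cvg_loc_unif Omega (fun n => A n alpha) (Alim alpha).
Hypothesis pde : forall n k phi, test_fun Omega phi ->
    \sum_(alpha : mi | (l <= mlen alpha <= m)%N)
      (eps n ^+ (mlen alpha - l))%:C *
      weak_partial Omega alpha (fun x => (A n alpha x *m u n x) k ord0) phi =
    f n k phi.

Lemma cAlim (alpha : mi) : (l <= mlen alpha <= m)%N ->
  forall k j, ccontinuous_on Omega (fun x => Alim alpha x k j).
Proof. by move=> ha; apply: (cvg_loc_unif_ccontinuous oO (fun n => cA n ha)); exact: hA. Qed.

Variables (phi : Rd -> C) (k : 'I_q).
Hypothesis tphi : test_fun Omega phi.
Let K := csupport phi.
Let hK : compact_in K Omega. Proof. by case: tphi. Qed.

Definition coef (B : Rd -> 'M[C]_(q, r)) (b : seq 'I_d) (j : 'I_r) (x : Rd) : C :=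
  cpartials b phi x * B x k j.

Lemma bcoef_coef (B : Rd -> 'M[C]_(q, r)) b j : ccontinuous_on Omega (fun x => B x k j) ->
  exists M, bcoef K M (coef B b j).
Proof.
move=> cB; apply: (Cc_bcoef (Omega := Omega)).
  by apply: Cc_mul => //; apply: test_fun_Cc; exact: test_fun_cpartials.
apply: subset_trans (@cpartials_support _ _ b phi).
by apply: csupportS => x e; rewrite /coef e mul0r.
Qed.

(* The terms of the Leibniz expansion of partial_alpha applied to
   phi * exp (- 2 pi i x . xi). *)
Definition terms : seq (mi * (seq 'I_d * seq 'I_d)) :=
  [seq (alpha, p) | alpha <- [seq alpha <- index_enum mi | (l <= mlen alpha <= m)%N],
                    p <- splits (mdirs alpha)].

Lemma termsP t : t \in terms -> (l <= mlen t.1 <= m)%N /\ (size t.2.1 <= mlen t.1)%N.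
Proof.
move=> /allpairsPdep[alpha [p [+ ps ->]]]; rewrite mem_filter => /andP[ha _]; split=> //=.
by rewrite -size_mdirs; exact: splits_size.
Qed.

(** At least m derivatives fall on the exponential only if |alpha| = m and all of them do, the first
    split in [splits_head]. *)
Lemma sum_top (V : nmodType) (H : mi * (seq 'I_d * seq 'I_d) -> V) :
  \sum_(t <- terms | ~~ (size t.2.1 < m)%N) H t =
  \sum_(alpha : mi | mlen alpha == m) H (alpha, (mdirs alpha, [::])).
Proof.
rewrite big_mkcond big_allpairs_dep big_filter [RHS]big_mkcond [LHS]big_mkcond /=.
apply: eq_bigr => alpha _; case: ifPn => [/andP[h1 h2]|hn]; last first.
  by case: eqP => // e; move: hn; rewrite e lm leqnn.
have [t [-> /allP ht]] := splits_head (mdirs alpha).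
rewrite big_cons /= size_mdirs big1_seq ?addr0; last first.
  by move=> p /= /ht; rewrite size_mdirs => h; rewrite (leq_trans h h2).
by rewrite -leqNgt eqn_leq h2.
Qed.

Definition term_coef n (xi : Rd) (t : mi * (seq 'I_d * seq 'I_d)) : C :=
  (eps n ^+ (mlen t.1 - l))%:C * ((-1) ^+ mlen t.1 * kernel_dirs xi t.2.1).

Lemma fourier_dist_terms n xi : fourier_dist (f n k) phi xi =
  \sum_(t <- terms) term_coef n xi t * fourier_comb u (coef (A n t.1) t.2.2) n xi.
Proof.
rewrite /fourier_dist -pde; last exact: test_fun_kernel.
rewrite big_allpairs_dep big_filter /=; apply: eq_bigr => alpha ha.
rewrite /weak_partial cintegral_mkcond; last first.
  move=> x nO; rewrite (csupport_out (f := cpartials _ _)) ?mulr0//.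
  move=> /(@cpartials_support _ _ _ _ _) sx; apply: nO.
  by have [_ _ [_]] := test_fun_kernel xi tphi; apply.
pose w p x := kernel_dirs xi p.1 * (fourier_kernel xi x * \sum_j coef (A n alpha) p.2 j x * u n x j ord0).
have bp p j : exists M, bcoef K M (coef (A n alpha) p j) by apply: bcoef_coef; exact: cA.
have iw p : cintegrable leb setT (w p).
  have [i1 _] := fourier_comb_integrable oO hu hK n xi (bp p.2).
  exact: (cintegralZ measurableT (kernel_dirs xi p.1) i1).1.
have E : (fun x => (A n alpha x *m u n x) k ord0 *
    cpartials (mdirs alpha) (fun x => phi x * fourier_kernel xi x) x) =
    fun x => \sum_(p <- splits (mdirs alpha)) w p x.
  apply/funext => x; rewrite cpartials_kernel; last by case: tphi.
  rewrite mulr_sumr; apply: eq_bigr => p _; rewrite /w mxE mulrCA; congr (_ * _).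
  rewrite mulr_sumr mulr_suml; apply: eq_bigr => j _; rewrite /coef; ring.
rewrite E (cintegral_sum measurableT _ iw).2 !mulr_sumr; apply: eq_bigr => p _.
have [i1 ->] := fourier_comb_integrable oO hu hK n xi (bp p.2).
rewrite (cintegralZ measurableT (kernel_dirs xi p.1) i1).2 /term_coef /=; ring.
Qed.

Definition main_part n (t : mi * (seq 'I_d * seq 'I_d)) xi := fourier_comb u (coef (Alim t.1) t.2.2) n xi.

Definition err_part n (t : mi * (seq 'I_d * seq 'I_d)) xi :=
  fourier_comb u (coef (fun x => A n t.1 x - Alim t.1 x) t.2.2) n xi.

Lemma ccontinuous_err n (alpha : mi) : (l <= mlen alpha <= m)%N ->
  forall k j, ccontinuous_on Omega (fun x => (A n alpha x - Alim alpha x) k j).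
Proof.
move=> ha k' j; apply/(ccontinuous_onP oO) => x Ox.
have [ar ai] := (ccontinuous_onP oO _).1 (cA n ha k' j) x Ox.
have [br bi] := (ccontinuous_onP oO _).1 (cAlim ha k' j) x Ox.
split.
  rewrite (_ : (fun y => _) = (fun y => Re (A n alpha y k' j) - Re (Alim alpha y k' j))).
    exact: (continuousB (f := fun y => Re (A n alpha y k' j)) (g := fun y => Re (Alim alpha y k' j))).
  by apply/funext => y; rewrite !mxE ReD ReN.
rewrite (_ : (fun y => _) = (fun y => Im (A n alpha y k' j) - Im (Alim alpha y k' j))).
  exact: (continuousB (f := fun y => Im (A n alpha y k' j)) (g := fun y => Im (Alim alpha y k' j))).
by apply/funext => y; rewrite !mxE ImD ImN.
Qed.

Lemma fourier_comb_split n xi t : t \in terms ->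
  fourier_comb u (coef (A n t.1) t.2.2) n xi = main_part n t xi + err_part n t xi.
Proof.
move=> /termsP[ha _]; rewrite /main_part /err_part.
have b1 j : exists M, bcoef K M (coef (A n t.1) t.2.2 j) by apply: bcoef_coef; exact: cA.
have b2 j : exists M, bcoef K M (coef (Alim t.1) t.2.2 j) by apply: bcoef_coef; exact: cAlim.
have b3 j : exists M, bcoef K M (coef (fun x => A n t.1 x - Alim t.1 x) t.2.2 j).
  by apply: bcoef_coef; exact: ccontinuous_err.
have [_ ->] := fourier_comb_integrable oO hu hK n xi b1.
have [i2 ->] := fourier_comb_integrable oO hu hK n xi b2.
have [i3 ->] := fourier_comb_integrable oO hu hK n xi b3.
rewrite -cintegralD//; congr cintegral; apply/funext => x.
rewrite -mulrDr -big_split /=; congr (_ * _); apply: eq_bigr => j _.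
rewrite /coef !mxE; ring.
Qed.

(* The vanishing of its limit in L^2 is what the equation says about the principal
   symbol. *)
Definition symbol_fourier n (xi : Rd) : C :=
  \sum_(alpha : mi | mlen alpha == m)
    (0 +i* (2 * pi)) ^+ m * (mpow ((enorm xi)^-1 *: xi) alpha)%:C *
    fourier_comb u (coef (Alim alpha) [::]) n xi.

(* All terms on the right of lower order in xi, or with the small factor
   A_n - A: the remaining ones, in which all derivatives fall on the exponential,
   make up the left-hand side. *)
Lemma symbol_fourier_terms n xi : 0 < enorm xi ->
  (eps n ^+ (m - l) * enorm xi ^+ m)%:C * symbol_fourier n xi =
  fourier_dist (f n k) phi xi - \sum_(t <- terms) term_coef n xi t * err_part n t xi
  - \sum_(t <- terms | (size t.2.1 < m)%N) term_coef n xi t * main_part n t xi.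
Proof.
move=> x0.
have -> : fourier_dist (f n k) phi xi =
    \sum_(t <- terms) term_coef n xi t * main_part n t xi +
    \sum_(t <- terms) term_coef n xi t * err_part n t xi.
  rewrite fourier_dist_terms -big_split /= !big_seq; apply: eq_bigr => t tT.
  by rewrite fourier_comb_split// mulrDr.
rewrite addrK (bigID (fun t => size t.2.1 < m)%N) /= [X in _ = X - _]addrC addrK.
rewrite sum_top /symbol_fourier mulr_sumr; apply: eq_bigr => alpha /eqP am.
rewrite /term_coef /main_part /= kernel_dirs_mdirs am mulrA; congr (_ * _).
rewrite mpowZ am exprVn [(-1) ^+ m * (_ * _)]mulrA -exprMn mulN1r opprK.
rewrite mulrCA [RHS]mulrCA -!rmorphM /=; congr (_ * _%:C); rewrite -mulrA mulVKf//.
by rewrite expf_neq0// gt_eqF.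
Qed.

Definition damping n (xi : Rd) : R := 1 + \sum_(l <= s < m.+1) eps n ^+ (s - l) * enorm xi ^+ s.

Lemma eps_ge0 n : 0 <= eps n.
Proof. by have /andP[+ _] := heps n; apply: le_trans; exact: ltW. Qed.

Lemma damping_ge1 n xi : 1 <= damping n xi.
Proof.
rewrite lerDl sumr_ge0// => s _; rewrite mulr_ge0// exprn_ge0 ?eps_ge0 ?enorm_ge0//.
Qed.

(** E and P are made at least 1, so that their powers up to m are bounded by the m-th one. *)
Let E : R := Num.max 1 eps_infty.
Let P : R := (2 * pi) ^+ 2 + 1.

Let E1 : 1 <= E. Proof. by rewrite le_max lexx. Qed.
Let P1 : 1 <= P. Proof. by rewrite lerDr sqr_ge0. Qed.

Let eps_le n a : (a <= m)%N -> eps n ^+ a <= E ^+ m.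
Proof.
move=> am; apply: (@le_trans _ _ (E ^+ a)); last exact: ler_weXn2l.
by apply: lerXn2r; rewrite ?nnegrE ?eps_ge0 ?(le_trans ler01)// le_max; case/andP: (heps n) => _ ->; rewrite orbT.
Qed.

(** Used with j = m for the terms with the small factor and with j = m - 1 for those of lower order.
    Any j above the actual order will do, since P |xi|^2 >= 1. *)
Lemma cabs2_term_coef n xi t j : t \in terms -> (size t.2.1 <= j)%N -> 1 <= enorm xi ->
  cabs2 (term_coef n xi t) <= (E ^+ m) ^+ 2 * (P * enorm xi ^+ 2) ^+ j.
Proof.
move=> /termsP[/andP[h1 h2] h3] tj z1.
rewrite /term_coef !cabs2M cabs2_real cabs2X cabs2N cabs21 expr1n mul1r.
have z2 : 1 <= enorm xi ^+ 2 by rewrite exprn_ege1.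
apply: ler_pM; rewrite ?sqr_ge0 ?cabs2_ge0//.
  apply: lerXn2r; rewrite ?nnegrE ?exprn_ge0 ?eps_ge0 ?(le_trans ler01)//.
  by apply: eps_le; rewrite (leq_trans (leq_subr _ _)).
apply: (le_trans (cabs2_kernel_dirs _ _)).
apply: (@le_trans _ _ ((P * enorm xi ^+ 2) ^+ size t.2.1)); last first.
  by apply: ler_weXn2l => //; rewrite (le_trans z2)// ler_peMl// (le_trans ler01).
apply: lerXn2r; rewrite ?nnegrE; first exact: sqr_ge0.
  by apply: mulr_ge0; [exact: le_trans ler01 P1|exact: sqr_ge0].
by rewrite exprMn; apply: ler_wpM2r; [exact: sqr_ge0|rewrite lerDl].
Qed.

Let N : R := 2 ^+ size terms.
(** The factor 2 compensates [lowpass]: 1 <= 2 |xi|^2 lowpass for |xi| >= 1, and 1 <= 2 lowpass for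
    |xi| <= 1. *)
Let C1 : R := 2 * ((E ^+ m) ^+ 2 * P ^+ m).
Let N0 : 0 <= N. Proof. exact: exprn_ge0. Qed.
Let P0 : 0 <= P ^+ m. Proof. by rewrite exprn_ge0// (le_trans ler01). Qed.
Let C10 : 2 * P ^+ m <= C1.
Proof. by rewrite ler_wpM2l// ler_peMl// exprn_ege1// exprn_ege1. Qed.
Let C1_ge0 : 0 <= C1. Proof. by apply: le_trans C10; rewrite mulr_ge0. Qed.

(** One majorant for all frequencies. The terms with A_n - A carry no weight, because they may have
    full order m. *)
Definition remainder n (xi : Rd) : R :=
  \sum_(t <- terms) (cabs2 (err_part n t xi) + cabs2 (main_part n t xi) * lowpass xi).

Lemma remainder_ge0 n xi : 0 <= remainder n xi.
Proof.
rewrite /remainder; apply: sumr_ge0 => t _; apply: addr_ge0; first exact: cabs2_ge0.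
by apply: mulr_ge0; [exact: cabs2_ge0|exact: ltW (lowpass_gt0 xi)].
Qed.

Let main_le n xi : \sum_(t <- terms) cabs2 (main_part n t xi) * lowpass xi <= remainder n xi.
Proof. by apply: ler_sum => t _; rewrite lerDr cabs2_ge0. Qed.

Let err_le n xi : \sum_(t <- terms) cabs2 (err_part n t xi) <= remainder n xi.
Proof.
by apply: ler_sum => t _; rewrite lerDl mulr_ge0 ?cabs2_ge0// ltW// lowpass_gt0.
Qed.

(** No equation is involved here: the symbol is bounded, and [lowpass] is at least 1 / 2 on the unit
    ball. *)
Lemma symbol_fourier_low n xi : enorm xi <= 1 ->
  cabs2 (symbol_fourier n xi) <= N * C1 * remainder n xi.
Proof.
move=> z1; pose qc (alpha : mi) : C :=
  (0 +i* (2 * pi)) ^+ m * (mpow ((enorm xi)^-1 *: xi) alpha)%:C.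
have -> : symbol_fourier n xi = \sum_(t <- terms)
    (if ~~ (size t.2.1 < m)%N then qc t.1 * main_part n t xi else 0).
  by rewrite -big_mkcond (sum_top (fun t => qc t.1 * main_part n t xi)).
apply: (le_trans (cabs2_sum _ _)); rewrite -mulrA ler_wpM2l//.
apply: (@le_trans _ _ (C1 * \sum_(t <- terms) cabs2 (main_part n t xi) * lowpass xi)); last first.
  by rewrite ler_wpM2l.
rewrite mulr_sumr; apply: ler_sum => t _; rewrite [cabs2 (main_part _ _ _) * _]mulrC mulrA.
have lp0 := ltW (lowpass_gt0 xi).
case: ifP => _; last by rewrite cabs20 mulr_ge0 ?cabs2_ge0// mulr_ge0.
rewrite cabs2M ler_wpM2r ?cabs2_ge0// (@le_trans _ _ (P ^+ m))//.
  rewrite /qc cabs2M cabs2X cabs2_real -[leRHS]mulr1 ler_pM ?sqr_ge0 ?exprn_ge0 ?cabs2_ge0//.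
    by apply: lerXn2r; rewrite ?nnegrE ?cabs2_ge0 ?(le_trans ler01)// /cabs2 /= expr0n add0r lerDl.
  exact: mpow_direction_le1.
have lp : 1 / 2 <= lowpass xi.
  rewrite /lowpass div1r lef_pV2 ?posrE ?kern_denom_gt0// -[leRHS]/(1 + 1) lerD2l.
  by rewrite exprn_ile1 ?enorm_ge0.
apply: (@le_trans _ _ (2 * P ^+ m * (1 / 2))); first by rewrite mulrAC mulrCA mulfV// mulr1 mul1r.
by apply: ler_pM => //; rewrite ?mulr_ge0.
Qed.

Let C2 : R := 1 + \sum_(l <= s < m.+1) E ^+ m.
(** A lower bound of eps_n^(2 (m - l)); the minimum with 1 lets the exponent m replace m - l. *)
Let e0 : R := (Num.min 1 eps_0 ^+ m) ^+ 2.

Let e0_gt0 : 0 < e0.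
Proof. by rewrite !exprn_gt0// lt_min ltr01. Qed.

Let e0_le n : e0 <= (eps n ^+ (m - l)) ^+ 2.
Proof.
have m0 : 0 <= Num.min 1 eps_0 by rewrite le_min ler01 ltW.
apply: lerXn2r; rewrite ?nnegrE ?exprn_ge0 ?eps_ge0//.
apply: (@le_trans _ _ (Num.min 1 eps_0 ^+ (m - l))).
  by apply: ler_wiXn2l; rewrite ?leq_subr// ge_min lexx.
apply: lerXn2r; rewrite ?nnegrE ?eps_ge0// ge_min; case/andP: (heps n) => -> _.
by rewrite orbT.
Qed.

Lemma damping_le n xi : 1 <= enorm xi -> damping n xi <= C2 * enorm xi ^+ m.
Proof.
move=> z1; rewrite /damping /C2 mulrDl mul1r; apply: lerD; first exact: exprn_ege1.
rewrite mulr_suml !big_nat; apply: ler_sum => s /andP[_]; rewrite ltnS => sm.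
apply: ler_pM; rewrite ?exprn_ge0 ?eps_ge0 ?enorm_ge0//; last exact: ler_weXn2l.
by apply: eps_le; rewrite (leq_trans (leq_subr _ _)).
Qed.

(** Two uses of [cabs2D] on F - D - L give 4 F + 4 D + 2 L, whence the constants 4 and 6. The square
    C2^2 comes from damping <= C2 |xi|^m, and e0 from the division by eps_n^(2 (m - l)). *)
Lemma symbol_fourier_high n xi : 1 <= enorm xi ->
  cabs2 (symbol_fourier n xi) <= (4 * C2 ^+ 2 + 6 * N * C1) / e0 *
    (cabs2 (fourier_dist (f n k) phi xi) / damping n xi ^+ 2 + remainder n xi).
Proof.
move=> z1; have z0 : 0 < enorm xi by exact: lt_le_trans z1.
set Z := (enorm xi ^+ m) ^+ 2; have Z0 : 0 < Z by rewrite !exprn_gt0.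
set F := cabs2 (fourier_dist (f n k) phi xi); set W := damping n xi.
have W1 : 1 <= W := damping_ge1 n xi; have W0 : 0 < W by exact: lt_le_trans W1.
have F0 : 0 <= F by exact: cabs2_ge0.
set S := remainder n xi; have S0 : 0 <= S := remainder_ge0 n xi.
have ZE : (enorm xi ^+ 2) ^+ m = Z by rewrite exprAC.
have D : cabs2 (\sum_(t <- terms) term_coef n xi t * err_part n t xi) <= N * (C1 * Z * S).
  apply: (le_trans (cabs2_sum _ _)); rewrite ler_wpM2l//.
  apply: (@le_trans _ _ (C1 * Z * \sum_(t <- terms) cabs2 (err_part n t xi))); last first.
    by apply: ler_wpM2l => //; rewrite mulr_ge0// ltW.
  rewrite mulr_sumr !big_seq; apply: ler_sum => t tT; rewrite cabs2M ler_wpM2r ?cabs2_ge0//.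
  have [/andP[_ tm] ts] := termsP tT.
  apply: (le_trans (cabs2_term_coef n tT (leq_trans ts tm) z1)).
  rewrite exprMn ZE mulrA ler_wpM2r ?(ltW Z0)// /C1 ler_peMl ?ler1n//.
  by apply: mulr_ge0 => //; exact: sqr_ge0.
have L : cabs2 (\sum_(t <- terms | (size t.2.1 < m)%N) term_coef n xi t * main_part n t xi)
    <= N * (C1 * Z * S).
  rewrite big_mkcond; apply: (le_trans (cabs2_sum _ _)); rewrite ler_wpM2l//.
  apply: (@le_trans _ _ (C1 * Z * \sum_(t <- terms) cabs2 (main_part n t xi) * lowpass xi)); last first.
    by apply: ler_wpM2l => //; rewrite mulr_ge0// ltW.
  have lp0 := ltW (lowpass_gt0 xi).
  rewrite mulr_sumr !big_seq; apply: ler_sum => t tT; rewrite [cabs2 (main_part _ _ _) * lowpass _]mulrC mulrA.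
  case: ifP => tm; last first.
    by rewrite cabs20 mulr_ge0 ?cabs2_ge0// mulr_ge0// mulr_ge0// ltW.
  rewrite cabs2M ler_wpM2r ?cabs2_ge0//.
  have mj : m = m.-1.+1 by rewrite (ltn_predK tm).
  have tj : (size t.2.1 <= m.-1)%N by rewrite -ltnS -mj.
  apply: (le_trans (cabs2_term_coef n tT tj z1)).
  have z2 : 1 <= enorm xi ^+ 2 by exact: exprn_ege1.
  (* Such a term has at most m - 1 factors xi; the weight makes up for the missing one. *)
  have zl : 1 <= 2 * (enorm xi ^+ 2 * lowpass xi).
    by rewrite mulrA ler_pdivlMr ?kern_denom_gt0// mul1r; lra.
  have -> : C1 * Z * lowpass xi = (E ^+ m) ^+ 2 * (P ^+ m * ((enorm xi ^+ 2) ^+ m.-1 *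
      (2 * (enorm xi ^+ 2 * lowpass xi)))).
    by rewrite -ZE [in X in C1 * X]mj exprSr /C1; ring.
  rewrite ler_wpM2l ?sqr_ge0// exprMn ler_pM ?exprn_ge0 ?enorm_ge0 ?(le_trans ler01 P1)//.
    by apply: ler_weXn2l => //; exact: leq_pred.
  by rewrite ler_peMr// exprn_ge0// sqr_ge0.
have XE := symbol_fourier_terms n z0.
have : cabs2 ((eps n ^+ (m - l) * enorm xi ^+ m)%:C * symbol_fourier n xi) <=
    4 * F + 6 * N * C1 * (Z * S).
  rewrite XE; apply: (le_trans (cabs2D _ _)); rewrite cabs2N.
  have := cabs2D (fourier_dist (f n k) phi xi) (- \sum_(t <- terms) term_coef n xi t * err_part n t xi).
  rewrite cabs2N -/F; move: D L; rewrite !mulrA; lra.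
rewrite cabs2M cabs2_real exprMn -/Z => h.
have FW : F <= F / W ^+ 2 * (C2 ^+ 2 * Z).
  rewrite mulrAC ler_pdivlMr ?exprn_gt0// ler_wpM2l// -exprMn.
  have WC := damping_le n z1.
  apply: lerXn2r => //; rewrite nnegrE; [exact: ltW|exact: le_trans (ltW W0) WC].
rewrite mulrAC ler_pdivlMr//.
have Q0 := cabs2_ge0 (symbol_fourier n xi).
rewrite -(ler_pM2r Z0).
apply: (@le_trans _ _ (4 * F + 6 * N * C1 * (Z * S))).
  apply: le_trans h; rewrite -mulrA mulrC ler_wpM2r// ler_wpM2r// ltW//.
have FW0 : 0 <= F / W ^+ 2 by rewrite divr_ge0// sqr_ge0.
have : 0 <= 6 * N * C1 * (F / W ^+ 2 * Z).
  by apply: mulr_ge0; rewrite mulr_ge0// ?(ltW Z0)// mulr_ge0.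
have : 0 <= 4 * C2 ^+ 2 * (S * Z).
  by apply: mulr_ge0; [rewrite mulr_ge0 ?sqr_ge0|rewrite mulr_ge0// ltW].
move: FW; set a := F / _; lra.
Qed.

Lemma symbol_fourier_bound : exists2 c : R, 0 <= c & forall n xi,
  cabs2 (symbol_fourier n xi) <=
  c * (cabs2 (fourier_dist (f n k) phi xi) / damping n xi ^+ 2 + remainder n xi).
Proof.
have h0 : 0 <= (4 * C2 ^+ 2 + 6 * N * C1) / e0.
  apply: divr_ge0; last exact: ltW.
  by apply: addr_ge0; [exact: (mulr_ge0 _ (sqr_ge0 _))|apply: mulr_ge0 => //; exact: mulr_ge0].
have NC : 0 <= N * C1 by exact: mulr_ge0.
exists ((4 * C2 ^+ 2 + 6 * N * C1) / e0 + N * C1); first exact: addr_ge0.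
move=> n xi; have F0 : 0 <= cabs2 (fourier_dist (f n k) phi xi) / damping n xi ^+ 2.
  by rewrite divr_ge0 ?cabs2_ge0 ?sqr_ge0.
have S0 := remainder_ge0 n xi.
have [z1|z1] := leP (enorm xi) 1.
  apply: (le_trans (symbol_fourier_low n z1)); apply: ler_pM => //.
    by rewrite lerDr.
  by rewrite lerDr.
apply: (le_trans (symbol_fourier_high n (ltW z1))); apply: ler_wpM2r; first exact: addr_ge0.
by rewrite lerDl.
Qed.

(** Read off from the equation: the transform is a finite sum of Fourier transforms of integrable
    functions with polynomial coefficients in xi. *)
Lemma measurable_fourier_dist n : cmeasurable_on setT (fourier_dist (f n k) phi).
Proof.
rewrite (_ : fourier_dist _ _ = fun xi => \sum_(t <- terms)
    (if t \in terms then term_coef n xi t * fourier_comb u (coef (A n t.1) t.2.2) n xi else 0)).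
  apply: cmeasurable_sum => t; case tT: (t \in terms); last exact: cmeasurable_cst.
  have [ha _] := termsP tT.
  apply: cmeasurableM; last first.
    by apply: (measurable_fourier_comb oO hu hK) => j; apply: bcoef_coef; exact: cA.
  apply: cmeasurableM; first exact: cmeasurable_cst.
  apply: cmeasurableM; first exact: cmeasurable_cst.
  rewrite /kernel_dirs; elim: t.2.1 => [|i a IH].
    by under eq_fun do rewrite big_nil; exact: cmeasurable_cst.
  under eq_fun do rewrite big_cons; apply: cmeasurableM => //.
  split => /=; first exact: measurable_cst.
  by apply: measurable_funN; apply: measurable_funM => //; exact: measurable_rV_coord.
apply/funext => xi; rewrite fourier_dist_terms !big_seq; apply: eq_bigr => t -> //.
Qed.

Lemma measurable_damping n : measurable_fun setT (damping n).
Proof.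
apply: measurable_funD => //; apply: measurable_sum => s; apply: measurable_funM => //.
by apply: measurable_funX; exact: measurable_enorm.
Qed.

Lemma measurable_invr_damping n : measurable_fun setT (fun xi => (damping n xi ^+ 2)^-1).
Proof.
apply: (measurableT_comp measurable_invr).
by apply: measurable_funX; exact: measurable_damping.
Qed.

Lemma measurable_symbol_fourier n : cmeasurable_on setT (symbol_fourier n).
Proof.
rewrite (_ : symbol_fourier n = fun xi => \sum_(alpha : mi) if mlen alpha == m then
    (0 +i* (2 * pi)) ^+ m * (mpow ((enorm xi)^-1 *: xi) alpha)%:C *
    fourier_comb u (coef (Alim alpha) [::]) n xi else 0); last first.
  by apply/funext => xi; rewrite -big_mkcond.
apply: cmeasurable_sum => alpha; case am: (mlen alpha == m); last exact: cmeasurable_cst.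
have ha : (l <= mlen alpha <= m)%N by rewrite (eqP am) lm leqnn.
apply: cmeasurableM; last first.
  by apply: (measurable_fourier_comb oO hu hK) => j; apply: bcoef_coef; exact: cAlim.
apply: cmeasurableM; first exact: cmeasurable_cst.
split => /=; last exact: measurable_cst.
rewrite /mpow; apply: measurable_prod => i _; apply: measurable_funX.
under eq_fun do rewrite mxE; apply: measurable_funM; last exact: measurable_rV_coord.
exact: (measurableT_comp measurable_invr measurable_enorm).
Qed.

Lemma symbol_fourier_null :
  ev0 (fun n => \int[leb]_xi (cabs2 (fourier_dist (f n k) phi xi) / damping n xi ^+ 2)%:E)%E ->
  ev0 (fun n => \int[leb]_xi (cabs2 (symbol_fourier n xi))%:E)%E.
Proof.
move=> hF; have [c c0 hc] := symbol_fourier_bound.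
pose F n xi := (cabs2 (fourier_dist (f n k) phi xi) / damping n xi ^+ 2)%:E.
(* The coefficients are known to be continuous only for indices in [terms], while the lemmas on sums
   range over all t; the others get the value 0. *)
pose ge n (t : mi * (seq 'I_d * seq 'I_d)) xi : \bar R :=
  if t \in terms then (cabs2 (err_part n t xi))%:E else 0%E.
pose gm n (t : mi * (seq 'I_d * seq 'I_d)) xi : \bar R :=
  if t \in terms then (cabs2 (main_part n t xi) * lowpass xi)%:E else 0%E.
have be n t j : t \in terms ->
    exists M, bcoef K M (coef (fun x => A n t.1 x - Alim t.1 x) t.2.2 j).
  by move=> /termsP[ha _]; apply: bcoef_coef; exact: ccontinuous_err.
have bm t j : t \in terms -> exists M, bcoef K M (coef (Alim t.1) t.2.2 j).
  by move=> /termsP[ha _]; apply: bcoef_coef; exact: cAlim.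
have F0 n xi : (0 <= F n xi)%E by rewrite lee_fin divr_ge0 ?cabs2_ge0 ?sqr_ge0.
have ge0 n t xi : (0 <= ge n t xi)%E by rewrite /ge; case: ifP; rewrite // lee_fin cabs2_ge0.
have gm0 n t xi : (0 <= gm n t xi)%E.
  rewrite /gm; case: ifP; rewrite // lee_fin => _; apply: mulr_ge0; first exact: cabs2_ge0.
  exact: ltW (lowpass_gt0 xi).
have mF n : measurable_fun setT (F n).
  apply/measurable_EFinP; apply: measurable_funM; last exact: measurable_invr_damping.
  by apply: measurable_cabs2; exact: measurable_fourier_dist.
have mge n t : measurable_fun setT (ge n t).
  rewrite /ge; case tT: (t \in terms); last exact: measurable_cst.
  apply/measurable_EFinP; apply: measurable_cabs2.
  by apply: (measurable_fourier_comb oO hu hK) => j; exact: be.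
have mgm n t : measurable_fun setT (gm n t).
  rewrite /gm; case tT: (t \in terms); last exact: measurable_cst.
  apply/measurable_EFinP; apply: measurable_funM; last exact: measurable_lowpass.
  apply: measurable_cabs2.
  by apply: (measurable_fourier_comb oO hu hK) => j; exact: bm.
have ev_e t : ev0 (fun n => \int[leb]_xi ge n t xi)%E.
  rewrite /ge; case: (boolP (t \in terms)) => tT; last first.
    by under eq_fun do rewrite integral0; exact: ev0_0.
  apply: (fourier_comb_unif0 oO hu hK (fun n j => be n t j tT)) => j e e0'.
  have [M M0 hM] := Cc_bounded (test_fun_Cc (test_fun_cpartials t.2.2 tphi)).
  have M1 : 0 < M + 1 by rewrite ltr_wpDl.
  (* Uniform convergence bounds the modulus, but its square is needed; M + 1 absorbs the derivative
     of phi. *)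
  have e1 : 0 < Num.sqrt (e / (M + 1)) by rewrite sqrtr_gt0 divr_gt0.
  have [ha _] := termsP tT.
  have := hA ha hK e1; apply: filterS => n hn x.
  rewrite /coef cabs2M; have [Kx|nK] := pselect (K x); last first.
    by rewrite (csupport_out (f := cpartials _ _)) ?cabs20 ?mul0r ?ltW// => /(@cpartials_support _ _ _ _ _).
  apply: (@le_trans _ _ (M * (e / (M + 1)))).
    apply: ler_pM; rewrite ?cabs2_ge0// -sqr_cabs -(sqr_sqrtr (ltW (divr_gt0 e0' M1))).
    apply: lerXn2r; rewrite ?nnegrE ?sqrtr_ge0//.
    by rewrite !mxE; apply: ltW; exact: hn.
  by rewrite mulrCA ger_pMr// ler_pdivrMr// mul1r lerDl.
have ev_m t : ev0 (fun n => \int[leb]_xi gm n t xi)%E.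
  rewrite /gm; case: (boolP (t \in terms)) => tT; last first.
    by under eq_fun do rewrite integral0; exact: ev0_0.
  by apply: (fourier_comb_lowpass oO hu hK) => j; exact: bm.
apply: (ev0_le _ (ev0Z c0 (ev0D hF (ev0D (ev0_sum terms ev_e) (ev0_sum terms ev_m))))) => n.
have msum (g : nat -> _ -> Rd -> \bar R) : (forall n t, measurable_fun setT (g n t)) ->
    measurable_fun setT (fun xi => \sum_(t <- terms) g n t xi)%E.
  by move=> mg; exact: emeasurable_sum.
rewrite -(ge0_integral_sum _ measurableT (mge n) (fun t x _ => ge0 n t x)).
rewrite -(ge0_integral_sum _ measurableT (mgm n) (fun t x _ => gm0 n t x)).
have se0 xi : (0 <= \sum_(t <- terms) ge n t xi)%E by apply: sume_ge0.
have sm0 xi : (0 <= \sum_(t <- terms) gm n t xi)%E by apply: sume_ge0.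
rewrite -(ge0_integralD _ measurableT (fun x _ => se0 x) (msum _ mge) (fun x _ => sm0 x) (msum _ mgm)).
have md : measurable_fun setT (fun xi => \sum_(t <- terms) ge n t xi + \sum_(t <- terms) gm n t xi)%E.
  by apply: emeasurable_funD; exact: msum.
have d0 xi : (0 <= \sum_(t <- terms) ge n t xi + \sum_(t <- terms) gm n t xi)%E by exact: adde_ge0.
rewrite -(ge0_integralD _ measurableT (fun x _ => F0 n x) (mF n) (fun x _ => d0 x) md).
rewrite -ge0_integralZl//; last 2 first.
- by apply: emeasurable_funD.
- by move=> x _; apply: adde_ge0.
apply: ge0_le_integral => //.
- by move=> xi _; rewrite lee_fin cabs2_ge0.
- by apply/measurable_EFinP; apply: measurable_cabs2; exact: measurable_symbol_fourier.
- by apply: measurable_funeM; apply: emeasurable_funD.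
move=> xi _; apply: (@le_trans _ _ ((c * (cabs2 (fourier_dist (f n k) phi xi) / damping n xi ^+ 2 + remainder n xi))%:E)); first by rewrite lee_fin.
rewrite EFinM EFinD; apply: lee_wpmul2l => //; apply: leeD => //.
rewrite /remainder big_split /= EFinD -!sumEFin; apply: leeD.
  by rewrite !big_seq; apply: lee_sum => t tT; rewrite /ge tT.
by rewrite !big_seq; apply: lee_sum => t tT; rewrite /gm tT.
Qed.

End pde_symbol.

Lemma cabs_ge0 {R : realType} (z : R[i]) : 0 <= cabs z.
Proof. exact: sqrtr_ge0. Qed.

(** * Orthogonality of the H-measure to the principal symbol *)

Section radon_integrals.
Context {R : realType} {d : nat}.
Local Notation Rd := 'rV[R]_d.
Local Notation C := R[i].
Variable Omega : set Rd.
Hypothesis oO : open Omega.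
Let X : set (Rd * Rd) := Omega `*` unit_sphere R d.

Lemma continuous_enorm : continuous (@enorm R d).
Proof.
move=> x; apply: (@continuous_comp _ _ _ (fun y : Rd => dotp y y) (@Num.sqrt R)); last exact: sqrt_continuous.
by apply: (continuous_dotp (f := id) (g := id)) => y; exact: cvg_id.
Qed.

Lemma compact_sphere : compact (unit_sphere R d).
Proof.
have cl : closed (unit_sphere R d).
  rewrite (_ : unit_sphere R d = @enorm R d @^-1` [set 1]); last first.
    by apply/seteqP; split.
  apply: closed_comp; last exact: closed_eq.
  by move=> x _; exact: continuous_enorm.
have sub : unit_sphere R d `<=` cube 0 1.
  by move=> x /= x1 i; rewrite mxE subr0 -x1; exact: coord_le_enorm.
have cc := @compact_cube R d 0 1.
exact: (subclosed_compact cl cc sub).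
Qed.

Lemma measurable_cotangent : measurable X.
Proof.
apply: measurableX; first exact: open_measurable_rV.
by apply: compact_measurable_rV; exact: compact_sphere.
Qed.

(** On X the integrand is bounded and vanishes off the product of the support of b with the sphere,
    a compact set of finite measure. The constant N M + 1 bounds the modulus t because t <= t^2 +
    1. *)
Lemma radon_integrable (nu : {measure set (Rd * Rd) -> \bar R}) (b p : Rd -> C) (M : R) :
  radon_on X nu -> Cc Omega b -> cmeasurable_on setT p -> (forall x, cabs2 (p x) <= M) ->
  cintegrable nu X (fun z => b z.1 * p z.2).
Proof.
move=> rX cb mp pM; have [N N0 hN] := Cc_bounded cb.
have M0 : 0 <= M by apply: le_trans (pM 0); exact: cabs2_ge0.
have mX := measurable_cotangent.
pose S := csupport b; have cS : compact S by case: cb => _ [].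
have SO : S `<=` Omega by case: cb => _ [].
have mB : measurable (S `*` unit_sphere R d).
  by apply: measurableX; apply: compact_measurable_rV => //; exact: compact_sphere.
have fin : (nu (S `*` unit_sphere R d) < +oo)%E.
  apply: rX; split; first by apply: compact_setX => //; exact: compact_sphere.
  by move=> z [/SO z1 z2].
have i0 : nu.-integrable X (EFin \o (\1_(S `*` unit_sphere R d) : Rd * Rd -> R)).
  apply/integrableP; split; first by apply/measurable_EFinP; exact: measurable_indic.
  under eq_integral do rewrite /= ger0_norm//.
  rewrite integral_indic//; apply: le_lt_trans fin; apply: le_measure; rewrite ?inE//.
    by apply/mem_set; exact: measurableI.
  exact: mem_set.
have i1 := integrableZl mX (N * M + 1) i0.
have mb := ccontinuous_measurable cb.1.
have mF : cmeasurable_on setT (fun z : Rd * Rd => b z.1 * p z.2).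
  apply: cmeasurableM.
    by split; [exact: (measurableT_comp mb.1 measurable_fst)|exact: (measurableT_comp mb.2 measurable_fst)].
  by split; [exact: (measurableT_comp mp.1 measurable_snd)|exact: (measurableT_comp mp.2 measurable_snd)].
have bd z : X z -> cabs (b z.1 * p z.2) <= (N * M + 1) * \1_(S `*` unit_sphere R d) z.
  move=> [_ z2]; have [Sz|nS] := pselect (S z.1); last first.
    by rewrite (csupport_out nS) mul0r /cabs cabs20 sqrtr0 mulr_ge0 ?addr_ge0 ?mulr_ge0.
  rewrite indicE mem_set//= mulr1.
  have h : cabs2 (b z.1 * p z.2) <= N * M by rewrite cabs2M; apply: ler_pM; rewrite ?cabs2_ge0.
  have c0 := cabs_ge0 (b z.1 * p z.2); move: h; rewrite -sqr_cabs => h.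
  have := sqr_ge0 (cabs (b z.1 * p z.2) - 1); rewrite sqrrB; lra.
split; apply: (integrable_Rle _ _ _ i1) => //.
- exact: (measurable_funS measurableT (@subsetT _ X) mF.1).
- by move=> z Xz; apply: le_trans (bd z Xz); exact: Re_le_cabs.
- exact: (measurable_funS measurableT (@subsetT _ X) mF.2).
- by move=> z Xz; apply: le_trans (bd z Xz); exact: Im_le_cabs.
Qed.

Definition cradon_integrable (mu : cradon X) (g : Rd * Rd -> C) :=
  [/\ cintegrable (rpos mu) X g, cintegrable (rneg mu) X g,
      cintegrable (ipos mu) X g & cintegrable (ineg mu) X g].

Lemma cradon_integrable_tensor (mu : cradon X) (b p : Rd -> C) (M : R) :
  Cc Omega b -> cmeasurable_on setT p -> (forall x, cabs2 (p x) <= M) ->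
  cradon_integrable mu (fun z => b z.1 * p z.2).
Proof.
by move=> cb mp pM; split; apply: radon_integrable cb mp pM;
  [exact: rpos_radon|exact: rneg_radon|exact: ipos_radon|exact: ineg_radon].
Qed.

(** The limits in [is_Hmeasure] are integrals against the conjugate of mu; conjugation turns them
    into integrals against mu itself. *)
Lemma cradon_integral_conj (mu : cradon X) (g : Rd * Rd -> C) : cradon_integrable mu g ->
  cradon_integral mu X (fun z => (g z)^*) = (cradon_integral (cradon_conj mu) X g)^*.
Proof.
move=> [i1 i2 i3 i4]; have mX := measurable_cotangent.
have cc (nu : {measure set (Rd * Rd) -> \bar R}) : cintegrable nu X g ->
    cintegral nu X (fun z => (g z)^*) = (cintegral nu X g)^*.
  move=> [ir ii]; apply: complexP; rewrite ?ReJ ?ImJ /cintegral /=.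
    by apply: eq_Rintegral => z _; rewrite ReJ.
  by rewrite -mulN1r -RintegralZl//; apply: eq_Rintegral => z _; rewrite ImJ mulN1r.
rewrite /cradon_integral !cc// rmorphD rmorphM !rmorphB /=.
by apply: complexP; rewrite !(ReD, ImD, ReM, ImM, ReN, ImN) /=; ring.
Qed.

Lemma cradon_integral_sum (mu : cradon X) I (s : seq I) (g : I -> Rd * Rd -> C) :
  (forall i, cradon_integrable mu (g i)) ->
  cradon_integral mu X (fun z => \sum_(i <- s) g i z) =
  \sum_(i <- s) cradon_integral mu X (g i).
Proof.
move=> ig; have mX := measurable_cotangent.
have i1 i : cintegrable (rpos mu) X (g i) by case: (ig i).
have i2 i : cintegrable (rneg mu) X (g i) by case: (ig i).
have i3 i : cintegrable (ipos mu) X (g i) by case: (ig i).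
have i4 i : cintegrable (ineg mu) X (g i) by case: (ig i).
rewrite /cradon_integral (cintegral_sum mX s i1).2 (cintegral_sum mX s i2).2.
rewrite (cintegral_sum mX s i3).2 (cintegral_sum mX s i4).2.
by rewrite big_split /= -mulr_sumr !sumrB.
Qed.

Lemma eq_cradon_integral (mu : cradon X) E (g h : Rd * Rd -> C) :
  (forall z, E z -> g z = h z) -> cradon_integral mu E g = cradon_integral mu E h.
Proof.
move=> gh; have e (nu : {measure set (Rd * Rd) -> \bar R}) : cintegral nu E g = cintegral nu E h.
  by rewrite /cintegral; congr (_ +i* _); apply: eq_Rintegral => z /set_mem /gh ->.
by rewrite /cradon_integral !e.
Qed.

End radon_integrals.

Section young.
Context {R : realType} {d : nat}.
Local Notation Rd := 'rV[R]_d.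
Local Notation C := R[i].
Local Notation leb := (lebesgue_rV d).

Lemma cabs2_integrable (F : Rd -> C) (B : R) : cmeasurable_on setT F ->
  (\int[leb]_xi (cabs2 (F xi))%:E <= B%:E)%E ->
  leb.-integrable setT (EFin \o (fun xi => cabs2 (F xi))) /\
  \int[leb]_xi cabs2 (F xi) <= B.
Proof.
move=> mF hB.
have iF : leb.-integrable setT (EFin \o (fun xi => cabs2 (F xi))).
  apply/integrableP; split; first by apply/measurable_EFinP; exact: measurable_cabs2.
  under eq_integral do rewrite /= ger0_norm ?cabs2_ge0//.
  by rewrite (le_lt_trans hB)// ltry.
by split=> //; rewrite -lee_fin -(Rintegral_EFin measurableT iF).
Qed.

(** Young's inequality with a free parameter in place of Cauchy-Schwarz: eta is first made small
    against the bound of F, then e against eta. *)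
Lemma cintegral_conjM_le (F G w : Rd -> C) (B e eta : R) :
  cmeasurable_on setT F -> cmeasurable_on setT G -> cmeasurable_on setT w ->
  (\int[leb]_xi (cabs2 (F xi))%:E <= B%:E)%E ->
  (\int[leb]_xi (cabs2 (G xi))%:E <= e%:E)%E ->
  (forall xi, cabs2 (w xi) <= 1) -> 0 < eta ->
  let H xi := F xi * (G xi)^* * w xi in
  cintegrable leb setT H /\
  `|Re (cintegral leb setT H)| <= eta * B + eta^-1 * e /\
  `|Im (cintegral leb setT H)| <= eta * B + eta^-1 * e.
Proof.
move=> mF mG mw hB he w1 eta0 H.
have [iF FB] := cabs2_integrable mF hB; have [iG Ge] := cabs2_integrable mG he.
have mGJ : cmeasurable_on setT (fun xi => (G xi)^*).
  split; under eq_fun do rewrite ?ReJ ?ImJ; [exact: mG.1|exact: (measurable_funN mG.2)].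
have mH : cmeasurable_on setT H by do 2! apply: cmeasurableM => //.
have ib : leb.-integrable setT (EFin \o (fun xi => eta * cabs2 (F xi) + eta^-1 * cabs2 (G xi))).
  exact: (integrableD measurableT (integrableZl measurableT eta iF) (integrableZl measurableT eta^-1 iG)).
have bd xi : cabs (H xi) <= eta * cabs2 (F xi) + eta^-1 * cabs2 (G xi).
  have h : cabs (H xi) <= cabs (F xi) * cabs (G xi).
    rewrite /cabs -sqrtrM ?cabs2_ge0// ler_wsqrtr// !cabs2M cabs2J -[leRHS]mulr1 ler_wpM2l//.
    by rewrite mulr_ge0// cabs2_ge0.
  apply: le_trans h _.
  rewrite -!sqr_cabs -(ler_pM2l eta0) mulrDr mulVKf ?gt_eqF//.
  have := sqr_ge0 (eta * cabs (F xi) - cabs (G xi)).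
  have : 0 <= eta * (cabs (F xi) * cabs (G xi)).
    by apply: mulr_ge0; [exact: ltW|apply: mulr_ge0; exact: cabs_ge0].
  rewrite sqrrB exprMn !expr2; lra.
have iH : cintegrable leb setT H.
  split; apply: (integrable_Rle measurableT _ _ ib); [exact: mH.1| |exact: mH.2|].
    by move=> xi _; apply: le_trans (bd xi); exact: Re_le_cabs.
  by move=> xi _; apply: le_trans (bd xi); exact: Im_le_cabs.
have fin (a : Rd -> R) : leb.-integrable setT (EFin \o a) ->
    (forall xi, `|a xi| <= cabs (H xi)) -> `|\int[leb]_xi a xi| <= eta * B + eta^-1 * e.
  move=> ia ha; apply: (le_trans (le_normr_Rintegral measurableT ia)).
  have ina : leb.-integrable setT (EFin \o (fun xi => `|a xi|)) := integrable_norm ia.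
  apply: (@le_trans _ _ (\int[leb]_xi (eta * cabs2 (F xi) + eta^-1 * cabs2 (G xi)))).
    by apply: le_Rintegral => // xi _; apply: le_trans (ha xi) (bd xi).
  have j1 := integrableZl measurableT eta iF; have j2 := integrableZl measurableT eta^-1 iG.
  rewrite RintegralD// !RintegralZl//; apply: lerD.
    by apply: ler_wpM2l => //; exact: ltW.
  by apply: ler_wpM2l => //; rewrite invr_ge0 ltW.
split=> //; split; apply: fin; [exact: iH.1|by move=> xi; exact: Re_le_cabs|exact: iH.2|].
by move=> xi; exact: Im_le_cabs.
Qed.

End young.

Section Hmeasure_orthogonality.
Context {R : realType} {d r q m : nat}.
Local Notation Rd := 'rV[R]_d.
Local Notation C := R[i].
Local Notation leb := (lebesgue_rV d).
Local Notation mi := (@mindex d m).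
Local Notation dir xi := ((enorm xi)^-1 *: xi).
Variables (Omega : set Rd) (u : nat -> Rd -> 'cV[C]_r) (sigma : nat -> nat)
  (mu : 'I_r -> 'I_r -> cradon (Omega `*` unit_sphere R d))
  (B : mi -> Rd -> 'M[C]_(q, r)) (phi : Rd -> C) (k : 'I_q).
Hypothesis oO : open Omega.
Hypothesis hu : weak_cvg0_L2loc Omega u.
Hypothesis sigma_incr : {homo sigma : a b / (a < b)%N}.
Hypothesis hmu : is_Hmeasure (fun n => u (sigma n)) mu.
Hypothesis cB : forall alpha k j, ccontinuous_on Omega (fun x => B alpha x k j).
Hypothesis tphi : test_fun Omega phi.
Hypothesis mQ : forall n, cmeasurable_on setT (symbol_fourier u B phi k n).
Hypothesis Q0 : ev0 (fun n => \int[leb]_xi (cabs2 (symbol_fourier u B phi k n xi))%:E)%E.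

Let X := Omega `*` unit_sphere R d.

Lemma ccontinuous_onJ (b : Rd -> C) : ccontinuous_on Omega b ->
  ccontinuous_on Omega (fun x => (b x)^*).
Proof.
move=> /(ccontinuous_onP oO) cb; apply/(ccontinuous_onP oO) => x Ox; have [cr ci] := cb x Ox.
split; first by rewrite (_ : (fun y => _) = fun y => Re (b y))//; apply/funext => y; rewrite ReJ.
rewrite (_ : (fun y => _) = fun y => - Im (b y)); last by apply/funext => y; rewrite ImJ.
exact: (continuousN (f := fun y => Im (b y))).
Qed.

Lemma Cc_coef alpha j : Cc Omega (coef phi k (B alpha) [::] j).
Proof.
rewrite (_ : coef _ _ _ _ _ = fun x => phi x * B alpha x k j).
  by apply: Cc_mul => //; exact: test_fun_Cc.
by apply/funext => x; rewrite /coef cpartials_nil.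
Qed.

Lemma continuous_mpow (alpha : mi) : continuous (fun xi : Rd => mpow xi alpha).
Proof.
apply: (@continuous_big R^o 'I_d *%R 1 xpredT _ Rd (index_enum 'I_d)
  (fun i y => y ord0 i ^+ alpha i)); first exact: mul_continuous.
move=> i _ y; apply: (@continuous_comp _ _ _ (fun x : Rd => x ord0 i) (fun t : R => t ^+ alpha i)).
  exact: coord_continuous.
exact: exprn_continuous.
Qed.

Lemma measurable_dir : measurable_fun setT (fun xi : Rd => dir xi).
Proof.
apply: measurable_fun_rVP => i; under eq_fun do rewrite mxE.
apply: measurable_funM; last exact: measurable_rV_coord.
exact: (measurableT_comp measurable_invr measurable_enorm).
Qed.

Lemma ccvg_sum I (s : seq I) (z : I -> nat -> C) (l : I -> C) : (forall i, ccvg (z i) (l i)) ->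
  ccvg (fun n => \sum_(i <- s) z i n) (\sum_(i <- s) l i).
Proof.
move=> zl; elim: s => [|i s [cr ci]].
  by rewrite big_nil; split; under eq_fun do rewrite big_nil; exact: cvg_cst.
rewrite big_cons; split; under eq_fun do rewrite big_cons ?ReD ?ImD; rewrite ?ReD ?ImD.
  exact: (cvgD (zl i).1 cr).
exact: (cvgD (zl i).2 ci).
Qed.

Lemma conj_mul_real (c a b : C) (t s : R) :
  c^* * (a * b^* * (t * s)%:C) = a * (c * t%:C * b)^* * s%:C.
Proof. by apply: complexP; rewrite !(ReM, ImM, ReJ, ImJ) /=; ring. Qed.

Lemma conj_tensor (c a b : C) (t : R) :
  a^* * b * (c * t%:C) = (a * b^* * (c^* * t%:C))^*.
Proof. by apply: complexP; rewrite !(ReM, ImM, ReJ, ImJ) /=; ring. Qed.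

Definition top_indices : seq mi := [seq alpha <- index_enum mi | mlen alpha == m].

Definition symbol_cst : C := (0 +i* (2 * pi)) ^+ m.

Variables (i : 'I_r) (phi1 : Rd -> C) (g : Rd -> R).
Hypothesis cphi1 : Cc Omega phi1.
Hypothesis cg : continuous g.
Hypothesis g01 : forall x, 0 <= g x <= 1.

Let F n := fourier (fun x => phi1 x * u n x i ord0).
Let w (alpha : mi) (xi : Rd) : C := (mpow (dir xi) alpha * g (dir xi))%:C.
(** The constant is conjugated because the symbol enters through the second, conjugated factor of
    the pairing. *)
Let piece (p : mi * 'I_r) n xi : C := symbol_cst^* *
  (F n xi * (fourier (fun x => coef phi k (B p.1) [::] p.2 x * u n x p.2 ord0) xi)^* * w p.1 xi).

Let g2 x : g x ^+ 2 <= 1.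
Proof. by have /andP[g0 g1] := g01 x; rewrite exprn_ile1. Qed.

Let mg : measurable_fun setT (fun xi => g (dir xi)).
Proof. exact: (measurableT_comp (continuous_measurable_rV cg) measurable_dir). Qed.

Let mw alpha : cmeasurable_on setT (w alpha).
Proof.
split => /=; last exact: measurable_cst.
apply: measurable_funM => //.
exact: (measurableT_comp (continuous_measurable_rV (@continuous_mpow alpha)) measurable_dir).
Qed.

Let w1 alpha xi : cabs2 (w alpha xi) <= 1.
Proof.
rewrite cabs2_real exprMn -[leRHS]mulr1 ler_pM ?sqr_ge0//.
exact: mpow_direction_le1.
Qed.

Let F_bounded : exists2 M : R, 0 < M & forall n,
  cmeasurable_on setT (F n) /\ (\int[leb]_xi (cabs2 (F n xi))%:E <= M%:E)%E.
Proof.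
have hK : compact_in (csupport phi1) Omega by case: cphi1.
have [M bM] := Cc_bcoef cphi1 (@subset_refl _ (csupport phi1)).
have [Bu Bu0 hBu] := u_bounded oO hu hK i.
have M0 : 0 <= M by case: bM => _ _ /(_ 0); apply: le_trans; exact: cabs2_ge0.
have b0 := bessel_cst_ge0 (R := R) (d := d).
exists (bessel_cst (R := R) (d := d) * M * Bu + 1); first by rewrite ltr_wpDl// mulr_ge0// mulr_ge0.
move=> n; split; first exact: (measurable_fourier_coef oO hu hK n i bM).
apply: (le_trans (fourier_coef_le oO hu hK n i bM)); rewrite lee_fin.
apply: (@le_trans _ _ (bessel_cst (R := R) (d := d) * M * Bu)); last by rewrite lerDl.
by apply: ler_wpM2l => //; exact: mulr_ge0.
Qed.

Let piece_integrable p n : cintegrable leb setT (piece p n).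
Proof.
have hK : compact_in (csupport phi) Omega by case: tphi.
have [M bM] := bcoef_coef oO tphi (B := B p.1) [::] (cB p.1 k p.2).
have [M1 _ /(_ n) [mF hF]] := F_bounded.
have mG := measurable_fourier_coef oO hu hK n p.2 bM.
have hG := fourier_coef_le oO hu hK n p.2 bM.
have [iH _] := cintegral_conjM_le mF mG (mw p.1) hF hG (w1 p.1) ltr01.
exact: (cintegralZ measurableT symbol_cst^* iH).1.
Qed.

Let pairs := [seq (alpha, j) | alpha <- top_indices, j <- index_enum 'I_r].

Let sum_piece n : (fun xi => \sum_(p <- pairs) piece p n xi) =
  fun xi => F n xi * (symbol_fourier u B phi k n xi)^* * (g (dir xi))%:C.
Proof.
apply/funext => xi; rewrite big_allpairs /top_indices big_filter /symbol_fourier.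
rewrite rmorph_sum mulr_sumr mulr_suml; apply: eq_bigr => alpha _.
rewrite /fourier_comb mulr_sumr rmorph_sum mulr_sumr mulr_suml; apply: eq_bigr => j _.
exact: conj_mul_real.
Qed.

Let sum_piece_cvg : ccvg (fun n => \sum_(p <- pairs) cintegral leb setT (piece p (sigma n))) 0.
Proof.
have E n : \sum_(p <- pairs) cintegral leb setT (piece p n) =
    cintegral leb setT (fun xi => F n xi * (symbol_fourier u B phi k n xi)^* * (g (dir xi))%:C).
  by rewrite -sum_piece (cintegral_sum measurableT pairs (piece_integrable ^~ n)).2.
have [M M0 hF] := F_bounded.
have key : forall e : R, 0 < e -> \forall n \near \oo,
    `|Re (\sum_(p <- pairs) cintegral leb setT (piece p (sigma n)))| <= e /\
    `|Im (\sum_(p <- pairs) cintegral leb setT (piece p (sigma n)))| <= e.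
  (* eta M = e / 2, and the threshold eta e / 2 for the integral of Q contributes the other half. *)
  move=> e e0; pose eta := e / (2 * M); have eta0 : 0 < eta by rewrite divr_gt0// mulr_gt0.
  have d0 : 0 < eta * (e / 2) by rewrite mulr_gt0// divr_gt0.
  have [N _ hN] := Q0 d0; exists N => // n /= Nn.
  (* The smallness of Q holds from N on along the whole sequence, hence along the subsequence. *)
  have ns : (n <= sigma n)%N.
    by elim: (n) => // n' IH; apply: leq_ltn_trans IH _; exact: sigma_incr.
  have hQ := hN _ (leq_trans Nn ns); have [mF hFn] := hF (sigma n).
  have mgc : cmeasurable_on setT (fun xi => (g (dir xi))%:C : C).
    by split => //=; exact: measurable_cst.
  have gw xi : cabs2 ((g (dir xi))%:C : C) <= 1 by rewrite cabs2_real.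
  have [_ [h1 h2]] := cintegral_conjM_le mF (mQ (sigma n)) mgc hFn hQ gw eta0.
  have eE : eta * M + eta^-1 * (eta * (e / 2)) = e.
    by rewrite mulKf ?gt_eqF// /eta; field; rewrite gt_eqF.
  by rewrite E -{1}eE; split => //; rewrite -eE.
split; apply/cvgr0Pnorm_le => e e0; have := key e e0; apply: filterS => n [].
  by [].
by [].
Qed.

(** Each summand is the conjugate of a limit provided by [is_Hmeasure], with phi_2 a coefficient of
    the symbol. The sum of these limits is 0, because it is also the limit of pairings with Q. *)
Lemma Hmeasure_orthogonal_pairs :
  \sum_(p <- pairs) cradon_integral (mu i p.2) X (fun z =>
    (phi1 z.1)^* * coef phi k (B p.1) [::] p.2 z.1 *
    (symbol_cst * (mpow (dir z.2) p.1 * g z.2)%:C)) = 0.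
Proof.
(* Without normalization of zeta, which makes psi continuous everywhere; on the sphere the two
   versions agree. *)
pose psi (alpha : mi) (zeta : Rd) : C := symbol_cst^* * (mpow zeta alpha * g zeta)%:C.
have cpsi alpha : ccontinuous_on (unit_sphere R d) (psi alpha).
  have cm : continuous (fun zeta : Rd => mpow zeta alpha * g zeta).
    by move=> z; apply: continuousM; [exact: continuous_mpow|exact: cg].
  split; apply: continuous_subspaceT; move=> z.
    rewrite (_ : (fun x => _) = fun x => Re (symbol_cst^*) * (mpow x alpha * g x)); last first.
      by apply/funext => x; rewrite ReM /= mulr0 subr0.
    exact: (continuousM (s := fun=> Re (symbol_cst^*)) (@cst_continuous _ _ _ _) (cm z)).
  rewrite (_ : (fun x => _) = fun x => Im (symbol_cst^*) * (mpow x alpha * g x)); last first.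
    by apply/funext => x; rewrite ImM /= mulr0 add0r.
  exact: (continuousM (s := fun=> Im (symbol_cst^*)) (@cst_continuous _ _ _ _) (cm z)).
have lim p := hmu.2 phi1 _ (psi p.1) cphi1 (Cc_coef p.1 p.2) (cpsi p.1) i p.2.
have := ccvg_sum pairs lim.
rewrite (_ : (fun n => _) = fun n => \sum_(p <- pairs) cintegral leb setT (piece p (sigma n))); last first.
  apply/funext => n; apply: eq_bigr => p _; congr cintegral; apply/funext => xi.
  by rewrite /piece /psi /w mulrCA.
move=> [cr ci]; have [cr0 ci0] := sum_piece_cvg.
set L := \sum_(p <- pairs) _ in cr ci.
have L0 : L = 0.
  by apply: complexP; [rewrite -(cvg_unique _ cr cr0)|rewrite -(cvg_unique _ ci ci0)].
transitivity (L^*); last by rewrite L0 rmorph0.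
rewrite /L rmorph_sum; apply: eq_bigr => p _.
pose b x := phi1 x * (coef phi k (B p.1) [::] p.2 x)^*.
pose pp (zeta : Rd) : C := symbol_cst^* * (mpow (dir zeta) p.1 * g zeta)%:C.
have cb : Cc Omega b.
  apply: Cc_mul => //; apply: ccontinuous_onJ; have [[c1 c2] _] := Cc_coef p.1 p.2.
  by split; [apply: continuous_subspaceW c1|apply: continuous_subspaceW c2].
have mpp : cmeasurable_on setT pp.
  apply: cmeasurableM; first exact: cmeasurable_cst.
  split => /=; last exact: measurable_cst.
  apply: measurable_funM; last exact: continuous_measurable_rV.
  exact: (measurableT_comp (continuous_measurable_rV (@continuous_mpow p.1)) measurable_dir).
have ppM x : cabs2 (pp x) <= cabs2 symbol_cst.
  rewrite cabs2M cabs2J -[leRHS]mulr1 ler_wpM2l ?cabs2_ge0// cabs2_real exprMn.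
  by rewrite -[leRHS]mulr1 ler_pM ?sqr_ge0//; exact: mpow_direction_le1.
have ib := cradon_integrable_tensor oO (mu i p.2) cb mpp ppM.
transitivity (cradon_integral (cradon_conj (mu i p.2)) X (fun z => b z.1 * pp z.2))^*.
  rewrite -cradon_integral_conj//; apply: eq_cradon_integral => z _.
  exact: conj_tensor.
congr (_^*); apply: eq_cradon_integral => z [_ z2]; rewrite /b /pp /psi.
by rewrite (_ : enorm z.2 = 1)// invr1 scale1r.
Qed.

End Hmeasure_orthogonality.

(** * From tensor products of continuous functions to Borel sets *)

Section bounded_functionals.
Context {R : realType} {d0 : measure_display} {T : measurableType d0}.
Implicit Types (v w : T -> R) (J : (T -> R) -> R).

Definition bmeasurable w := measurable_fun setT w /\ forall x, `|w x| <= 1.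

(* The functionals [w |-> \int w dnu] of finite signed measures [nu]; using them
   instead of charges avoids Jordan decompositions. *)
Definition bfunctional J :=
  (forall v w, bmeasurable v -> bmeasurable w -> J (fun x => v x + w x) = J v + J w) /\
  (forall (w_ : nat -> T -> R) w, (forall n, bmeasurable (w_ n)) -> bmeasurable w ->
    (forall x, w_ ^~ x @ \oo --> w x) -> J (w_ n) @[n --> \oo] --> J w).

Lemma bfunctional_integral (nu : {measure set T -> \bar R}) (X : set T) (a : T -> R) :
  measurable X -> nu.-integrable X (EFin \o a) ->
  bfunctional (fun w => \int[nu]_(x in X) (w x * a x)).
Proof.
move=> mX ia; have ib w : bmeasurable w -> nu.-integrable X (EFin \o (fun x => w x * a x)).
  move=> [mw w1]; apply: (integrable_bddM (c := 1)) => //.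
  exact: measurable_funS mw.
split.
  move=> v w bv bw; under eq_Rintegral do rewrite mulrDl.
  by rewrite RintegralD//; exact: ib.
move=> w_ w bw_ bw cw; have ina : nu.-integrable X (EFin \o (fun x => `|a x|)) := integrable_norm ia.
have ma : measurable_fun X a by apply/measurable_EFinP; exact: (measurable_int _ ia).
have [||||_ //] := @Rdominated_convergence _ _ _ nu X mX (fun n x => w_ n x * a x) (fun x => w x * a x) _ _ _ _ ina.
- by move=> n; apply: measurable_funM => //; apply: (measurable_funS measurableT (@subsetT _ X)); exact: (bw_ n).1.
- by apply: measurable_funM => //; apply: (measurable_funS measurableT (@subsetT _ X)); exact: bw.1.
- by move=> x _; apply: cvgM; [exact: cw|exact: cvg_cst].
by move=> n x _; rewrite lee_fin normrM ler_piMl//; exact: (bw_ n).2.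
Qed.

Lemma bfunctionalD J1 J2 : bfunctional J1 -> bfunctional J2 ->
  bfunctional (fun w => J1 w + J2 w).
Proof.
move=> [a1 c1] [a2 c2]; split=> [v w bv bw|w_ w bw_ bw cw].
  by rewrite a1// a2// addrACA.
by apply: cvgD; [exact: c1|exact: c2].
Qed.

Lemma bfunctionalZ (c : R) J : bfunctional J -> bfunctional (fun w => c * J w).
Proof.
move=> [a1 c1]; split=> [v w bv bw|w_ w bw_ bw cw]; first by rewrite a1// mulrDr.
by apply: cvgM; [exact: cvg_cst|exact: c1].
Qed.

Lemma bfunctional_sum I (s : seq I) (J : I -> (T -> R) -> R) :
  (forall i, bfunctional (J i)) -> bfunctional (fun w => \sum_(i <- s) J i w).
Proof.
move=> bJ; elim: s => [|i s IH].
  rewrite (_ : (fun w => _) = fun=> 0); last by apply/funext => w; rewrite big_nil.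
  by split=> [*|*]; [rewrite addr0|exact: cvg_cst].
rewrite (_ : (fun w => _) = fun w => J i w + \sum_(i <- s) J i w); last first.
  by apply/funext => w; rewrite big_cons.
exact: bfunctionalD.
Qed.

Lemma bmeasurable_indic (A : set T) : measurable A -> bmeasurable (\1_A).
Proof.
move=> mA; split; first exact: measurable_indic.
by move=> x; rewrite indicE; case: (x \in A); rewrite ?normr1 ?normr0.
Qed.

(** The sets with J \1_A = 0 form a lambda-system: complements by additivity and J 1 = 0, countable
    disjoint unions by bounded pointwise convergence of the finite ones. *)
Lemma bfunctional_dynkin J (G : set (set T)) : bfunctional J ->
  @measurable _ T = <<s G >> -> setI_closed G -> J (fun=> 1) = 0 ->
  (forall A, G A -> J \1_A = 0) -> forall A, measurable A -> J \1_A = 0.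
Proof.
move=> [Jadd Jcvg] GE GI J1 JG A; rewrite GE.
have J0 : J (fun=> 0) = 0.
  have b0 : bmeasurable (fun=> 0) by split=> [|x]; [exact: measurable_cst|rewrite normr0].
  have := Jadd _ _ b0 b0; under eq_fun do rewrite addr0.
  by move=> e; apply: (@addrI _ (J (fun=> 0))); rewrite -e addr0.
have JU A1 A2 : measurable A1 -> measurable A2 -> A1 `&` A2 = set0 ->
    J \1_(A1 `|` A2) = J \1_A1 + J \1_A2.
  move=> m1 m2 A12; rewrite -Jadd; [|exact: bmeasurable_indic..].
  congr J; apply/funext => x; rewrite !indicE in_setU.
  have [x1|] := boolP (x \in A1); have [x2|] := boolP (x \in A2) => /=; rewrite ?addr0 ?add0r//.
  by have Ax : (A1 `&` A2) x := conj (set_mem x1) (set_mem x2); rewrite A12 in Ax.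
apply: (@dynkin_induction _ _ G (fun A => J \1_A = 0)) => //.
- by rewrite /= (_ : \1_setT = fun=> 1)//; apply/funext => x; rewrite indicE in_setT.
- move=> S mS JS; have := JU S (~` S) mS (measurableC mS) (setICr _).
  rewrite setUv (_ : \1_setT = fun=> 1) ?J1 ?JS ?add0r//.
  by apply/funext => x; rewrite indicE in_setT.
move=> F mF tF JF; pose U n := \big[setU/set0]_(i < n) F i.
have mU n : measurable (U n) by apply: bigsetU_measurable.
have JUn n : J \1_(U n) = 0.
  elim: n => [|n IH].
    rewrite /U big_ord0 (_ : \1_set0 = fun=> 0)//.
    by apply/funext => x; rewrite indicE in_set0.
  rewrite /U big_ord_recr /= JU; [by rewrite IH JF addr0|exact: (mU n)|exact: mF|].
  rewrite big_distrl /= big1// => i _; move/trivIsetP : tF; apply=> //.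
  by rewrite neq_ltn ltn_ord.
have cv := Jcvg (fun n => \1_(U n)) (\1_(\bigcup_k F k)).
apply/esym; apply: (@cvg_unique _ (@norm_hausdorff R R^o) (J \1_(U n) @[n --> \oo])); last first.
  apply: cv.
  - by move=> n; exact: bmeasurable_indic.
  - by apply: bmeasurable_indic; exact: bigcup_measurable.
  move=> x; have [[k _ Fx]|nx] := pselect ((\bigcup_k F k) x).
    apply: cvg_near_cst; exists k.+1 => // n /= kn.
    rewrite !indicE !mem_set//; first by exists k.
    by rewrite /U -bigcup_mkord; exists k.
  apply: cvg_near_cst; apply: nearW => n; rewrite !indicE !memNset//.
  by rewrite /U -bigcup_mkord => -[k _ Fx]; apply: nx; exists k.
have -> : (fun n => J \1_(U n)) = fun=> 0 by apply/funext.
exact: cvg_cst.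
Qed.

End bounded_functionals.

Section open_rectangles.
Context {R : realType} {d : nat}.
Local Notation Rd := 'rV[R]_d.

Definition open_rectangles : set (set (Rd * Rd)) :=
  [set A | exists U V : set Rd, [/\ open U, open V & A = U `*` V]].

(** The product sigma-algebra is generated by preimages under the two projections, and the preimage
    of an open set is a rectangle with one full side. *)
Lemma open_rectangles_generate : @measurable _ (Rd * Rd)%type = <<s open_rectangles >>.
Proof.
apply/seteqP; split; last first.
  apply: smallest_sub; first exact: sigma_algebra_measurable.
  by move=> _ [U [V [oU oV ->]]]; apply: measurableX; exact: open_measurable_rV.
have [s0 sD sU] := smallest_sigma_algebra setT open_rectangles.
have gen (pr : Rd * Rd -> Rd) : (forall U, open U -> <<s open_rectangles >> (pr @^-1` U)) ->
    forall A : set Rd, measurable A -> <<s open_rectangles >> (pr @^-1` A).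
  move=> ho; rewrite measurable_rVE => A.
  suff : <<s [set A : set Rd | open A] >> `<=` [set A | <<s open_rectangles >> (pr @^-1` A)] by exact.
  apply: smallest_sub; last exact: ho.
  split => /=.
  - by rewrite preimage_set0.
  - by move=> B hB; rewrite setTD preimage_setC -setTD; exact: sD.
  - by move=> F hF; rewrite preimage_bigcup; exact: sU.
apply: smallest_sub; first exact: smallest_sigma_algebra.
move=> A [] [B mB <-]; rewrite setTI; apply: gen => // U oU; apply: sub_sigma_algebra.
  by exists U, setT; split=> //; [exact: openT|rewrite setXT].
by exists setT, U; split=> //; [exact: openT|rewrite setTX].
Qed.

Lemma open_rectangles_setI : setI_closed open_rectangles.
Proof.
move=> _ _ [U [V [oU oV ->]]] [U' [V' [oU' oV' ->]]].
by exists (U `&` U'), (V `&` V'); split; [exact: openI|exact: openI|rewrite setXI].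
Qed.

(** min (1, n h) with h the distance to the complement of U, which is positive exactly on U. If U is
    everything, the infimum would range over an empty set, and the constant 1 is taken. *)
Lemma open_indicator_approx (U : set Rd) : open U ->
  exists g : nat -> Rd -> R, (forall n, continuous (g n)) /\
    (forall n x, 0 <= g n x <= 1) /\ forall x, g ^~ x @ \oo --> (\1_U x : R).
Proof.
move=> oU; have [[a0 /= na0]|U1] := pselect (exists a, ~ U a); last first.
  exists (fun _ _ => 1); split; first by move=> n; exact: cst_continuous.
  split; first by move=> n x; rewrite ler01 lexx.
  move=> x; rewrite indicE mem_set; last by apply: contrapT => nx; apply: U1; exists x.
  exact: cvg_cst.
pose S x := [set `|x - a| | a in ~` U].
pose h x := inf (S x).
have S0 x : S x !=set0 by exists `|x - a0|; exists a0.
have Slb x : lbound (S x) 0 by move=> _ [a _ <-].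
have hS x a : ~ U a -> h x <= `|x - a|.
  by move=> na; apply: ge_inf; [exists 0; exact: Slb|exists a].
have h0 x : 0 <= h x by apply: lb_le_inf.
have hL x y : h x - h y <= `|x - y|.
  rewrite lerBlDr -lerBlDl; apply: lb_le_inf => // _ [a na <-]; rewrite lerBlDl.
  apply: (le_trans (hS x a na)).
  by rewrite (_ : x - a = (x - y) + (y - a)) ?ler_normD// addrA subrK.
have ch : continuous h.
  move=> x; suff H : h y @[y --> nbhs x] --> h x by exact: H.
  apply/cvgrPdist_lt => /= e e0; have /cvgrPdist_lt/(_ e e0) : id y @[y --> nbhs x] --> x by exact: cvg_id.
  apply: filterS => y /= xy; rewrite (le_lt_trans _ xy)// ler_norml hL andbT.
  by have := hL y x; rewrite distrC; lra.
pose g n x := Num.min 1 (n%:R * h x).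
exists g; split.
  move=> n x; have c1 : {for x, continuous (fun _ : Rd => 1 : R)} by exact: cst_continuous.
  have c2 : {for x, continuous (fun y => n%:R * h y)}.
    by apply: (continuousM (s := fun=> n%:R)); [exact: cst_continuous|exact: ch].
  exact: (continuous_min c1 c2).
split.
  by move=> n x; rewrite /g le_min ler01 mulr_ge0//= ge_min lexx.
move=> x; have [Ux|nU] := pselect (U x); last first.
  rewrite indicE memNset//=; apply: cvg_near_cst; apply: nearW => n.
  have hx0 : h x = 0 by apply/eqP; rewrite eq_le h0 andbT (le_trans (hS x x nU))// subrr normr0.
  by rewrite /g hx0 mulr0 min_r.
have hx : 0 < h x.
  have /nbhs_ballP[e /= e0 xe] : nbhs x U by exact: open_nbhs_nbhs.
  apply: (lt_le_trans e0); apply: lb_le_inf => // _ [a na <-].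
  rewrite leNgt; apply/negP => xa; apply: na; apply: xe.
  by rewrite -ball_normE /=.
rewrite indicE mem_set//=; apply: cvg_near_cst.
exists (Num.truncn (h x)^-1).+1 => // n /= hn; rewrite /g; apply/min_idPl.
rewrite -ler_pdivrMr// div1r; apply: ltW; apply: lt_le_trans (truncnS_gt _) _.
by rewrite ler_nat.
Qed.

Lemma bfunctional_tensor (J : (Rd * Rd -> R) -> R) : bfunctional J ->
  (forall g f : Rd -> R, continuous g -> continuous f ->
     (forall x, 0 <= g x <= 1) -> (forall x, 0 <= f x <= 1) ->
     J (fun z => g z.1 * f z.2) = 0) ->
  forall A, measurable A -> J \1_A = 0.
Proof.
move=> bJ JT; apply: (bfunctional_dynkin bJ open_rectangles_generate open_rectangles_setI).
  have := JT (fun=> 1) (fun=> 1); under [X in J X]eq_fun do rewrite mulr1.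
  by apply; rewrite ?ler01 ?lexx//; exact: cst_continuous.
move=> _ [U [V [oU oV ->]]].
have [g [cg [g01 gU]]] := open_indicator_approx oU.
have [f [cf [f01 fV]]] := open_indicator_approx oV.
have b n : bmeasurable (fun z : Rd * Rd => g n z.1 * f n z.2).
  split.
    apply: measurable_funM.
      exact: (measurableT_comp (continuous_measurable_rV (cg n)) measurable_fst).
    exact: (measurableT_comp (continuous_measurable_rV (cf n)) measurable_snd).
  move=> z; have /andP[a1 a2] := g01 n z.1; have /andP[b1 b2] := f01 n z.2.
  by rewrite ger0_norm ?mulr_ge0// mulr_ile1.
have mUV : measurable (U `*` V) by apply: measurableX; exact: open_measurable_rV.
have := bJ.2 _ _ b (bmeasurable_indic mUV).
have -> : (fun n => J (fun z => g n z.1 * f n z.2)) = fun=> 0.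
  by apply/funext => n; exact: JT.
move=> H; have cw z : g n z.1 * f n z.2 @[n --> \oo] --> (\1_(U `*` V) z : R).
  rewrite (_ : \1_(U `*` V) z = \1_U z.1 * \1_V z.2 :> R).
    by apply: cvgM; [exact: gU|exact: fV].
  by rewrite !indicE in_setX -natrM mulnb.
by rewrite -(cvg_lim _ (H cw))// lim_cst.
Qed.

End open_rectangles.

Section measure_conclusion.
Context {R : realType} {d r q m : nat}.
Local Notation Rd := 'rV[R]_d.
Local Notation C := R[i].
Local Notation mi := (@mindex d m).
Local Notation dir xi := ((enorm xi)^-1 *: xi).
Variable Omega : set Rd.
Hypothesis oO : open Omega.
Let X := Omega `*` unit_sphere R d.
Implicit Types (mu : cradon X) (F : Rd * Rd -> C).

Let mX : measurable X. Proof. exact: measurable_cotangent. Qed.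

Lemma cradon_integral_indic mu E F : E `<=` X ->
  cradon_integral mu E F = cradon_integral mu X (fun z => (\1_E z)%:C * F z).
Proof.
move=> EX; have h (nu : {measure set (Rd * Rd) -> \bar R}) (p : C -> R) :
    (forall (t : R) z, p (t%:C * z) = t * p z) ->
    \int[nu]_(z in E) p (F z) = \int[nu]_(z in X) p ((\1_E z)%:C * F z).
  move=> pZ; rewrite Rintegral_mkcond [RHS]Rintegral_mkcond; apply: eq_Rintegral => z _.
  rewrite !patchE pZ indicE; have [zE|zE] := boolP (z \in E).
    by rewrite (mem_set (EX _ (set_mem zE))) mul1r.
  by rewrite mul0r; case: ifP.
have hr (nu : {measure set (Rd * Rd) -> \bar R}) : \int[nu]_(z in E) Re (F z) = \int[nu]_(z in X) Re ((\1_E z)%:C * F z).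
  by apply: (h nu (fun z => Re z)) => t z; rewrite ReM /= mul0r subr0.
have hi (nu : {measure set (Rd * Rd) -> \bar R}) : \int[nu]_(z in E) Im (F z) = \int[nu]_(z in X) Im ((\1_E z)%:C * F z).
  by apply: (h nu (fun z => Im z)) => t z; rewrite ImM /= mul0r addr0.
by rewrite /cradon_integral /cintegral !hr !hi.
Qed.

Lemma cradon_integrable_bmeasurable mu w F : bmeasurable w -> cradon_integrable mu F ->
  cradon_integrable mu (fun z => (w z)%:C * F z).
Proof.
move=> [mw w1] [i1 i2 i3 i4].
have h (nu : {measure set (Rd * Rd) -> \bar R}) : cintegrable nu X F ->
    cintegrable nu X (fun z => (w z)%:C * F z).
  move=> [ir ii]; have mwX := measurable_funS measurableT (@subsetT _ X) mw.
  split.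
    rewrite (_ : (fun z => _) = fun z => w z * Re (F z)).
      exact: (integrable_bddM mX mwX (fun z _ => w1 z) ir).
    by apply/funext => z; rewrite ReM /= mul0r subr0.
  rewrite (_ : (fun z => _) = fun z => w z * Im (F z)).
    exact: (integrable_bddM mX mwX (fun z _ => w1 z) ii).
  by apply/funext => z; rewrite ImM /= mul0r addr0.
by split; exact: h.
Qed.

Lemma bfunctional_cradon mu F : cradon_integrable mu F ->
  bfunctional (fun w => Re (cradon_integral mu X (fun z => (w z)%:C * F z))) /\
  bfunctional (fun w => Im (cradon_integral mu X (fun z => (w z)%:C * F z))).
Proof.
move=> [[r1 m1] [r2 m2] [r3 m3] [r4 m4]].
have er (nu : {measure set (Rd * Rd) -> \bar R}) w :
    \int[nu]_(z in X) Re ((w z)%:C * F z) = \int[nu]_(z in X) (w z * Re (F z)).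
  by apply: eq_Rintegral => z _; rewrite ReM /= mul0r subr0.
have ei (nu : {measure set (Rd * Rd) -> \bar R}) w :
    \int[nu]_(z in X) Im ((w z)%:C * F z) = \int[nu]_(z in X) (w z * Im (F z)).
  by apply: eq_Rintegral => z _; rewrite ImM /= mul0r addr0.
have B := bfunctional_integral; have Z := bfunctionalZ (-1).
split.
  rewrite (_ : (fun w => _) = fun w =>
      (\int[rpos mu]_(z in X) (w z * Re (F z)) + -1 * \int[rneg mu]_(z in X) (w z * Re (F z))) +
      (-1 * \int[ipos mu]_(z in X) (w z * Im (F z)) + \int[ineg mu]_(z in X) (w z * Im (F z)))).
    apply: bfunctionalD; apply: bfunctionalD; [exact: B|apply: bfunctionalZ; exact: B| |exact: B].
    by apply: bfunctionalZ; exact: B.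
  by apply/funext => w; rewrite !(ReD, ReM, ImD, ReN, ImN) /= !er !ei; ring.
rewrite (_ : (fun w => _) = fun w =>
    (\int[rpos mu]_(z in X) (w z * Im (F z)) + -1 * \int[rneg mu]_(z in X) (w z * Im (F z))) +
    (\int[ipos mu]_(z in X) (w z * Re (F z)) + -1 * \int[ineg mu]_(z in X) (w z * Re (F z)))).
  apply: bfunctionalD; apply: bfunctionalD; [exact: B| |exact: B|].
    by apply: bfunctionalZ; exact: B.
  by apply: bfunctionalZ; exact: B.
by apply/funext => w; rewrite !(ReD, ImM, ImD, ReN, ImN) /= !er !ei; ring.
Qed.

Lemma real_weights (s t a b : R) (c e : C) :
  (s * t)%:C * (a%:C * c * (e * b%:C)) = ((s * a)%:C)^* * c * (e * (b * t)%:C).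
Proof. by apply: complexP; rewrite !(ReM, ImM, ReJ, ImJ) /=; ring. Qed.

Variables (u : nat -> Rd -> 'cV[C]_r) (sigma : nat -> nat) (mu : 'I_r -> 'I_r -> cradon X)
  (B : mi -> Rd -> 'M[C]_(q, r)) (k : 'I_q) (i : 'I_r).
Hypothesis hu : weak_cvg0_L2loc Omega u.
Hypothesis sigma_incr : {homo sigma : a b / (a < b)%N}.
Hypothesis hmu : is_Hmeasure (fun n => u (sigma n)) mu.
Hypothesis cB : forall alpha k j, ccontinuous_on Omega (fun x => B alpha x k j).
Hypothesis mQ : forall phi, test_fun Omega phi -> forall n,
  cmeasurable_on setT (symbol_fourier u B phi k n).
Hypothesis Q0 : forall phi, test_fun Omega phi ->
  ev0 (fun n => \int[lebesgue_rV d]_xi (cabs2 (symbol_fourier u B phi k n xi))%:E)%E.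

(** The cutoff chi is at least c on the projection K1 of a compact set containing E. In kap = chi /
    max (chi, c)^2 the numerator keeps the support compact and the maximum keeps kap continuous,
    while kap = 1 / chi on K1. *)
Lemma principal_symbol_null E : bounded_borel X E ->
  \sum_j cradon_integral (mu i j) E (fun z => principal_symbol B z k j) = 0.
Proof.
move=> [mE [K0 [cK0 K0X] EK0]].
have EX : E `<=` X by exact: subset_trans K0X.
pose K1 := fst @` K0.
have hK1 : compact_in K1 Omega.
  split; last by move=> _ [z /K0X[z1 _] <-].
  by apply: continuous_compact => //; apply: continuous_subspaceT => z; exact: cvg_fst.
have [chi [schi chi0 [cS SO] [c c0 chic]]] := smooth_cutoff oO hK1.
pose phi (x : Rd) : C := (chi x)%:C.
have phiS : csupport phi `<=` closure [set x | chi x != 0].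
  by apply: closureS => x /=; apply: contraNneq => e; rewrite /phi e.
have tphi : test_fun Omega phi.
  split => /=; [exact: schi|exact: smooth_cst|].
  exact: csupport_compact_in phiS (conj cS SO).
(* phi * kap = 1 on K1. *)
pose kap (x : Rd) : R := chi x * (Num.max (chi x) c)^-1 ^+ 2.
have max0 x : 0 < Num.max (chi x) c by rewrite lt_max c0 orbT.
have ckap : continuous kap.
  move=> x; have cchi : {for x, continuous chi} by exact: smooth_continuous.
  have c1 : {for x, continuous (fun y => Num.max (chi y) c)}.
    by apply: (continuous_max cchi); exact: cst_continuous.
  have c2 : {for x, continuous (fun y => (Num.max (chi y) c)^-1)}.
    by apply: continuousV => //; rewrite gt_eqF.
  have c3 := @continuous_comp _ _ _ (fun y => (Num.max (chi y) c)^-1) (fun t : R => t ^+ 2)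
    x c2 (@exprn_continuous _ 2 _).
  exact: (continuousM cchi c3).
have kap1 x : K1 x -> kap x * chi x = 1.
  move=> /chic cx; rewrite /kap (max_idPl cx) mulrAC -expr2 -exprMn divff ?expr1n//.
  by rewrite gt_eqF// (lt_le_trans c0).
pose hb (p : mi * 'I_r) (x : Rd) : C := (kap x)%:C * coef phi k (B p.1) [::] p.2 x.
pose hp (p : mi * 'I_r) (zeta : Rd) : C := @symbol_cst R m * (mpow (dir zeta) p.1)%:C.
have cK (a : Rd -> R) : continuous a -> Cc Omega (fun x => (a x * kap x)%:C).
  move=> ca; have sub : csupport (fun x => (a x * kap x)%:C) `<=` closure [set x | chi x != 0].
    by apply: closureS => x /=; apply: contraNneq => e; rewrite /kap e mul0r mulr0.
  split; last exact: csupport_compact_in sub (conj cS SO).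
  split; apply: continuous_subspaceT => x /=; last exact: cst_continuous.
  by apply: (continuousM (s := a)); [exact: ca|exact: ckap].
have chb p : Cc Omega (hb p).
  have := cK (fun=> 1) (@cst_continuous _ _ _); under [X in Cc _ X]eq_fun do rewrite mul1r.
  move=> h; apply: Cc_mul => //; have [[c1 c2] _] := Cc_coef k oO cB tphi p.1 p.2.
  by split; [apply: continuous_subspaceW c1|apply: continuous_subspaceW c2].
have mhp p : cmeasurable_on setT (hp p).
  apply: cmeasurableM; first exact: cmeasurable_cst.
  split => /=; last exact: measurable_cst.
  exact: (measurableT_comp (continuous_measurable_rV (@continuous_mpow _ _ _ p.1)) measurable_dir).
have hpM p x : cabs2 (hp p x) <= cabs2 (@symbol_cst R m).
  rewrite cabs2M cabs2_real -[leRHS]mulr1 ler_wpM2l ?cabs2_ge0//.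
  exact: mpow_direction_le1.
pose G (p : mi * 'I_r) z := hb p z.1 * hp p z.2.
have iG p : cradon_integrable (mu i p.2) (G p).
  exact: (cradon_integrable_tensor oO (mu i p.2) (chb p) (mhp p) (hpM p)).
pose pairs : seq (mi * 'I_r) := [seq (alpha, j) | alpha <- top_indices, j <- index_enum 'I_r].
(* For w = g f this is the sum in [Hmeasure_orthogonal_pairs] with phi_1 = g kap; for the indicator
   of E it is the sum to be computed. *)
pose J w := \sum_(p <- pairs) cradon_integral (mu i p.2) X (fun z => (w z)%:C * G p z).
have JT (g f : Rd -> R) : continuous g -> continuous f ->
    (forall x, 0 <= g x <= 1) -> (forall x, 0 <= f x <= 1) -> J (fun z => g z.1 * f z.2) = 0.
  move=> cg cf g01 f01.
  rewrite -(Hmeasure_orthogonal_pairs oO hu sigma_incr hmu cB tphi (mQ tphi) (Q0 tphi)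
     i (cK g cg) cf f01).
  apply: eq_bigr => p _; apply: eq_cradon_integral => z _.
  exact: real_weights.
have J0 : J \1_E = 0.
  apply: complexP.
    pose Jr w := Re (J w).
    have -> : Re (J \1_E) = Jr \1_E by [].
    apply: bfunctional_tensor => //; last by move=> g f cg cf g01 f01; rewrite /Jr JT.
    rewrite /Jr /J; under eq_fun do rewrite Re_sum.
    by apply: bfunctional_sum => p; exact: (bfunctional_cradon (iG p)).1.
  pose Ji w := Im (J w).
  have -> : Im (J \1_E) = Ji \1_E by [].
  apply: bfunctional_tensor => //; last by move=> g f cg cf g01 f01; rewrite /Ji JT.
  rewrite /Ji /J; under eq_fun do rewrite Im_sum.
  by apply: bfunctional_sum => p; exact: (bfunctional_cradon (iG p)).2.
rewrite -[RHS]J0 /J big_allpairs exchange_big /=; apply: eq_bigr => j _.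
rewrite cradon_integral_indic// -cradon_integral_sum//; last first.
  move=> alpha; have := iG (alpha, j); apply: cradon_integrable_bmeasurable.
  exact: bmeasurable_indic.
apply: eq_cradon_integral => z _; rewrite -mulr_sumr.
have [zE|zE] := boolP (z \in E); last by rewrite indicE (negbTE zE) !mul0r.
congr (_ * _); rewrite /principal_symbol summxE /top_indices big_filter; apply: eq_bigr => alpha _.
have K1z : K1 z.1 by exists z => //; apply: EK0; exact: set_mem.
rewrite !mxE /G /hb /hp /coef /symbol_cst cpartials_nil /phi /=.
(* On E the factor kap cancels the cutoff hidden in [coef]. *)
have e : (kap z.1)%:C * (chi z.1)%:C = 1 :> C.
  by apply: complexP; rewrite !(ReM, ImM) /= ?mulr0 ?mul0r ?subr0 ?addr0 ?kap1.
by rewrite [RHS]mulrC [(kap _)%:C * _]mulrA e mul1r.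
Qed.

End measure_conclusion.

Theorem corollary8 (R : realType) (d r q m l : nat) (Omega : set 'rV[R]_d)
    (u : nat -> 'rV[R]_d -> 'cV[R[i]]_r)
    (eps : nat -> R) (eps_0 eps_infty : R)
    (A : nat -> @mindex d m -> 'rV[R]_d -> 'M[R[i]]_(q, r))
    (Alim : @mindex d m -> 'rV[R]_d -> 'M[R[i]]_(q, r))
    (f : nat -> 'I_q -> sdistribution Omega)
    (sigma : nat -> nat)
    (mu : 'I_r -> 'I_r -> cradon (Omega `*` unit_sphere R d)) :
  open Omega ->
  (l <= m)%N ->
  weak_cvg0_L2loc Omega u ->
  0 < eps_0 ->
  (forall n, eps_0 <= eps n <= eps_infty) ->
  (forall n (alpha : @mindex d m), (l <= mlen alpha <= m)%N ->
    forall k j, ccontinuous_on Omega (fun x => A n alpha x k j)) ->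
  (forall alpha : @mindex d m, (l <= mlen alpha <= m)%N ->
    cvg_loc_unif Omega (fun n => A n alpha) (Alim alpha)) ->
  (forall n, Hneg_loc m (f n)) ->
  (forall n k phi, test_fun Omega phi ->
    \sum_(alpha : @mindex d m | (l <= mlen alpha <= m)%N)
      (eps n ^+ (mlen alpha - l))%:C *
      weak_partial Omega alpha (fun x => (A n alpha x *m u n x) k ord0) phi =
    f n k phi) ->
  (forall phi, test_fun Omega phi ->
    (\int[lebesgue_rV d]_xi
      (vabs2 (fourier_distv (f n) phi xi) /
       (1 + \sum_(l <= s < m.+1) eps n ^+ (s - l) * enorm xi ^+ s) ^+ 2)%:E)%E
    @[n --> \oo] --> 0%E) ->
  {homo sigma : a b / (a < b)%N} ->
  is_Hmeasure (fun n => u (sigma n)) mu ->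
  forall E, bounded_borel (Omega `*` unit_sphere R d) E ->
    mul_tr_radon (principal_symbol Alim) mu E = 0.
Proof.
move=> oO lm hu e0 heps cA hA _ pde hF sigma_incr hmu E hE; apply/matrixP => k i; rewrite !mxE.
(* The conclusion involves only |alpha| = m, and continuity of the limits is known only for l <=
   |alpha| <= m; setting the others to 0 makes all coefficients continuous. *)
pose B alpha := if mlen alpha == m then Alim alpha else fun=> 0.
have sE phi n : symbol_fourier u B phi k n = symbol_fourier u Alim phi k n.
  by apply/funext => xi; apply: eq_bigr => alpha am; rewrite /B am.
have pE : principal_symbol Alim = principal_symbol B.
  by apply/funext => z; apply: eq_bigr => alpha am; rewrite /B am.
rewrite pE; apply: (principal_symbol_null oO i hu sigma_incr hmu _ _ _ hE).
- move=> alpha k' j; rewrite /B; case: eqP => am.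
    by apply: (cAlim oO cA hA); rewrite am lm leqnn.
  by split; under eq_fun do rewrite mxE; apply: continuous_subspaceT; exact: cst_continuous.
- by move=> phi tphi n; rewrite sE; exact: (measurable_symbol_fourier oO lm hu cA hA k tphi).
move=> phi tphi; under eq_fun do under eq_integral do rewrite sE.
apply: (symbol_fourier_null oO lm hu e0 heps cA hA pde tphi).
have F0 n xi : (0 <= (vabs2 (fourier_distv (f n) phi xi) / @damping R d m l eps n xi ^+ 2)%:E)%E.
  by rewrite lee_fin divr_ge0 ?sqr_ge0// sumr_ge0// => j _; exact: cabs2_ge0.
have ev := ev0_cvg (fun n => integral_ge0 _ (fun xi _ => F0 n xi)) (hF phi tphi).
apply: (ev0_le _ ev) => n.
have mF k' := measurable_fourier_dist oO hu cA pde k' tphi n.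
have mW := @measurable_invr_damping R d m l eps n.
apply: ge0_le_integral => //.
- by move=> xi _; rewrite lee_fin divr_ge0 ?cabs2_ge0 ?sqr_ge0.
- by apply/measurable_EFinP; apply: measurable_funM => //; exact: measurable_cabs2.
- apply/measurable_EFinP; apply: measurable_funM => //.
  apply: measurable_sum => k'; apply: measurable_cabs2.
  by under eq_fun do rewrite mxE; exact: mF.
move=> xi _; rewrite lee_fin ler_wpM2r ?invr_ge0 ?sqr_ge0//.
(* The squared modulus of the k-th component is at most that of the whole vector. *)
rewrite /vabs2 (bigD1 k)//= mxE lerDl sumr_ge0// => j _; exact: cabs2_ge0.
Qed.
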